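(* Assume that $\omega(A_0)=p/q$ and $\omega'(A_0)\ne0$. Assume that there exists $\kappa\ge0$ such that $M_{k'}(t_0)$ vanishes identically in $t_0$ for all $k'=0,\dots,\kappa-1$, and that there exist $t_0\in[0,2\pi)$ and an odd $\mathfrak n\in\mathbb N$ such that $\frac{d^jM_\kappa}{dt_0^j}(t_0)=0$ for $0\le j\le\mathfrak n-1$ and $\frac{d^{\mathfrak n}M_\kappa}{dt_0^{\mathfrak n}}(t_0)\ne0$. Then for $\varepsilon$ small enough the system $$\dot\alpha=\omega(A)+\varepsilon F(\alpha,A,t),\qquad \dot A=\varepsilon G(\alpha,A,t)$$ has at least one subharmonic solution of order $q/p$. Such a solution admits a convergent power series in $|\varepsilon|^{1/\mathfrak n!}$, and hence a convergent Puiseux series in $|\varepsilon|$.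
   Context: Setting: $W\subset\mathbb R$ is open, $\mathbb T=\mathbb R/2\pi\mathbb Z$, $\omega:W\to\mathbb R$ is real analytic, and $F,G$ are real-analytic real-valued functions of $(\alpha,A,t)\in\mathbb T\times W\times\mathbb R$, $2\pi$-periodic in $\alpha$ and in $t$; $\varepsilon$ is a real parameter. Fix $A_0\in W$ with $\omega(A_0)=p/q$, where $p,q$ are relatively prime integers, $q\ge1$, $p\ne0$. Put $\alpha_0(t)=\omega(A_0)t$, $T=2\pi q$. A subharmonic solution of order $q/p$ (with initial phase $t_0$) is a solution $(\alpha(t),A(t))$ of $\dot\alpha=\omega(A)+\varepsilon F(\alpha,A,t+t_0)$, $\dot A=\varepsilon G(\alpha,A,t+t_0)$ (the given system with time shifted by $t_0$), depending on $\varepsilon$, such that $\alpha(t)-\alpha_0(t)$ and $A(t)-A_0$ are $T$-periodic in $t$ and tend to $0$ as $\varepsilon\to0$. It admits a convergent power series in $|\varepsilon|^{1/\mathfrak n!}$ if, for each fixed sign of $\varepsilon$, $\alpha(t)-\alpha_0(t)$ and $A(t)-A_0$ are given for $|\varepsilon|$ small by convergent power series in $|\varepsilon|^{1/\mathfrak n!}$ with $T$-periodic coefficients (which may depend on the sign of $\varepsilon$). Auxiliary system and higher order Melnikov functions. Let $t_0\in[0,2\pi)$. For $\alpha=\alpha_0+\beta$, $A=A_0+B$ with $\beta,B$ $T$-periodic, let $\Gamma(t)=\varepsilon G(\alpha(t),A(t),t+t_0)$, $\Phi(t)=\varepsilon F(\alpha(t),A(t),t+t_0)+\omega(A(t))-\omega(A_0)-\omega'(A_0)(A(t)-A_0)$,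 and let a subscript $\nu\in\mathbb Z$ denote the coefficient of $e^{i\nu t/q}$ in the Fourier series. For $\beta_0\in\mathbb R$ (small) the auxiliary system is: the zeroth Fourier coefficient of $\beta$ equals the free parameter $\beta_0$, $\beta_\nu=\frac{\Phi_\nu}{i\nu/q}+\omega'(A_0)\frac{\Gamma_\nu}{(i\nu/q)^2}$ and $B_\nu=\frac{\Gamma_\nu}{i\nu/q}$ for $\nu\neq0$, and $B_0=-\Phi_0/\omega'(A_0)$. It has a unique solution which is a power series in $(\varepsilon,\beta_0)$ with $\beta_\nu$ ($\nu\ne0$) and $B_\nu$ of order at least $1$ in $\varepsilon$. Along this solution $\Gamma$ is denoted $\overline\Gamma$, and its mean is $\overline\Gamma_0=\sum_{k\ge1}\varepsilon^k\,\overline\Gamma^{(k)}_0(\beta_0,t_0)$. Define $M_k(t_0):=\overline\Gamma_0^{(k+1)}(0,t_0)$, $k\ge0$; in particular $M_0(t_0)=\frac1T\int_0^TG(\alpha_0(t),A_0,t+t_0)\,dt$. *)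

(* Defs.v *)
From Stdlib Require Import Reals ZArith Znumtheory ClassicalEpsilon.
From Coquelicot Require Import Coquelicot.
Open Scope R_scope.

Definition analytic_at (f : R -> R) (x : R) : Prop :=
  exists (a : nat -> R) (r : R), 0 < r /\
    forall h, Rabs h < r -> is_pseries a h (f (x + h)).

(** The bound on the coefficients makes the triple series absolutely convergent
    on the polydisc of radius [r], so the order of summation is immaterial. *)
Definition analytic3_at (f : R -> R -> R -> R) (x y z : R) : Prop :=
  exists (a : nat -> nat -> nat -> R) (r K : R), 0 < r /\
    (forall i j k, Rabs (a i j k) * r ^ (i + j + k) <= K) /\
    (forall h1 h2 h3, Rabs h1 < r -> Rabs h2 < r -> Rabs h3 < r ->
       f (x + h1) (y + h2) (z + h3) =
       PSeries (fun i => PSeries (fun j => PSeries (fun k => a i j k) h3) h2) h1).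

(** Real-analytic functions of [(alpha, A, t)] in T x W x R, 2 pi-periodic in
    [alpha] and [t]; the values at [A] outside [W] are irrelevant. *)
Definition analytic_forcing (W : R -> Prop) (f : R -> R -> R -> R) : Prop :=
  (forall a A t, W A -> analytic3_at f a A t) /\
  (forall a A t, W A -> f (a + 2 * PI) A t = f a A t) /\
  (forall a A t, W A -> f a A (t + 2 * PI) = f a A t).

Definition periodic (T : R) (f : R -> R) : Prop := forall t, f (t + T) = f t.

Definition period (q : Z) : R := 2 * PI * IZR q.

(** Coefficient of [exp (i nu t / q)], i.e. the mean over a period of
    [f t * exp (- i nu t / q)], as a pair (real part, imaginary part). *)
Definition fourier (q : Z) (f : R -> R) (nu : Z) : C :=
  (RInt (fun t => f t * cos (IZR nu * t / IZR q)) 0 (period q) / period q,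
   - (RInt (fun t => f t * sin (IZR nu * t / IZR q)) 0 (period q) / period q)).

(** Coefficients, indexed by [k j], of [eps ^ k * beta0 ^ j]; they are
    functions of [t]. *)
Definition coeffs : Type := nat -> nat -> R -> R.

Definition sum_coeffs (c : coeffs) (eps beta0 t : R) : R :=
  PSeries (fun k => PSeries (fun j => c k j t) beta0) eps.

Definition Gamma (G : R -> R -> R -> R) (om : R -> R) (A0 t0 eps : R)
    (beta B : R -> R) (t : R) : R :=
  eps * G (om A0 * t + beta t) (A0 + B t) (t + t0).

Definition Phi (F : R -> R -> R -> R) (om : R -> R) (A0 t0 eps : R)
    (beta B : R -> R) (t : R) : R :=
  eps * F (om A0 * t + beta t) (A0 + B t) (t + t0)
  + om (A0 + B t) - om A0 - Derive om A0 * B t.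

Definition aux_equations (F G : R -> R -> R -> R) (om : R -> R) (A0 : R)
    (q : Z) (t0 eps beta0 : R) (beta B : R -> R) : Prop :=
  let Ga := fourier q (Gamma G om A0 t0 eps beta B) in
  let Ph := fourier q (Phi F om A0 t0 eps beta B) in
  let om' := RtoC (Derive om A0) in
  let D := fun nu : Z => (Ci * RtoC (IZR nu / IZR q))%C in
  fourier q beta 0 = RtoC beta0 /\
  (forall nu, nu <> 0%Z ->
     fourier q beta nu = (Ph nu / D nu + om' * (Ga nu / (D nu * D nu)))%C) /\
  (forall nu, nu <> 0%Z -> fourier q B nu = (Ga nu / D nu)%C) /\
  fourier q B 0 = (- (Ph 0%Z / om'))%C.

(** The pair [(b, a)] of coefficient families for [(beta, B)] is a solution of
    the auxiliary system as a convergent power series in [(eps, beta0)], whose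
    nonzero modes of [beta] and all modes of [B] have order at least 1 in
    [eps].  Under the standing hypotheses such a pair exists and is unique, so that
    the choice in [aux_sol] below is forced. *)
Definition aux_solution (W : R -> Prop) (F G : R -> R -> R -> R) (om : R -> R)
    (A0 : R) (q : Z) (t0 : R) (s : coeffs * coeffs) : Prop :=
  let (b, a) := s in
  (forall k j, periodic (period q) (b k j) /\ periodic (period q) (a k j)) /\
  (forall k j t, continuous (b k j) t /\ continuous (a k j) t) /\
  (forall j nu, nu <> 0%Z -> fourier q (b 0%nat j) nu = RtoC 0) /\
  (forall j nu, fourier q (a 0%nat j) nu = RtoC 0) /\
  exists r K : R, 0 < r /\
    (forall k j t, Rabs (b k j t) * r ^ (k + j) <= K /\
                   Rabs (a k j t) * r ^ (k + j) <= K) /\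
    (forall eps beta0, Rabs eps < r -> Rabs beta0 < r ->
       (forall t, W (A0 + sum_coeffs a eps beta0 t)) /\
       aux_equations F G om A0 q t0 eps beta0
         (sum_coeffs b eps beta0) (sum_coeffs a eps beta0)).

Definition aux_sol (W : R -> Prop) (F G : R -> R -> R -> R) (om : R -> R)
    (A0 : R) (q : Z) (t0 : R) : coeffs * coeffs :=
  epsilon (inhabits (fun _ _ _ => 0, fun _ _ _ => 0))
    (aux_solution W F G om A0 q t0).

Definition Gammabar (W : R -> Prop) (F G : R -> R -> R -> R) (om : R -> R)
    (A0 : R) (q : Z) (t0 eps beta0 : R) : R -> R :=
  let s := aux_sol W F G om A0 q t0 in
  Gamma G om A0 t0 eps (sum_coeffs (fst s) eps beta0)
    (sum_coeffs (snd s) eps beta0).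

Definition Gammabar_mean (W : R -> Prop) (F G : R -> R -> R -> R) (om : R -> R)
    (A0 : R) (q : Z) (t0 eps beta0 : R) : R :=
  RInt (Gammabar W F G om A0 q t0 eps beta0) 0 (period q) / period q.

(** Coefficient of [eps ^ k] in the expansion of the mean, which is analytic
    in [eps] near 0. *)
Definition Gammabar_coeff (W : R -> Prop) (F G : R -> R -> R -> R)
    (om : R -> R) (A0 : R) (q : Z) (k : nat) (beta0 t0 : R) : R :=
  Derive_n (fun eps => Gammabar_mean W F G om A0 q t0 eps beta0) k 0
  / INR (fact k).

Definition Melnikov (W : R -> Prop) (F G : R -> R -> R -> R) (om : R -> R)
    (A0 : R) (q : Z) (k : nat) (t0 : R) : R :=
  Gammabar_coeff W F G om A0 q (S k) 0 t0.

Definition is_solution (W : R -> Prop) (F G : R -> R -> R -> R) (om : R -> R)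
    (t0 eps : R) (al A : R -> R) : Prop :=
  forall t, W (A t) /\
    is_derive al t (om (A t) + eps * F (al t) (A t) (t + t0)) /\
    is_derive A t (eps * G (al t) (A t) (t + t0)).

Definition tends_to_0 (f : R -> R -> R) : Prop :=
  forall eta, 0 < eta -> exists delta, 0 < delta /\
    forall eps t, Rabs eps < delta -> Rabs (f eps t) < eta.

(** [al] and [A] are families of functions of [t] indexed by [eps], only
    meaningful for [eps] small. *)
Definition subharmonic_solution (W : R -> Prop) (F G : R -> R -> R -> R)
    (om : R -> R) (A0 : R) (q : Z) (t0 : R) (al A : R -> R -> R) : Prop :=
  (exists eps1, 0 < eps1 /\ forall eps, Rabs eps < eps1 ->
     is_solution W F G om t0 eps (al eps) (A eps) /\
     periodic (period q) (fun t => al eps t - om A0 * t) /\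
     periodic (period q) (fun t => A eps t - A0)) /\
  tends_to_0 (fun eps t => al eps t - om A0 * t) /\
  tends_to_0 (fun eps t => A eps t - A0).

(** For each sign [s] of [eps], [f eps t] is for small [eps] the sum of a power
    series in [|eps| ^ (1 / N)] with [T]-periodic coefficients, convergent
    uniformly in [t].  [eps = 0] is left out since [Rpower 0 _] is not 0. *)
Definition fractional_power_series (T : R) (N : nat) (f : R -> R -> R) : Prop :=
  forall s : R, s = 1 \/ s = -1 ->
  exists (c : nat -> R -> R) (r K : R), 0 < r /\
    (forall k, periodic T (c k)) /\
    (forall k t, Rabs (c k t) * r ^ k <= K) /\
    (forall eps t, 0 < s * eps -> Rpower (Rabs eps) (/ INR N) < r ->
       is_pseries (fun k => c k t) (Rpower (Rabs eps) (/ INR N)) (f eps t)).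

(* Main.v *)
(** Write [beta = Y + eps * bh] and [B = eps * Bh].  The auxiliary system, read as
    integral equations with the zero-mean periodic antiderivative, becomes a fixed
    point problem for [(bh, Bh)] in which the coefficients of order [k] in [eps]
    are determined by those of lower order.  It therefore has exactly one formal
    solution, and a majorant bound on the iterates in a weighted [l^1] norm makes
    this solution converge.

    Shifting a solution in time by [s] trades the phase [t0] for [t0 + s] and the
    parameter [beta0] for [beta0 + om A0 * s].  By uniqueness the mean of Gamma at
    [(eps, beta0, t0)] is therefore [sum_k eps^(k+1) M_k (t0 - beta0 / om A0)];
    divided by [eps^(kappa+1)] it is an analytic function of [(eps, beta0)] that
    vanishes to the odd order [n] in [beta0] at [eps = 0].

    Such a function has a real Puiseux branch [beta0 = phi (|eps|^(1/n!))]: after a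
    Tschirnhaus translation, the first edge of the Newton polygon yields a real
    polynomial with a root of odd multiplicity [n' < n], and one proceeds by
    induction.  On the branch the mean of Gamma is zero, so the solution of the
    auxiliary system solves the differential equations. *)
Require Import Defs.
From Stdlib Require Import Reals ZArith Znumtheory Lia Lra Psatz.
From Stdlib Require Import ClassicalEpsilon FunctionalExtensionality.
From Coquelicot Require Import Coquelicot.
Open Scope R_scope.

(** * Double series and algebras of convergent power series *)

(** All work with series is done once, in an abstract algebra. Each application of [ser] to the
    reals or to functions of time adds a variable, so the same composition lemmas serve the forcing
    terms, the fixed point, the implicit function and the final substitution. Uniqueness for the
    auxiliary system is proved only for the slice beta0 = 0. This suffices: the Melnikov functions
    are read at beta0 = 0, and the time shift carries every small beta0 there. As the system is
    given by Fourier coefficients, the return to integral equations needs the fact that these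
    coefficients determine a continuous periodic function. In the Newton step the translation
    removes the coefficient of degree n - 1. Otherwise the edge polynomial could be an n-th power of
    a linear factor, and the multiplicity would not drop. Oddness survives because this polynomial
    has odd degree and the form w^e q(w^m): either e is odd and the root 0 serves, or both m and deg
    q are odd. The exponent n! comes from the fact that m * n'! divides n!, where m is the
    denominator of the slope. *)

Lemma functional_choice {A B : Type} (R : A -> B -> Prop) :
  (forall x, exists y, R x y) -> exists f, forall x, R x (f x).
Proof.
  intros H. exists (fun x => proj1_sig (constructive_indefinite_description _ (H x))).
  intros x. apply proj2_sig.
Qed.

Lemma ex_series_dom (a b : nat -> R) (S : R) :
  (forall n, Rabs (a n) <= b n) -> is_series b S -> ex_series a.
Proof.
  intros H Hb. apply (ex_series_le (V := R_CompleteNormedModule) a b).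
  - exact H.
  - now exists S.
Qed.

Lemma series_abs_le (a b : nat -> R) (S : R) :
  (forall n, Rabs (a n) <= b n) -> is_series b S -> Rabs (Series a) <= S.
Proof.
  intros H Hb.
  rewrite <- (is_series_unique _ _ Hb).
  apply Rle_trans with (Series (fun n => Rabs (a n))).
  - apply Series_Rabs. apply (ex_series_dom _ b S); auto.
    intros n. rewrite Rabs_Rabsolu. apply H.
  - apply Series_le; [|now exists S].
    intros n; split; [apply Rabs_pos | apply H].
Qed.

Lemma sum_le_is_series (a : nat -> R) (S : R) (n : nat) :
  (forall k, 0 <= a k) -> is_series a S -> sum_n a n <= S.
Proof.
  intros Ha HS.
  apply (is_lim_seq_incr_compare (sum_n a) S).
  - exact HS.
  - intros m. rewrite sum_Sn. unfold plus; simpl. specialize (Ha (Datatypes.S m)). lra.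
Qed.

Lemma term_le_is_series (a : nat -> R) (S : R) (n : nat) :
  (forall k, 0 <= a k) -> is_series a S -> a n <= S.
Proof.
  intros Ha HS. apply Rle_trans with (sum_n a n).
  - destruct n; [rewrite sum_O; lra|]. rewrite sum_Sn. unfold plus; simpl.
    assert (0 <= sum_n a n); [|lra].
    rewrite sum_n_Reals. apply cond_pos_sum, Ha.
  - now apply sum_le_is_series.
Qed.

Lemma is_series_nonneg (a : nat -> R) (S : R) :
  (forall k, 0 <= a k) -> is_series a S -> 0 <= S.
Proof.
  intros Ha HS. apply Rle_trans with (a O); auto. now apply term_le_is_series.
Qed.

Lemma is_series_eq (a : nat -> R) (l l' : R) : is_series a l -> l = l' -> is_series a l'.
Proof. now intros H <-. Qed.

Lemma is_series_ext_R (a b : nat -> R) (l : R) :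
  (forall n, a n = b n) -> is_series a l -> is_series b l.
Proof. exact (is_series_ext a b l). Qed.

Lemma is_series_tail (M : nat -> R) (S : R) (I : nat) :
  is_series M S -> is_series (fun k => M (Datatypes.S I + k)%nat) (S - sum_n M I).
Proof.
  intros HS. apply (is_series_incr_n M (Datatypes.S I)); [lia|].
  simpl pred. apply (is_series_eq M S _ HS).
  change (S = S - sum_n M I + sum_n M I). ring.
Qed.

(** Dominated convergence for series: beyond [I] the sum is controlled by the tail of [M], uniformly
    in [n], and the finitely many terms up to [I] tend to 0. *)
Lemma tannery (u : nat -> nat -> R) (M : nat -> R) (S : R) :
  (forall i n, Rabs (u i n) <= M i) -> is_series M S ->
  (forall i, is_lim_seq (u i) 0) ->
  is_lim_seq (fun n => Series (fun i => u i n)) 0.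
Proof.
  intros HM HS Hu.
  assert (HM0 : forall i, 0 <= M i).
  { intros i. eapply Rle_trans; [apply Rabs_pos | apply (HM i O)]. }
  apply is_lim_seq_spec. intros eps.
  assert (He : 0 < eps / 2) by (destruct eps; simpl; lra).
  destruct (proj2 (is_lim_seq_spec (sum_n M) S) HS (mkposreal _ He)) as [I HI].
  specialize (HI I (Nat.le_refl _)). simpl in HI.
  assert (Hfin : is_lim_seq (fun n => sum_n (fun i => u i n) I) 0).
  { clear HI. induction I as [|I IH].
    - eapply is_lim_seq_ext; [|apply (Hu O)]. intros n; now rewrite sum_O.
    - replace (Finite 0) with (Finite (0 + 0)) by (f_equal; ring).
      eapply is_lim_seq_ext; [|apply is_lim_seq_plus'; [apply IH | apply (Hu (Datatypes.S I))]].
      intros n; simpl. now rewrite sum_Sn. }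
  destruct (proj2 (is_lim_seq_spec _ _) Hfin (mkposreal _ He)) as [N HN].
  exists N. intros n Hn. specialize (HN n Hn). simpl in HN.
  assert (Hex : ex_series (fun i => u i n)) by (apply (ex_series_dom _ M S); auto).
  rewrite (Series_incr_n _ (Datatypes.S I)); [|lia|exact Hex].
  simpl pred.
  rewrite <- sum_n_Reals.
  assert (Ht := is_series_tail M S I HS).
  assert (H2 : Rabs (Series (fun k => u (Datatypes.S I + k)%nat n)) <= S - sum_n M I)
    by (apply (series_abs_le _ _ _ (fun k => HM (Datatypes.S I + k)%nat n) Ht)).
  rewrite Rminus_0_r in *.
  eapply Rle_lt_trans; [apply Rabs_triang|].
  assert (sum_n M I <= S) by (now apply sum_le_is_series).
  rewrite Rabs_left1 in HI by lra. lra.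
Qed.

(** The exchange reduces to [tannery] for the row remainders [sum_n (a i) n - Series (a i)], which
    tend to 0 and are dominated by [2 * M i]. *)
Lemma is_series_swap (a m : nat -> nat -> R) (M : nat -> R) (S : R) :
  (forall i j, Rabs (a i j) <= m i j) ->
  (forall i, is_series (m i) (M i)) -> is_series M S ->
  is_series (fun j => Series (fun i => a i j)) (Series (fun i => Series (a i))).
Proof.
  intros Ha Hm HS.
  assert (Hm0 : forall i j, 0 <= m i j).
  { intros; eapply Rle_trans; [apply Rabs_pos | apply Ha]. }
  assert (Hex : forall i, ex_series (a i)) by (intros i; apply (ex_series_dom _ (m i) (M i)); auto).
  assert (Hexj : forall j, ex_series (fun i => a i j)).
  { intros j; apply (ex_series_dom _ M S); auto. intros i.
    eapply Rle_trans; [apply Ha|]. now apply (term_le_is_series (m i)). }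
  assert (Hpart : forall i n, Rabs (sum_n (a i) n) <= M i).
  { intros i n. eapply Rle_trans; [|apply (sum_le_is_series (m i) _ n); auto].
    rewrite !sum_n_Reals. eapply Rle_trans; [apply Rsum_abs|].
    now apply sum_Rle. }
  assert (Hfull : forall i, Rabs (Series (a i)) <= M i).
  { intros i. apply (series_abs_le _ (m i)); auto. }
  assert (HexS : ex_series (fun i => Series (a i))) by (apply (ex_series_dom _ M S); auto).
  assert (Hsumn : forall n, is_series (fun i => sum_n (a i) n) (sum_n (fun j => Series (fun i => a i j)) n)).
  { induction n as [|n IH].
    - rewrite sum_O. eapply is_series_ext; [|apply Series_correct, (Hexj O)].
      intros i; now rewrite sum_O.
    - rewrite sum_Sn. eapply is_series_ext; [|apply (is_series_plus _ _ _ _ IH (Series_correct _ (Hexj (Datatypes.S n))))].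
      intros i; simpl. now rewrite sum_Sn. }
  assert (H : is_lim_seq (fun n => Series (fun i => (sum_n (a i) n - Series (a i)))) 0).
  { apply (tannery _ (fun i => 2 * M i) (2 * S)).
    - intros i n. unfold Rminus. eapply Rle_trans; [apply Rabs_triang|].
      rewrite Rabs_Ropp. specialize (Hpart i n); specialize (Hfull i). lra.
    - apply (is_series_scal 2 M S HS).
    - intros i. replace (Finite 0) with (Finite (Series (a i) - Series (a i))) by (f_equal; ring).
      apply is_lim_seq_minus'; [apply (Series_correct _ (Hex i)) | apply is_lim_seq_const]. }
  change (is_lim_seq (sum_n (fun j => Series (fun i => a i j))) (Series (fun i => Series (a i)))).
  replace (Finite (Series (fun i => Series (a i)))) with (Finite (0 + Series (fun i => Series (a i)))) by (f_equal; ring).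
  eapply is_lim_seq_ext; [|apply is_lim_seq_plus'; [apply H | apply is_lim_seq_const]].
  intros n; simpl.
  rewrite Series_minus; [|eexists; apply Hsumn|exact HexS].
  rewrite (is_series_unique _ _ (Hsumn n)). ring.
Qed.

(** The operations satisfy no axioms; they acquire a meaning only through [nrm],
    where [nr a M] says that the norm of [a] is at most [M] and [ev] is a
    homomorphism on elements of finite norm. *)
Record alg := Alg {
  car :> Type;
  pt : Type;
  cst : R -> car;
  add : car -> car -> car;
  mul : car -> car -> car;
  isum : (nat -> car) -> car;
  ev : car -> pt -> R }.
Arguments cst {a}. Arguments add {a}. Arguments mul {a}. Arguments isum {a}. Arguments ev {a}.

Record nrm (A : alg) := Nrm {
  nr : A -> R -> Prop;
  dom : pt A -> Prop;
  nr_pos : forall a M, nr a M -> 0 <= M;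
  nr_le : forall a M M', nr a M -> M <= M' -> nr a M';
  nr_cst : forall c, nr (cst c) (Rabs c);
  nr_add : forall a b M M', nr a M -> nr b M' -> nr (add a b) (M + M');
  nr_mul : forall a b M M', nr a M -> nr b M' -> nr (mul a b) (M * M');
  nr_isum : forall a M S, (forall p, nr (a p) (M p)) -> is_series M S -> nr (isum a) S;
  ev_bound : forall a M x, nr a M -> dom x -> Rabs (ev a x) <= M;
  ev_cst : forall c x, dom x -> ev (cst c) x = c;
  ev_add : forall a b M M' x, nr a M -> nr b M' -> dom x -> ev (add a b) x = ev a x + ev b x;
  ev_mul : forall a b M M' x, nr a M -> nr b M' -> dom x -> ev (mul a b) x = ev a x * ev b x;
  ev_isum : forall a M S x, (forall p, nr (a p) (M p)) -> is_series M S -> dom x ->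
    is_series (fun p => ev (a p) x) (ev (isum a) x) }.
Arguments nr {A}. Arguments dom {A}.
Arguments nr_pos {A}. Arguments nr_le {A}. Arguments nr_cst {A}. Arguments nr_add {A}. Arguments nr_mul {A}. Arguments nr_isum {A}.
Arguments ev_bound {A}. Arguments ev_cst {A}. Arguments ev_add {A}. Arguments ev_mul {A}. Arguments ev_isum {A}.

Definition alg_R : alg := Alg R unit (fun c => c) Rplus Rmult Series (fun a _ => a).

Definition nrm_R : nrm alg_R.
Proof.
  refine (Nrm alg_R (fun a M => Rabs a <= M) (fun _ => True) _ _ _ _ _ _ _ _ _ _ _); simpl.
  - intros a M H. eapply Rle_trans; [apply Rabs_pos | exact H].
  - intros; lra.
  - intros; lra.
  - intros. eapply Rle_trans; [apply Rabs_triang|]. lra.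
  - intros. rewrite Rabs_mult. apply Rmult_le_compat; auto using Rabs_pos.
  - intros a M S H HS. now apply (series_abs_le a M).
  - auto.
  - auto.
  - auto.
  - auto.
  - intros a M S x H HS _. apply Series_correct. now apply (ex_series_dom a M S).
Defined.

Definition alg_fun : alg :=
  Alg (R -> R) R (fun c _ => c) (fun f g t => f t + g t) (fun f g t => f t * g t)
    (fun a t => Series (fun p => a p t)) (fun f t => f t).

Lemma continuous_eps (f : R -> R) (t : R) :
  continuous f t <->
  forall eps, 0 < eps -> exists d, 0 < d /\ forall s, Rabs (s - t) < d -> Rabs (f s - f t) < eps.
Proof.
  split.
  - intros H eps He.
    destruct (proj1 (filterlim_locally f (f t)) H (mkposreal eps He)) as [d Hd].
    exists d; split; [apply cond_pos|]. intros s Hs. apply Hd, Hs.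
  - intros H. apply filterlim_locally. intros [eps He].
    destruct (H eps He) as [d [Hd Hf]]. exists (mkposreal d Hd).
    intros s Hs. apply Hf, Hs.
Qed.

(** Weierstrass test by thirds of eps: the tail beyond [I] is at most [S - sum_n M I] at every point
    of [D], and openness keeps nearby points inside [D]. *)
Lemma continuous_normal_series (D : R -> Prop) (a : nat -> R -> R) (M : nat -> R) (S t : R) :
  open D -> D t -> (forall p s, D s -> continuous (a p) s /\ Rabs (a p s) <= M p) ->
  is_series M S -> continuous (fun s => Series (fun p => a p s)) t.
Proof.
  intros HD Ht Ha HS. apply continuous_eps. intros eps He.
  assert (HM0 : forall i, 0 <= M i).
  { intros i. eapply Rle_trans; [apply Rabs_pos | apply (proj2 (Ha i t Ht))]. }
  assert (He3 : 0 < eps / 3) by lra.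
  destruct (proj2 (is_lim_seq_spec (sum_n M) S) HS (mkposreal _ He3)) as [I HI].
  specialize (HI I (Nat.le_refl _)). simpl in HI.
  assert (sum_n M I <= S) by (now apply sum_le_is_series).
  rewrite Rabs_left1 in HI by lra.
  assert (Htail : forall s, D s ->
    Rabs (Series (fun p => a p s) - sum_n (fun p => a p s) I) <= S - sum_n M I).
  { intros s Hs.
    assert (Hex : ex_series (fun i => a i s)).
    { apply (ex_series_dom _ M S); auto. intros p; apply (Ha p s Hs). }
    rewrite (Series_incr_n _ (Datatypes.S I)); [|lia|exact Hex].
    simpl pred. rewrite <- sum_n_Reals.
    replace (_ + _ - _) with (Series (fun k => a (Datatypes.S I + k)%nat s)) by ring.
    apply (series_abs_le _ (fun k => M (Datatypes.S I + k)%nat)).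
    - intros k; apply (Ha _ s Hs).
    - now apply is_series_tail. }
  assert (Hc : continuous (fun s => sum_n (fun p => a p s) I) t).
  { clear -Ha Ht. induction I as [|I IH].
    - apply (continuous_ext (a O)). intros s; now rewrite sum_O. apply (Ha O t Ht).
    - apply (continuous_ext (fun s => plus (sum_n (fun p => a p s) I) (a (Datatypes.S I) s))).
      intros s; now rewrite sum_Sn.
      apply (continuous_plus (V := R_NormedModule)); auto. apply (Ha _ t Ht). }
  destruct (proj1 (continuous_eps _ _) Hc _ He3) as [d1 [Hd1 H1]].
  destruct (HD t Ht) as [d2 H2].
  exists (Rmin d1 d2). split. apply Rmin_glb_lt; auto. apply cond_pos.
  intros s Hs.
  assert (Ds : D s). { apply H2. eapply Rlt_le_trans; [exact Hs | apply Rmin_r]. }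
  assert (Hs1 := H1 s (Rlt_le_trans _ _ _ Hs (Rmin_l _ _))).
  assert (A1 := Htail s Ds). assert (A2 := Htail t Ht).
  apply Rabs_def1; apply Rabs_def2 in Hs1; apply Rabs_le_between in A1; apply Rabs_le_between in A2; lra.
Qed.

(** The time domain [D] and the period [T] are parameters; [T = 0] imposes no periodicity. *)
Definition nrm_fun (D : R -> Prop) (HD : open D) (T : R) : nrm alg_fun.
Proof.
  refine (Nrm alg_fun
    (fun f M => 0 <= M /\ forall t, D t -> continuous f t /\ Rabs (f t) <= M /\ f (t + T) = f t)
    D _ _ _ _ _ _ _ _ _ _ _); simpl.
  - tauto.
  - intros a M M' [H0 H] Hl. split; [lra|]. intros t Ht.
    destruct (H t Ht) as [? [? ?]]. repeat split; auto; lra.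
  - intros c. split; [apply Rabs_pos|]. intros t Ht. repeat split; auto; [|lra].
    apply continuous_const.
  - intros a b M M' [H0 H] [H0' H']. split; [lra|]. intros t Ht.
    destruct (H t Ht) as [? [? ?]]. destruct (H' t Ht) as [? [? ?]].
    repeat split.
    + now apply (continuous_plus (V := R_NormedModule)).
    + eapply Rle_trans; [apply Rabs_triang|]. lra.
    + congruence.
  - intros a b M M' [H0 H] [H0' H']. split; [now apply Rmult_le_pos|]. intros t Ht.
    destruct (H t Ht) as [? [? ?]]. destruct (H' t Ht) as [? [? ?]].
    repeat split.
    + now apply (continuous_mult (K := R_AbsRing)).
    + rewrite Rabs_mult. apply Rmult_le_compat; auto using Rabs_pos.
    + congruence.
  - intros a M S H HS.
    split.
    { apply (is_series_nonneg M); auto. intros k; apply (H k). }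
    intros t Ht. repeat split.
    + apply (continuous_normal_series D a M S); auto. intros p s Hs.
      destruct (proj2 (H p) s Hs); tauto.
    + apply (series_abs_le _ M); auto. intros p; apply (proj2 (H p) t Ht).
    + apply Series_ext. intros p; apply (proj2 (H p) t Ht).
  - intros a M t [_ H] Ht. apply (H t Ht).
  - auto.
  - auto.
  - auto.
  - intros a M S t H HS Ht. apply Series_correct. apply (ex_series_dom _ M S); auto.
    intros p; apply (proj2 (H p) t Ht).
Defined.

Fixpoint fsum {A : alg} (f : nat -> A) (n : nat) : A :=
  match n with O => f O | S n' => add (fsum f n') (f n) end.

Lemma nr_fsum {A : alg} (N : nrm A) (f : nat -> A) (m : nat -> R) n :
  (forall k, (k <= n)%nat -> nr N (f k) (m k)) -> nr N (fsum f n) (sum_f_R0 m n).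
Proof.
  induction n as [|n IH]; intros H; simpl.
  - apply H; lia.
  - apply nr_add; auto.
Qed.

Lemma ev_fsum {A : alg} (N : nrm A) (f : nat -> A) (m : nat -> R) n x :
  (forall k, (k <= n)%nat -> nr N (f k) (m k)) -> dom N x ->
  ev (fsum f n) x = sum_f_R0 (fun k => ev (f k) x) n.
Proof.
  induction n as [|n IH]; intros H Hx; simpl; auto.
  rewrite (ev_add N _ _ (sum_f_R0 m n) (m (S n))); auto.
  - rewrite IH; auto.
  - apply nr_fsum; auto.
Qed.

(** Formal power series over [A] with the Cauchy product. A point is a pair: the value of the new
    variable, then a point of [A]. In an iterated [ser] the outermost variable therefore comes
    first. *)
Definition ser (A : alg) : alg :=
  Alg (nat -> A) (R * pt A)
    (fun c k => match k with O => cst c | S _ => cst 0 end)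
    (fun c d k => add (c k) (d k))
    (fun c d k => fsum (fun i => mul (c i) (d (k - i)%nat)) k)
    (fun a k => isum (fun p => a p k))
    (fun c x => PSeries (fun k => ev (c k) (snd x)) (fst x)).

(** The weighted l^1 norm. A majorant sequence is quantified because the norm in [A] is only a
    relation, so there is no coefficient norm to be summed directly. *)
Definition ser_nr {A : alg} (N : nrm A) (rho : R) (c : nat -> A) (M : R) : Prop :=
  exists (m : nat -> R) (S : R),
    (forall k, nr N (c k) (m k)) /\ is_series (fun k => m k * rho ^ k) S /\ S <= M.

Lemma is_series_first (a : nat -> R) : (forall k, a (S k) = 0) -> is_series a (a O).
Proof.
  intros H. change (is_lim_seq (sum_n a) (a O)).
  apply (is_lim_seq_ext (fun _ => a O)); [|apply is_lim_seq_const].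
  intros n; induction n as [|n IH].
  - now rewrite sum_O.
  - rewrite sum_Sn, <- IH, H. unfold plus; simpl. ring.
Qed.

Lemma is_pseries_R (a : nat -> R) (x l : R) :
  is_pseries a x l <-> is_series (fun k => a k * x ^ k) l.
Proof.
  assert (E : forall n, scal (pow_n x n) (a n) = a n * x ^ n).
  { intros n. rewrite pow_n_pow. unfold scal; simpl; unfold mult; simpl; ring. }
  split; intros H; [apply (is_series_ext _ _ _ E H)|].
  apply (is_series_ext (fun k => a k * x ^ k)); auto.
Qed.

Lemma PSeries_R (a : nat -> R) (x : R) : PSeries a x = Series (fun k => a k * x ^ k).
Proof. reflexivity. Qed.

Lemma pow_abs_le (x rho : R) k : Rabs x <= rho -> Rabs (x ^ k) <= rho ^ k.
Proof.
  intros H. rewrite <- RPow_abs. apply pow_incr. split; auto using Rabs_pos.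
Qed.

Lemma ser_term_le {A : alg} (N : nrm A) (a : A) m x (h rho : R) k :
  nr N a m -> dom N x -> Rabs h <= rho -> Rabs (ev a x * h ^ k) <= m * rho ^ k.
Proof.
  intros Ha Hx Hh. rewrite Rabs_mult. apply Rmult_le_compat; auto using Rabs_pos.
  - now apply (ev_bound N).
  - now apply pow_abs_le.
Qed.

Lemma ser_is_pseries {A : alg} (N : nrm A) (rho : R) (c : nat -> A) M (h : R) x :
  ser_nr N rho c M -> Rabs h <= rho -> dom N x ->
  is_series (fun k => ev (c k) x * h ^ k) (ev (a := ser A) c (h, x)).
Proof.
  intros [m [S [Hm [HS _]]]] Hh Hx. apply Series_correct.
  apply (ex_series_dom _ _ S (fun k => ser_term_le N _ _ x h rho k (Hm k) Hx Hh) HS).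
Qed.

(** Submultiplicativity holds because the Cauchy product of the majorants is a majorant of the
    product; infinite sums rest on [is_series_swap]. The definition is transparent, so that [nr] of
    an iterated [ser] unfolds to [ser_nr]. *)
Definition ser_nrm {A : alg} (N : nrm A) (rho : R) (Hrho : 0 < rho) : nrm (ser A).
Proof.
  assert (Hp : forall k, 0 < rho ^ k) by (intros; now apply pow_lt).
  assert (Hm0 : forall c m, (forall k, nr N (c k) (m k)) -> forall k, 0 <= m k * rho ^ k).
  { intros c m Hm k. apply Rmult_le_pos; [apply (nr_pos N _ _ (Hm k)) | now left]. }
  refine (Nrm (ser A) (ser_nr N rho) (fun x => Rabs (fst x) <= rho /\ dom N (snd x)) _ _ _ _ _ _ _ _ _ _ _).
  - intros c M [m [S [Hm [HS Hl]]]]. apply Rle_trans with S; auto.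
    now apply (is_series_nonneg _ _ (Hm0 c m Hm)).
  - intros c M M' [m [S [Hm [HS Hl]]]] H. exists m, S. repeat split; auto; lra.
  - intros c. exists (fun k => match k with O => Rabs c | S _ => 0 end), (Rabs c).
    split; [|split; [|lra]].
    + intros [|k]; simpl. apply nr_cst.
      rewrite <- Rabs_R0 at 2. apply nr_cst.
    + apply (is_series_eq _ (Rabs c * rho ^ 0)); [|simpl; ring].
      apply (is_series_first (fun k => match k with O => Rabs c | S _ => 0 end * rho ^ k)). intros k; ring.
  - intros c d M M' [m [S [Hm [HS Hl]]]] [m' [S' [Hm' [HS' Hl']]]].
    exists (fun k => m k + m' k), (S + S'). split; [|split; [|lra]].
    + intros k; simpl. now apply nr_add.
    + eapply is_series_ext; [|apply (is_series_plus _ _ _ _ HS HS')].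
      intros k; unfold plus; simpl; ring.
  - intros c d M M' [m [S [Hm [HS Hl]]]] [m' [S' [Hm' [HS' Hl']]]].
    exists (fun k => sum_f_R0 (fun i => m i * m' (k - i)%nat) k), (S * S').
    split; [|split].
    + intros k. apply nr_fsum. intros i Hi. now apply nr_mul.
    + assert (X := is_series_mult (fun k => m k * rho ^ k) (fun k => m' k * rho ^ k) S S' HS HS').
      eapply is_series_ext; [|apply X].
      * intros k. rewrite Rmult_comm, scal_sum. apply sum_eq. intros i Hi.
        replace (rho ^ k) with (rho ^ i * rho ^ (k - i)); [ring|].
        rewrite <- pow_add. f_equal; lia.
      * exists S. eapply is_series_ext; [|apply HS]. intros k.
        rewrite Rabs_right; auto. apply Rle_ge, (Hm0 c); auto.
      * exists S'. eapply is_series_ext; [|apply HS']. intros k.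
        rewrite Rabs_right; auto. apply Rle_ge, (Hm0 d); auto.
    + apply Rmult_le_compat; auto.
      * apply (is_series_nonneg _ _ (Hm0 c m Hm) HS).
      * apply (is_series_nonneg _ _ (Hm0 d m' Hm') HS').
  - intros a M S Ha HS.
    apply functional_choice in Ha. destruct Ha as [m Ha]. apply functional_choice in Ha. destruct Ha as [s Ha].
    assert (Hs0 : forall p, 0 <= s p).
    { intros p. destruct (Ha p) as [H1 [H2 _]]. apply (is_series_nonneg _ _ (Hm0 _ _ H1) H2). }
    assert (Hexs : ex_series s).
    { apply (ex_series_dom _ M S); auto. intros p. rewrite Rabs_right by (apply Rle_ge, Hs0).
      apply (Ha p). }
    assert (Hexm : forall k, ex_series (fun p => m p k)).
    (* Each majorant satisfies [m p k * rho ^ k <= M p], so for fixed [k] the coefficient bounds are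
       summable over [p]. *)
    { intros k. apply (ex_series_dom _ (fun p => / rho ^ k * M p) (/ rho ^ k * S)).
      - intros p. destruct (Ha p) as [H1 [H2 H3]].
        rewrite Rabs_right; [|apply Rle_ge, (nr_pos N _ _ (H1 k))].
        assert (m p k * rho ^ k <= M p).
        { eapply Rle_trans; [|apply H3]. apply (term_le_is_series _ _ k (Hm0 _ _ H1) H2). }
        apply Rmult_le_reg_r with (rho ^ k); auto.
        replace (/ rho ^ k * M p * rho ^ k) with (M p); auto. field. apply Rgt_not_eq, Hp.
      - apply (is_series_scal (/ rho ^ k) M S HS). }
    exists (fun k => Series (fun p => m p k)), (Series s). split; [|split].
    + intros k. simpl. apply (nr_isum N _ (fun p => m p k)).
      * intros p; apply (Ha p).
      * now apply Series_correct.
    + assert (X := is_series_swap (fun p k => m p k * rho ^ k) (fun p k => m p k * rho ^ k) s (Series s)).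
      replace (Series s) with (Series (fun i => Series (fun k => m i k * rho ^ k))).
      2:{ apply Series_ext. intros p. apply is_series_unique. apply (Ha p). }
      eapply is_series_ext; [|apply X].
      * intros k; simpl. rewrite Series_scal_r. reflexivity.
      * intros i j. rewrite Rabs_right; [lra|]. apply Rle_ge, (Hm0 (a i)). apply (Ha i).
      * intros i; apply (Ha i).
      * now apply Series_correct.
    + rewrite <- (is_series_unique _ _ HS). apply Series_le.
      * intros p; split; auto. apply (Ha p).
      * now exists S.
  - intros c M [h x] [m [S [Hm [HS Hl]]]] [Hh Hx]; simpl in *.
    apply Rle_trans with S; auto.
    apply (series_abs_le _ _ _ (fun k => ser_term_le N _ _ x h rho k (Hm k) Hx Hh) HS).
  - intros c [h x] [Hh Hx]; simpl in *. rewrite PSeries_R.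
    rewrite (is_series_unique _ (ev (cst c) x * h ^ 0)).
    + rewrite (ev_cst N); auto. simpl; ring.
    + apply (is_series_first (fun k => ev (match k with O => cst c | S _ => cst 0 end) x * h ^ k)).
      intros k. rewrite (ev_cst N); auto. ring.
  - intros c d M M' [h x] Hc Hd [Hh Hx]; simpl fst in *; simpl snd in *.
    assert (E1 := ser_is_pseries N rho c M h x Hc Hh Hx).
    assert (E2 := ser_is_pseries N rho d M' h x Hd Hh Hx).
    destruct Hc as [m [S [Hm _]]]. destruct Hd as [m' [S' [Hm' _]]].
    apply is_series_unique.
    eapply is_series_ext; [|apply (is_series_plus _ _ _ _ E1 E2)].
    intros k; simpl. rewrite (ev_add N _ _ (m k) (m' k)); auto. unfold plus; simpl; ring.
  - intros c d M M' [h x] Hc Hd [Hh Hx]; simpl fst in *; simpl snd in *.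
    assert (E1 := ser_is_pseries N rho c M h x Hc Hh Hx).
    assert (E2 := ser_is_pseries N rho d M' h x Hd Hh Hx).
    destruct Hc as [m [S [Hm [HS _]]]]. destruct Hd as [m' [S' [Hm' [HS' _]]]].
    apply is_series_unique.
    assert (X := is_series_mult _ _ _ _ E1 E2).
    eapply is_series_ext; [|apply X].
    + intros k; simpl. rewrite (ev_fsum N _ (fun i => m i * m' (k - i)%nat)); auto.
      * rewrite Rmult_comm, scal_sum. apply sum_eq. intros i Hi.
        rewrite (ev_mul N _ _ (m i) (m' (k - i)%nat)); auto.
        replace (h ^ k) with (h ^ i * h ^ (k - i)); [ring|].
        rewrite <- pow_add. f_equal; lia.
      * intros i Hi. now apply nr_mul.
    + apply (ex_series_dom _ (fun k => m k * rho ^ k) S); auto.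
      intros k. rewrite Rabs_Rabsolu. now apply (ser_term_le N).
    + apply (ex_series_dom _ (fun k => m' k * rho ^ k) S'); auto.
      intros k. rewrite Rabs_Rabsolu. now apply (ser_term_le N).
  - intros a M S [h x] Ha HS [Hh Hx]; simpl fst in *; simpl snd in *.
    assert (Ha0 := Ha).
    apply functional_choice in Ha. destruct Ha as [m Ha]. apply functional_choice in Ha. destruct Ha as [s Ha].
    assert (Hs0 : forall p, 0 <= s p).
    { intros p. destruct (Ha p) as [H1 [H2 _]]. apply (is_series_nonneg _ _ (Hm0 _ _ H1) H2). }
    assert (Hexs : ex_series s).
    { apply (ex_series_dom _ M S); auto. intros p. rewrite Rabs_right by (apply Rle_ge, Hs0).
      apply (Ha p). }
    assert (X := is_series_swap (fun p k => ev (a p k) x * h ^ k) (fun p k => m p k * rho ^ k) s (Series s)).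
    assert (XX := X (fun p k => ser_term_le N _ _ x h rho k (proj1 (Ha p) k) Hx Hh)
                   (fun p => proj1 (proj2 (Ha p))) (Series_correct _ Hexs)).
    assert (Hev : ev (a := ser A) (isum a) (h, x)
                  = Series (fun p => ev (a := ser A) (a p) (h, x))).
    { simpl. rewrite PSeries_R.
      transitivity (Series (fun k => Series (fun p => ev (a p k) x * h ^ k)));
        [|apply is_series_unique, XX].
      apply Series_ext. intros k.
      rewrite Series_scal_r. f_equal. apply eq_sym, is_series_unique.
      apply (ev_isum N _ (fun p => / rho ^ k * M p) (/ rho ^ k * S)); auto.
      - intros p. destruct (Ha p) as [H1 [H2 H3]]. apply (nr_le N _ (m p k)); auto.
        assert (m p k * rho ^ k <= M p).
        { eapply Rle_trans; [|apply H3]. apply (term_le_is_series _ _ k (Hm0 _ _ H1) H2). }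
        apply Rmult_le_reg_r with (rho ^ k); auto.
        replace (/ rho ^ k * M p * rho ^ k) with (M p); auto. field. apply Rgt_not_eq, Hp.
      - apply (is_series_scal (/ rho ^ k) M S HS). }
    rewrite Hev. apply Series_correct. apply (ex_series_dom _ s (Series s)).
    + intros p. destruct (Ha p) as [H1 [H2 H3]]. simpl.
      apply (series_abs_le _ _ _ (fun k => ser_term_le N _ _ x h rho k (H1 k) Hx Hh) H2).
    + now apply Series_correct.
Defined.

(** * Composition and formal fixed points *)

(** On [[0, 1/2]] one has [1 / (1 - x) <= 1 + 2 * x]. The leading [K] is kept apart so that
    everything beyond the constant term carries a factor [x] that can be made small. *)
Lemma is_series_geom_half (K x : R) :
  0 <= K -> 0 <= x <= 1 / 2 -> exists S : R, is_series (fun p => K * x ^ p) S /\ S <= K + 2 * x * K.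
Proof.
  intros HK Hx. exists (K * / (1 - x)). split.
  - assert (Hg : is_series (fun p => x ^ p) (/ (1 - x))).
    { apply is_series_geom. rewrite Rabs_pos_eq; lra. }
    apply (is_series_scal K _ _ Hg).
  - apply Rmult_le_reg_r with (1 - x); [lra|].
    rewrite Rmult_assoc, Rinv_l by lra.
    assert (0 <= K * (x * (1 - 2 * x))) by (apply Rmult_le_pos; [|apply Rmult_le_pos]; lra).
    lra.
Qed.

Section Algebra.
Context {A : alg}.

Definition lift (a : A) : ser A := fun k => match k with O => a | S _ => cst 0 end.
(** Multiplication by the series variable; [sh (cst 1)] is the variable itself. *)
Definition sh (c : ser A) : ser A := fun k => match k with O => cst 0 | S k' => c k' end.
(** Congruence modulo the [n]-th power of the variable. Coefficients are compared by plain equality,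
    since the operations of an [alg] satisfy no laws. *)
Definition cong (n : nat) (c d : ser A) : Prop := forall k, (k < n)%nat -> c k = d k.

Fixpoint pw (u : A) (p : nat) : A := match p with O => cst 1 | S p' => mul u (pw u p') end.
Definition comp1 (a : nat -> A) (u : A) : A := isum (fun p => mul (a p) (pw u p)).
Definition comp2 (a : nat -> nat -> A) (u v : A) : A := comp1 (fun p => comp1 (a p) v) u.
Definition comp3 (a : nat -> nat -> nat -> A) (u v w : A) : A :=
  comp1 (fun p => comp2 (a p) v w) u.

Variable N : nrm A.

Lemma nr_0 : nr N (cst 0) 0.
Proof. apply (nr_le N _ (Rabs 0)); [apply nr_cst | rewrite Rabs_R0; lra]. Qed.

Lemma nr_1 : nr N (cst 1) 1.
Proof. apply (nr_le N _ (Rabs 1)); [apply nr_cst | rewrite Rabs_R1; lra]. Qed.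

Lemma nr_scal (c : R) (a : A) M : nr N a M -> nr N (mul (cst c) a) (Rabs c * M).
Proof. intros H. apply nr_mul; auto. apply nr_cst. Qed.

Lemma ev_scal (c : R) (a : A) M x : nr N a M -> dom N x -> ev (mul (cst c) a) x = c * ev a x.
Proof.
  intros H Hx. rewrite (ev_mul N _ _ (Rabs c) M); auto using nr_cst.
  now rewrite (ev_cst N).
Qed.

Lemma nr_pw (u : A) U p : nr N u U -> nr N (pw u p) (U ^ p).
Proof.
  intros H; induction p as [|p IH]; simpl.
  - apply nr_1.
  - now apply nr_mul.
Qed.

Lemma ev_pw (u : A) U p x : nr N u U -> dom N x -> ev (pw u p) x = ev u x ^ p.
Proof.
  intros H Hx; induction p as [|p IH]; simpl.
  - now apply (ev_cst N).
  - rewrite (ev_mul N _ _ U (U ^ p)); auto using nr_pw. now rewrite IH.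
Qed.

(** With [U <= r / 2] the terms are at most [K * (U / r) ^ p], a geometric series with sum at most
    [2 * K]. Nesting one, two or three compositions gives the factors 2, 4 and 8 used below. *)
Lemma comp1_terms (a : nat -> A) (u : A) (r K U : R) :
  0 < r -> (forall p, nr N (a p) (K / r ^ p)) -> nr N u U -> U <= r / 2 ->
  exists m S, (forall p, nr N (mul (a p) (pw u p)) (m p)) /\ is_series m S /\ S <= 2 * K.
Proof.
  intros Hr Ha Hu HU.
  assert (HU0 := nr_pos N _ _ Hu).
  assert (HK : 0 <= K). { assert (X := nr_pos N _ _ (Ha O)). simpl in X. lra. }
  assert (Hx : 0 <= U / r <= 1 / 2).
  { split; [apply Rmult_le_pos; auto; left; now apply Rinv_0_lt_compat|].
    apply Rmult_le_reg_r with r; auto. unfold Rdiv at 1. rewrite Rmult_assoc, Rinv_l by lra. lra. }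
  destruct (is_series_geom_half K (U / r) HK Hx) as [S [HS Hl]].
  exists (fun p => K / r ^ p * U ^ p), S. split; [|split].
  - intros p. apply nr_mul; auto. now apply nr_pw.
  - eapply is_series_ext_R; [|apply HS]. intros p. unfold Rdiv.
    rewrite Rpow_mult_distr, pow_inv. ring.
  - nra.
Qed.

Lemma nr_comp1 (a : nat -> A) (u : A) (r K U : R) :
  0 < r -> (forall p, nr N (a p) (K / r ^ p)) -> nr N u U -> U <= r / 2 ->
  nr N (comp1 a u) (2 * K).
Proof.
  intros Hr Ha Hu HU.
  destruct (comp1_terms a u r K U Hr Ha Hu HU) as [m [S [Hm [HS Hl]]]].
  apply (nr_le N _ S); auto. now apply (nr_isum N _ m).
Qed.

Lemma is_series_ev_comp1 (a : nat -> A) (u : A) (r K U : R) x :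
  0 < r -> (forall p, nr N (a p) (K / r ^ p)) -> nr N u U -> U <= r / 2 -> dom N x ->
  is_series (fun p => ev (a p) x * ev u x ^ p) (ev (comp1 a u) x).
Proof.
  intros Hr Ha Hu HU Hx.
  destruct (comp1_terms a u r K U Hr Ha Hu HU) as [m [S [Hm [HS Hl]]]].
  eapply is_series_ext_R; [|apply (ev_isum N _ m S x Hm HS Hx)].
  intros p; simpl. rewrite (ev_mul N _ _ (K / r ^ p) (U ^ p)); auto using nr_pw.
  now rewrite (ev_pw _ U).
Qed.

Lemma ev_comp1 (a : nat -> A) (u : A) (r K U : R) x :
  0 < r -> (forall p, nr N (a p) (K / r ^ p)) -> nr N u U -> U <= r / 2 -> dom N x ->
  ev (comp1 a u) x = PSeries (fun p => ev (a p) x) (ev u x).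
Proof.
  intros Hr Ha Hu HU Hx. rewrite PSeries_R. symmetry. apply is_series_unique.
  now apply (is_series_ev_comp1 a u r K U).
Qed.

Lemma div_pow_add (K r : R) i j : 0 < r -> K / r ^ (i + j) = K / r ^ i / r ^ j.
Proof.
  intros Hr. rewrite pow_add. field. split; apply Rgt_not_eq; now apply pow_lt.
Qed.

Lemma nr_comp2 (a : nat -> nat -> A) (u v : A) (r K U V : R) :
  0 < r -> (forall p q, nr N (a p q) (K / r ^ (p + q))) ->
  nr N u U -> U <= r / 2 -> nr N v V -> V <= r / 2 ->
  nr N (comp2 a u v) (4 * K).
Proof.
  intros Hr Ha Hu HU Hv HV. replace (4 * K) with (2 * (2 * K)) by ring.
  apply (nr_comp1 _ _ r (2 * K) U); auto. intros p.
  replace (2 * K / r ^ p) with (2 * (K / r ^ p)) by (unfold Rdiv; ring).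
  apply (nr_comp1 _ _ r (K / r ^ p) V); auto. intros q.
  rewrite <- div_pow_add; auto.
Qed.

Lemma ev_comp2 (a : nat -> nat -> A) (u v : A) (r K U V : R) x :
  0 < r -> (forall p q, nr N (a p q) (K / r ^ (p + q))) ->
  nr N u U -> U <= r / 2 -> nr N v V -> V <= r / 2 -> dom N x ->
  ev (comp2 a u v) x = PSeries (fun p => PSeries (fun q => ev (a p q) x) (ev v x)) (ev u x).
Proof.
  intros Hr Ha Hu HU Hv HV Hx.
  assert (Ha' : forall p q, nr N (a p q) (K / r ^ p / r ^ q)).
  { intros p q. rewrite <- div_pow_add; auto. }
  unfold comp2. rewrite (ev_comp1 _ _ r (2 * K) U); auto.
  - apply PSeries_ext. intros p. now apply (ev_comp1 _ _ r (K / r ^ p) V).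
  - intros p. replace (2 * K / r ^ p) with (2 * (K / r ^ p)) by (unfold Rdiv; ring).
    now apply (nr_comp1 _ _ r (K / r ^ p) V).
Qed.

Lemma nr_comp3 (a : nat -> nat -> nat -> A) (u v w : A) (r K U V W : R) :
  0 < r -> (forall p q s, nr N (a p q s) (K / r ^ (p + q + s))) ->
  nr N u U -> U <= r / 2 -> nr N v V -> V <= r / 2 -> nr N w W -> W <= r / 2 ->
  nr N (comp3 a u v w) (8 * K).
Proof.
  intros Hr Ha Hu HU Hv HV Hw HW. replace (8 * K) with (2 * (4 * K)) by ring.
  apply (nr_comp1 _ _ r (4 * K) U); auto. intros p.
  replace (4 * K / r ^ p) with (4 * (K / r ^ p)) by (unfold Rdiv; ring).
  apply (nr_comp2 _ _ _ r (K / r ^ p) V W); auto. intros q s.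
  rewrite <- div_pow_add, Nat.add_assoc; auto.
Qed.

Lemma ev_comp3 (a : nat -> nat -> nat -> A) (u v w : A) (r K U V W : R) x :
  0 < r -> (forall p q s, nr N (a p q s) (K / r ^ (p + q + s))) ->
  nr N u U -> U <= r / 2 -> nr N v V -> V <= r / 2 -> nr N w W -> W <= r / 2 -> dom N x ->
  ev (comp3 a u v w) x =
  PSeries (fun p => PSeries (fun q => PSeries (fun s => ev (a p q s) x) (ev w x)) (ev v x)) (ev u x).
Proof.
  intros Hr Ha Hu HU Hv HV Hw HW Hx.
  assert (Ha' : forall p q s, nr N (a p q s) (K / r ^ p / r ^ (q + s))).
  { intros p q s. rewrite <- div_pow_add, Nat.add_assoc; auto. }
  unfold comp3. rewrite (ev_comp1 _ _ r (4 * K) U); auto.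
  - apply PSeries_ext. intros p. now apply (ev_comp2 _ _ _ r (K / r ^ p) V W).
  - intros p. replace (4 * K / r ^ p) with (4 * (K / r ^ p)) by (unfold Rdiv; ring).
    now apply (nr_comp2 _ _ _ r (K / r ^ p) V W).
Qed.

Lemma nr_lift (rho : R) (a : A) M : nr N a M -> ser_nr N rho (lift a) M.
Proof.
  intros H. exists (fun k => match k with O => M | S _ => 0 end), M. split; [|split; [|lra]].
  - intros [|k]; simpl; auto. apply nr_0.
  - apply (is_series_eq _ (M * rho ^ 0)); [|simpl; ring].
    apply (is_series_first (fun k => match k with O => M | S _ => 0 end * rho ^ k)). intros k; ring.
Qed.

Lemma ev_lift (a : A) h x : dom N x -> ev (lift a) (h, x) = ev a x.
Proof.
  intros Hx. simpl. rewrite PSeries_R. apply is_series_unique.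
  apply (is_series_eq _ (ev a x * h ^ 0)); [|simpl; ring].
  apply (is_series_first (fun k => ev (lift a k) x * h ^ k)). intros k; simpl.
  rewrite (ev_cst N); auto. ring.
Qed.

Lemma nr_sh (rho : R) (c : ser A) M : ser_nr N rho c M -> 0 <= rho -> ser_nr N rho (sh c) (rho * M).
Proof.
  intros [m [S [Hm [HS Hl]]]] Hrho.
  exists (fun k => match k with O => 0 | Datatypes.S k' => m k' end), (rho * S). split; [|split].
  - intros [|k]; simpl; auto. apply nr_0.
  - apply is_series_decr_1.
    apply (is_series_eq _ (rho * S)); [|unfold plus, opp; simpl; ring].
    eapply is_series_ext_R; [|apply (is_series_scal rho _ _ HS)].
    intros k; unfold scal; simpl; unfold mult; simpl. ring.
  - now apply Rmult_le_compat_l.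
Qed.

Lemma ev_sh (rho : R) (c : ser A) M h x :
  ser_nr N rho c M -> Rabs h <= rho -> dom N x -> ev (sh c) (h, x) = h * ev c (h, x).
Proof.
  intros Hc Hh Hx. simpl. rewrite PSeries_R. apply is_series_unique.
  apply is_series_decr_1.
  apply (is_series_eq _ (h * ev c (h, x))).
  - eapply is_series_ext_R; [|apply (is_series_scal h _ _ (ser_is_pseries N rho c M h x Hc Hh Hx))].
    intros k; unfold scal; simpl; unfold mult; simpl. ring.
  - simpl. rewrite (ev_cst N); auto. unfold plus, opp; simpl. ring.
Qed.

Lemma ser_nr_coef (rho : R) (c : ser A) M k : 0 < rho -> ser_nr N rho c M -> nr N (c k) (M / rho ^ k).
Proof.
  intros Hrho [m [S [Hm [HS Hl]]]]. apply (nr_le N _ (m k)); auto.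
  assert (Hp := pow_lt rho k Hrho).
  apply Rmult_le_reg_r with (rho ^ k); auto.
  unfold Rdiv. rewrite Rmult_assoc, Rinv_l, Rmult_1_r by lra.
  eapply Rle_trans; [|apply Hl]. apply (term_le_is_series (fun k => m k * rho ^ k)); auto.
  intros i. apply Rmult_le_pos; [apply (nr_pos N _ _ (Hm i)) | left; now apply pow_lt].
Qed.

(** Turns Cauchy estimates on the coefficients back into a norm, at the price of a smaller radius.
    The constant coefficient has its own bound [K0], to which the norm tends as [rho] tends to 0. *)
Lemma ser_nr_of_bound (c : ser A) (r K K0 rho : R) :
  0 < r -> 0 <= rho <= r / 2 -> nr N (c O) K0 -> (forall k, nr N (c k) (K / r ^ k)) ->
  ser_nr N rho c (K0 + 2 * (rho / r) * K).
Proof.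
  intros Hr Hrho H0 H.
  assert (HK : 0 <= K). { assert (X := nr_pos N _ _ (H O)). simpl in X. lra. }
  assert (Hx : 0 <= rho / r <= 1 / 2).
  { split; [apply Rmult_le_pos; try lra; left; now apply Rinv_0_lt_compat|].
    apply Rmult_le_reg_r with r; auto. unfold Rdiv at 1. rewrite Rmult_assoc, Rinv_l by lra. lra. }
  destruct (is_series_geom_half K (rho / r) HK Hx) as [S [HS Hl]].
  exists (fun k => match k with O => K0 | Datatypes.S _ => K / r ^ k end), (K0 + (S - K)).
  split; [|split].
  - intros [|k]; [exact H0 | apply H].
  - apply is_series_decr_1.
    apply (is_series_eq _ (S - sum_n (fun p => K * (rho / r) ^ p) 0)).
    + eapply is_series_ext_R; [|apply (is_series_tail _ _ O HS)].
      intros k. change (K * (rho / r) ^ Datatypes.S k = K / r ^ Datatypes.S k * rho ^ Datatypes.S k).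
      unfold Rdiv. rewrite Rpow_mult_distr, pow_inv. ring.
    + rewrite sum_O. unfold plus, opp; simpl. ring.
  - lra.
Qed.

End Algebra.

Lemma cong_le {A : alg} n n' (c d : ser A) : (n' <= n)%nat -> cong n c d -> cong n' c d.
Proof. intros H Hc k Hk. apply Hc; lia. Qed.

Lemma cong_all {A : alg} (c d : ser A) : (forall n, cong n c d) -> c = d.
Proof. intros H. apply functional_extensionality. intros k. apply (H (S k)); lia. Qed.

Lemma cong_add {A : alg} n (c c' d d' : ser A) :
  cong n c c' -> cong n d d' -> cong n (add c d) (add c' d').
Proof. intros H H' k Hk. simpl. now rewrite H, H'. Qed.

Lemma fsum_ext {A : alg} (f g : nat -> A) n :
  (forall k, (k <= n)%nat -> f k = g k) -> fsum f n = fsum g n.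
Proof.
  induction n as [|n IH]; intros H; simpl; [now apply H|].
  rewrite H by lia. rewrite IH; auto.
Qed.

Lemma cong_mul {A : alg} n (c c' d d' : ser A) :
  cong n c c' -> cong n d d' -> cong n (mul c d) (mul c' d').
Proof.
  intros H H' k Hk. simpl. apply fsum_ext. intros i Hi. rewrite H, H'; auto; lia.
Qed.

Lemma cong_refl {A : alg} n (c : ser A) : cong n c c.
Proof. now intros k Hk. Qed.

Lemma cong_pw {A : alg} n (u u' : ser A) p : cong n u u' -> cong n (pw u p) (pw u' p).
Proof.
  intros H; induction p as [|p IH]; [apply cong_refl | now apply cong_mul].
Qed.

Lemma cong_comp1 {A : alg} n (a a' : nat -> ser A) u u' :
  (forall p, cong n (a p) (a' p)) -> cong n u u' -> cong n (comp1 a u) (comp1 a' u').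
Proof.
  intros Ha Hu k Hk. unfold comp1; cbn [isum ser]. f_equal. apply functional_extensionality. intros p.
  apply (cong_mul n); auto. now apply cong_pw.
Qed.

Lemma cong_comp2 {A : alg} n (a : nat -> nat -> ser A) u u' v v' :
  cong n u u' -> cong n v v' -> cong n (comp2 a u v) (comp2 a u' v').
Proof.
  intros Hu Hv. apply cong_comp1; auto. intros p. apply cong_comp1; auto.
  intros q; apply cong_refl.
Qed.

Lemma cong_sh {A : alg} n (c d : ser A) : cong n c d -> cong (S n) (sh c) (sh d).
Proof. intros H [|k] Hk; simpl; auto. apply H; lia. Qed.

Lemma cong_map {A : alg} (J : A -> A) n (c d : ser A) :
  cong n c d -> cong n (fun k => J (c k)) (fun k => J (d k)).
Proof. intros H k Hk. now rewrite H. Qed.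

Section FixPoint.
Context {A : alg}.
Variable Psi : ser A * ser A -> ser A * ser A.

Definition cong2 n (u v : ser A * ser A) := cong n (fst u) (fst v) /\ cong n (snd u) (snd v).

Hypothesis HPsi : forall n u v, cong2 n u v -> cong2 (S n) (Psi u) (Psi v).

(** By [HPsi] the map is a contraction for the order of vanishing, so two fixed points agree to
    every order. *)
Lemma formal_fixpoint_unique u v : Psi u = u -> Psi v = v -> u = v.
Proof.
  intros Hu Hv.
  assert (H : forall n, cong2 n u v).
  { induction n as [|n IH]; [split; intros k Hk; lia|].
    rewrite <- Hu, <- Hv. now apply HPsi. }
  destruct u, v. f_equal; apply cong_all; intros n; apply (H n).
Qed.

(** Coefficient [k] of the iterates is stationary from step [S k] on, and the fixed point collects
    these stable values along the diagonal. Different coefficients come from different iterates, so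
    only the estimates [M / rho ^ k] pass to the limit; summing them at half the radius doubles the
    bound. *)
Lemma formal_fixpoint (N : nrm A) (rho M : R) :
  0 < rho -> 0 <= M ->
  (forall u, ser_nr N rho (fst u) M -> ser_nr N rho (snd u) M ->
     ser_nr N rho (fst (Psi u)) M /\ ser_nr N rho (snd (Psi u)) M) ->
  exists u, Psi u = u /\ ser_nr N (rho / 2) (fst u) (2 * M) /\ ser_nr N (rho / 2) (snd u) (2 * M).
Proof.
  intros Hrho HM HN.
  set (z := (cst 0, cst 0) : ser A * ser A).
  set (it := fun n => Nat.iter n Psi z).
  assert (Hc : forall n, cong2 n (it n) (it (S n))).
  { induction n as [|n IH]; [split; intros k Hk; lia|]. simpl. now apply HPsi. }
  assert (Hc' : forall n m, cong2 n (it n) (it (m + n)%nat)).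
  { intros n m; induction m as [|m [I1 I2]]; [split; apply cong_refl|].
    destruct (Hc (m + n)%nat) as [C1 C2].
    split; intros k Hk.
    - rewrite I1 by auto. apply C1. lia.
    - rewrite I2 by auto. apply C2. lia. }
  assert (Hn : forall n, ser_nr N rho (fst (it n)) M /\ ser_nr N rho (snd (it n)) M).
  { induction n as [|n [I1 I2]]; [|now apply HN].
    assert (X : ser_nr N rho (cst 0 : ser A) M).
    { apply (nr_le (ser_nrm N rho Hrho) _ (Rabs 0)); [apply (nr_cst (ser_nrm N rho Hrho))|].
      now rewrite Rabs_R0. }
    split; exact X. }
  exists (fun k => fst (it (S k)) k, fun k => snd (it (S k)) k).
  assert (Hu : forall n, cong2 n (fun k => fst (it (S k)) k, fun k => snd (it (S k)) k) (it n)).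
  { intros n. split; intros k Hk; destruct (Hc' (S k) (n - S k)%nat) as [C1 C2];
    replace (n - S k + S k)%nat with n in C1, C2 by lia; [apply C1 | apply C2]; lia. }
  assert (X : forall c : ser A, (forall k, nr N (c k) (M / rho ^ k)) -> ser_nr N (rho / 2) c (2 * M)).
  { intros c Hc0. apply (nr_le (ser_nrm N (rho / 2) ltac:(lra)) _ (M + 2 * (rho / 2 / rho) * M)).
    - apply ser_nr_of_bound; try lra; auto.
      apply (nr_le N _ _ _ (Hc0 O)). right. simpl. field.
    - right. field. lra. }
  split; [|split].
  - assert (H : forall n, cong2 n (Psi (fun k => fst (it (S k)) k, fun k => snd (it (S k)) k)) (fun k => fst (it (S k)) k, fun k => snd (it (S k)) k)).
    { intros [|n]; [split; intros k Hk; lia|].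
      destruct (HPsi _ _ _ (Hu n)) as [P1 P2]. destruct (Hu (S n)) as [Q1 Q2].
      split; intros k Hk; [rewrite P1, Q1 | rewrite P2, Q2]; auto. }
    rewrite (surjective_pairing (Psi _)). f_equal; apply cong_all; intros n; apply (H n).
  - apply X. intros k. apply (ser_nr_coef N rho (fst (it (S k))) M k Hrho), Hn.
  - apply X. intros k. apply (ser_nr_coef N rho (snd (it (S k))) M k Hrho), Hn.
Qed.
End FixPoint.

(** * Uniqueness of coefficients and norm bounds for double series *)

Lemma CV_radius_pos (a : nat -> R) (r K : R) :
  0 < r -> (forall k, Rabs (a k) * r ^ k <= K) -> Rbar_lt 0 (CV_radius a).
Proof.
  intros Hr H. apply Rbar_lt_le_trans with (Finite r); [exact Hr|].
  apply (proj1 (CV_radius_bounded a)). exists K. intros n.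
  rewrite Rabs_mult, (Rabs_right (r ^ n)); auto. apply Rle_ge, pow_le; lra.
Qed.

Lemma PSeries_coef_unique (a b : nat -> R) (r K K' d : R) :
  0 < r -> 0 < d -> (forall k, Rabs (a k) * r ^ k <= K) -> (forall k, Rabs (b k) * r ^ k <= K') ->
  (forall x, Rabs x < d -> PSeries a x = PSeries b x) -> forall k, a k = b k.
Proof.
  intros Hr Hd Ha Hb H k. apply PSeries_ext_recip.
  - now apply (CV_radius_pos a r K).
  - now apply (CV_radius_pos b r K').
  - exists (mkposreal d Hd). intros x Hx. apply H.
    replace x with (x - 0) by ring. exact Hx.
Qed.

Lemma PSeries_bound (a : nat -> R) (r K x : R) :
  0 < r -> (forall k, Rabs (a k) * r ^ k <= K) -> Rabs x <= r / 2 ->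
  Rabs (PSeries a x) <= 2 * K /\ is_series (fun k => a k * x ^ k) (PSeries a x).
Proof.
  intros Hr Ha Hx.
  assert (N : forall p, nr nrm_R (a p) (K / r ^ p)).
  { intros p. simpl. apply Rmult_le_reg_r with (r ^ p); [now apply pow_lt|].
    unfold Rdiv. rewrite Rmult_assoc, Rinv_l, Rmult_1_r; auto. apply Rgt_not_eq; now apply pow_lt. }
  assert (Hn : nr nrm_R x (Rabs x)) by (simpl; lra).
  assert (E : comp1 (A := alg_R) a x = PSeries a x)
    by exact (ev_comp1 (A := alg_R) nrm_R a x r K (Rabs x) tt Hr N Hn Hx I).
  split.
  - rewrite <- E. apply (nr_comp1 nrm_R a x r K (Rabs x) Hr N Hn Hx).
  - rewrite <- E. apply (is_series_ev_comp1 nrm_R a x r K (Rabs x) tt Hr N Hn Hx I).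
Qed.

(** One-variable uniqueness is used twice: in [x] at fixed [y], which identifies the row sums, and
    then in [y]. The row sums are bounded only for [Rabs y <= r / 2], whence the factor 2. *)
Lemma PSeries2_coef_unique (a b : nat -> nat -> R) (r K K' : R) :
  0 < r -> (forall i j, Rabs (a i j) * r ^ (i + j) <= K) ->
  (forall i j, Rabs (b i j) * r ^ (i + j) <= K') ->
  (forall x y, Rabs x < r -> Rabs y < r ->
     PSeries (fun i => PSeries (a i) y) x = PSeries (fun i => PSeries (b i) y) x) ->
  forall i j, a i j = b i j.
Proof.
  intros Hr Ha Hb H.
  assert (aux : forall (c : nat -> nat -> R) C i y, (forall i j, Rabs (c i j) * r ^ (i + j) <= C) -> Rabs y <= r / 2 ->
     Rabs (PSeries (c i) y) * r ^ i <= 2 * C).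
  { intros c C i y Hc Hy. assert (Hp := pow_lt r i Hr).
    apply Rmult_le_reg_r with (/ r ^ i); [now apply Rinv_0_lt_compat|].
    rewrite Rmult_assoc, Rinv_r, Rmult_1_r by lra.
    rewrite Rmult_assoc. apply (PSeries_bound (c i) r (C * / r ^ i) y); auto.
    intros k. apply Rmult_le_reg_r with (r ^ i); auto.
    rewrite Rmult_assoc, (Rmult_assoc C), Rinv_l, Rmult_1_r by lra.
    rewrite <- pow_add, Nat.add_comm. apply Hc. }
  intros i. apply (PSeries_coef_unique (a i) (b i) r (K / r ^ i) (K' / r ^ i) (r / 2)); auto; try lra.
  - intros j. apply Rmult_le_reg_r with (r ^ i); [now apply pow_lt|].
    unfold Rdiv. rewrite Rmult_assoc, (Rmult_assoc K), Rinv_l, Rmult_1_r by (apply Rgt_not_eq, pow_lt, Hr).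
    rewrite <- pow_add, Nat.add_comm. apply Ha.
  - intros j. apply Rmult_le_reg_r with (r ^ i); [now apply pow_lt|].
    unfold Rdiv. rewrite Rmult_assoc, (Rmult_assoc K'), Rinv_l, Rmult_1_r by (apply Rgt_not_eq, pow_lt, Hr).
    rewrite <- pow_add, Nat.add_comm. apply Hb.
  - intros y Hy.
    apply (PSeries_coef_unique (fun i => PSeries (a i) y) (fun i => PSeries (b i) y) r (2 * K) (2 * K') r); auto.
    + intros k. apply aux; auto; lra.
    + intros k. apply aux; auto; lra.
    + intros x Hx. apply H; auto. lra.
Qed.

Lemma bound_div (x r K : R) n : 0 < r -> Rabs x * r ^ n <= K -> Rabs x <= K / r ^ n.
Proof.
  intros Hr H. assert (Hp := pow_lt r n Hr). apply Rmult_le_reg_r with (r ^ n); auto.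
  unfold Rdiv. rewrite Rmult_assoc, Rinv_l by lra. lra.
Qed.

Lemma bound_mul (x r K : R) n : 0 < r -> Rabs x <= K / r ^ n -> Rabs x * r ^ n <= K.
Proof.
  intros Hr H. assert (Hp := pow_lt r n Hr).
  replace K with (K / r ^ n * r ^ n) by (field; lra). apply Rmult_le_compat_r; lra.
Qed.

Lemma nr_var {A : alg} (N : nrm A) (rho : R) : 0 < rho -> ser_nr N rho (sh (cst 1)) (rho * 1).
Proof.
  intros Hr. apply nr_sh; [|lra]. apply (nr_1 (ser_nrm N rho Hr)).
Qed.

Lemma ev_var {A : alg} (N : nrm A) (rho : R) h x : 0 < rho -> Rabs h <= rho -> dom N x ->
  ev (a := ser A) (sh (cst 1)) (h, x) = h.
Proof.
  intros Hr Hh Hx. rewrite (ev_sh N rho _ 1); auto; [|apply (nr_1 (ser_nrm N rho Hr))].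
  rewrite (ev_cst (ser_nrm N rho Hr)); [ring | split; auto].
Qed.

Lemma div_pow_le (M r r' : R) k : 0 <= M -> 0 < r <= r' -> M / r' ^ k <= M / r ^ k.
Proof.
  intros HM Hr. apply Rmult_le_compat_l; auto. apply Rinv_le_contravar; [apply pow_lt; lra|].
  apply pow_incr; lra.
Qed.

Lemma nr_coef2 {A : alg} (N : nrm A) (r1 r2 r : R) (H1 : 0 < r1) (c : ser (ser A)) M :
  ser_nr (ser_nrm N r1 H1) r2 c M -> 0 < r <= r1 -> r <= r2 ->
  forall k j, nr N (c k j) (M / r ^ (k + j)).
Proof.
  intros Hc Hr Hr2 k j.
  assert (X := ser_nr_coef (ser_nrm N r1 H1) r2 c M k ltac:(lra) Hc).
  assert (Y := ser_nr_coef N r1 (c k) _ j H1 X).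
  assert (HM : 0 <= M) by apply (nr_pos (ser_nrm (ser_nrm N r1 H1) r2 ltac:(lra)) c M Hc).
  assert (Hp : 0 < / r2 ^ k) by (apply Rinv_0_lt_compat, pow_lt; lra).
  apply (nr_le N _ _ _ Y). rewrite div_pow_add by lra.
  apply Rle_trans with (M / r2 ^ k / r ^ j).
  - apply div_pow_le; [apply Rmult_le_pos; lra | lra].
  - apply Rmult_le_compat_r; [left; apply Rinv_0_lt_compat, pow_lt; lra|]. apply div_pow_le; lra.
Qed.

(** The constant 6 is 2 from row 0 plus 4 from the other rows, whose norms are at most
    [2 * K / r ^ k] and enter with another factor [2 * (rho / r)]. *)
Lemma nr_of_coef2 {A : alg} (N : nrm A) (r K K0 rho : R) (Hrho : 0 < rho) (c : ser (ser A)) :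
  0 < r -> rho <= r / 2 -> nr N (c O O) K0 -> (forall k j, nr N (c k j) (K / r ^ (k + j))) ->
  ser_nr (ser_nrm N rho Hrho) rho c (K0 + 6 * (rho / r) * K).
Proof.
  intros Hr Hr2 H0 H.
  assert (HK : 0 <= K). { assert (X := nr_pos N _ _ (H O O)). simpl in X. lra. }
  assert (Hx : 0 <= rho / r <= 1 / 2).
  { split; [apply Rmult_le_pos; try lra; left; now apply Rinv_0_lt_compat|].
    apply Rmult_le_reg_r with r; auto. unfold Rdiv at 1. rewrite Rmult_assoc, Rinv_l by lra. lra. }
  set (N1 := ser_nrm N rho Hrho).
  assert (B0 : nr N1 (c O) (K0 + 2 * (rho / r) * K)).
  { apply ser_nr_of_bound; [exact Hr | lra | exact H0 | intros k; apply (H O)]. }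
  assert (B : forall k, nr N1 (c k) (2 * K / r ^ k)).
  { intros k.
    assert (Hk : 0 <= K / r ^ k).
    { apply Rmult_le_pos; auto. left. apply Rinv_0_lt_compat, pow_lt, Hr. }
    apply (nr_le N1 _ (K / r ^ k + 2 * (rho / r) * (K / r ^ k))).
    - apply ser_nr_of_bound; [exact Hr | lra | |].
      + specialize (H k O). rewrite Nat.add_0_r in H. exact H.
      + intros j. rewrite <- div_pow_add; auto.
    - replace (2 * K / r ^ k) with (2 * (K / r ^ k)) by (unfold Rdiv; ring). nra. }
  apply (nr_le (ser_nrm N1 rho Hrho) _ (K0 + 2 * (rho / r) * K + 2 * (rho / r) * (2 * K))).
  - apply ser_nr_of_bound; [exact Hr | lra | exact B0 | exact B].
  - lra.
Qed.

(** * Germs of analytic functions of two variables *)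

(** The expansion is in powers of [y], with coefficients that are power series in [x]. *)
Definition expansion (c : nat -> nat -> R) (r K : R) (f : R -> R -> R) : Prop :=
  0 < r /\ (forall j k, Rabs (c j k) <= K / r ^ (j + k)) /\
  forall x y, Rabs x < r -> Rabs y < r -> f x y = PSeries (fun j => PSeries (c j) x) y.

Definition analytic2 (f : R -> R -> R) : Prop := exists c r K, expansion c r K f.

Definition analytic1 (f : R -> R) : Prop := analytic2 (fun x _ => f x).

Definition nrm2 (rho : R) (H : 0 < rho) : nrm (ser (ser alg_R)) := ser_nrm (ser_nrm nrm_R rho H) rho H.

Definition ev2 (c : ser (ser alg_R)) (x y : R) : R := ev c (y, (x, tt)).

Lemma dom2 rho H x y : Rabs x <= rho -> Rabs y <= rho -> dom (nrm2 rho H) (y, (x, tt)).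
Proof. intros; repeat split; auto. Qed.

Lemma expansion_nr c r K f rho (H : 0 < rho) : expansion c r K f -> rho <= r / 2 ->
  nr (nrm2 rho H) c (Rabs (f 0 0) + 6 * (rho / r) * K) /\
  forall x y, Rabs x <= rho -> Rabs y <= rho -> f x y = ev2 c x y.
Proof.
  intros [Hr [Hc Hf]] Hrho. split.
  - apply (nr_of_coef2 nrm_R r K); auto.
    rewrite Hf by (rewrite Rabs_R0; auto). rewrite !PSeries_0. simpl. lra.
  - intros x y Hx Hy. apply Hf; lra.
Qed.

Lemma expansion_of_nr c M f rho (H : 0 < rho) : nr (nrm2 rho H) c M ->
  (forall x y, Rabs x <= rho -> Rabs y <= rho -> f x y = ev2 c x y) -> expansion c rho M f.
Proof.
  intros Hc Hf. split; [auto|split].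
  - intros j k. apply (nr_coef2 nrm_R rho rho rho H c M Hc); lra.
  - intros x y Hx Hy. apply Hf; lra.
Qed.

Lemma small_radius (r K eta : R) : 0 < r -> 0 <= K -> 0 < eta -> exists d, 0 < d /\
  forall rho, 0 < rho <= d -> rho <= r / 2 /\ 6 * (rho / r) * K <= eta.
Proof.
  intros Hr HK Heta. exists (Rmin (r / 2) (eta * r / (6 * (K + 1)))).
  assert (H1 : 0 < eta * r / (6 * (K + 1))) by (apply Rdiv_lt_0_compat; [apply Rmult_lt_0_compat|]; lra).
  split; [apply Rmin_glb_lt; lra|]. intros rho [Hp Hrho].
  assert (L1 := Rle_trans _ _ _ Hrho (Rmin_l _ _)). assert (L2 := Rle_trans _ _ _ Hrho (Rmin_r _ _)).
  split; auto.
  apply Rle_trans with (6 * (rho / r) * (K + 1)).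
  - apply Rmult_le_compat_l; [|lra]. apply Rmult_le_pos; [lra|]. apply Rmult_le_pos; [lra|left; now apply Rinv_0_lt_compat].
  - apply Rle_trans with (6 * (eta * r / (6 * (K + 1)) / r) * (K + 1)).
    + apply Rmult_le_compat_r; [lra|]. apply Rmult_le_compat_l; [lra|].
      apply Rmult_le_compat_r; [left; now apply Rinv_0_lt_compat | exact L2].
    + right. field. lra.
Qed.

Lemma expansion_K c r K f : expansion c r K f -> 0 <= K.
Proof.
  intros [_ [H _]]. specialize (H O O). simpl in H. assert (X := Rabs_pos (c O O)). lra.
Qed.

(** On a small bidisc the norm is close to the value at the origin. A function that vanishes there
    gets arbitrarily small norm, which is what substitution into another series demands. *)
Lemma expansion_nr_small f eta : analytic2 f -> 0 < eta -> exists d, 0 < d /\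
  forall rho (H : 0 < rho), rho <= d -> exists c, nr (nrm2 rho H) c (Rabs (f 0 0) + eta) /\
    forall x y, Rabs x <= rho -> Rabs y <= rho -> f x y = ev2 c x y.
Proof.
  intros [c [r [K Hc]]] Heta.
  destruct (small_radius r K eta (proj1 Hc) (expansion_K _ _ _ _ Hc) Heta) as [d [Hd Hs]].
  exists d. split; auto. intros rho H Hrho. exists c.
  destruct (Hs rho (conj H Hrho)) as [L1 L2].
  destruct (expansion_nr c r K f rho H Hc L1) as [N1 N2]. split; auto.
  apply (nr_le _ _ _ _ N1). lra.
Qed.

(** Both functions are represented on a common bidisc. The operation is polymorphic so that it can
    be applied inside the nested series algebra. *)
Lemma analytic2_binop (op : forall A : alg, A -> A -> A) (opR : R -> R -> R) f g :
  (forall A (N : nrm A) a b M M', nr N a M -> nr N b M' ->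
     exists M'', nr N (op A a b) M'' /\ forall x, dom N x -> ev (op A a b) x = opR (ev a x) (ev b x)) ->
  analytic2 f -> analytic2 g -> analytic2 (fun x y => opR (f x y) (g x y)).
Proof.
  intros Hop Hf Hg.
  destruct (expansion_nr_small f 1 Hf Rlt_0_1) as [d1 [Hd1 H1]].
  destruct (expansion_nr_small g 1 Hg Rlt_0_1) as [d2 [Hd2 H2]].
  set (rho := Rmin d1 d2). assert (H : 0 < rho) by now apply Rmin_glb_lt.
  destruct (H1 rho H (Rmin_l _ _)) as [a [Ha Ea]]. destruct (H2 rho H (Rmin_r _ _)) as [b [Hb Eb]].
  destruct (Hop _ (nrm2 rho H) a b _ _ Ha Hb) as [M [HM Hev]].
  exists (op _ a b), rho, M. apply (expansion_of_nr _ _ _ rho H HM).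
  intros x y Hx Hy. rewrite Ea, Eb by auto. symmetry. apply Hev. now apply dom2.
Qed.

Lemma analytic2_plus f g : analytic2 f -> analytic2 g -> analytic2 (fun x y => f x y + g x y).
Proof.
  apply (analytic2_binop (fun A => @add A) Rplus). intros A N a b M M' Ha Hb.
  exists (M + M'). split; [now apply nr_add|]. intros x Hx. now apply (ev_add N a b M M').
Qed.

Lemma analytic2_mult f g : analytic2 f -> analytic2 g -> analytic2 (fun x y => f x y * g x y).
Proof.
  apply (analytic2_binop (fun A => @mul A) Rmult). intros A N a b M M' Ha Hb.
  exists (M * M'). split; [now apply nr_mul|]. intros x Hx. now apply (ev_mul N a b M M').
Qed.

Lemma analytic2_const c : analytic2 (fun _ _ => c).
Proof.
  exists (cst c : ser (ser alg_R)), 1, (Rabs c).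
  apply (expansion_of_nr _ _ _ 1 Rlt_0_1); [apply (nr_cst (nrm2 1 Rlt_0_1))|].
  intros x y Hx Hy. symmetry. apply (ev_cst (nrm2 1 Rlt_0_1)). now apply dom2.
Qed.

Lemma analytic2_x : analytic2 (fun x _ => x).
Proof.
  exists (lift (sh (cst 1)) : ser (ser alg_R)), 1, (1 * 1).
  apply (expansion_of_nr _ _ _ 1 Rlt_0_1).
  - apply (nr_lift (ser_nrm nrm_R 1 Rlt_0_1)). apply (nr_var nrm_R). lra.
  - intros x y Hx Hy. unfold ev2. symmetry.
    etransitivity; [apply (ev_lift (ser_nrm nrm_R 1 Rlt_0_1)); split; [exact Hx|exact I]|].
    apply (ev_var nrm_R 1); auto; [lra | exact I].
Qed.

Lemma analytic2_y : analytic2 (fun _ y => y).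
Proof.
  exists (sh (cst 1) : ser (ser alg_R)), 1, (1 * 1).
  apply (expansion_of_nr _ _ _ 1 Rlt_0_1).
  - apply (nr_var (ser_nrm nrm_R 1 Rlt_0_1)). lra.
  - intros x y Hx Hy. unfold ev2. symmetry.
    apply (ev_var (ser_nrm nrm_R 1 Rlt_0_1) 1); auto; [lra | split; [exact Hx | exact I]].
Qed.

Lemma analytic2_pow f n : analytic2 f -> analytic2 (fun x y => f x y ^ n).
Proof.
  intros H; induction n as [|n IH]; [exact (analytic2_const 1) | exact (analytic2_mult _ _ H IH)].
Qed.

Lemma analytic2_sum (f : nat -> R -> R -> R) n : (forall j, (j <= n)%nat -> analytic2 (f j)) ->
  analytic2 (fun x y => sum_f_R0 (fun j => f j x y) n).
Proof.
  induction n as [|n IH]; intros H; simpl; [apply H; lia|].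
  apply analytic2_plus; auto.
Qed.

(** The inner functions vanish at the origin, so after shrinking the bidisc their norms are at most
    [r / 4]; the coefficients of [f] enter as constants and [comp2] applies. *)
Lemma analytic2_comp f g1 g2 : analytic2 f -> analytic2 g1 -> analytic2 g2 ->
  g1 0 0 = 0 -> g2 0 0 = 0 -> analytic2 (fun x y => f (g1 x y) (g2 x y)).
Proof.
  intros [a [r [K Ha]]] Hg1 Hg2 E1 E2.
  assert (Hr := proj1 Ha). assert (Hr4 : 0 < r / 4) by lra.
  destruct (expansion_nr_small g1 (r / 4) Hg1 Hr4) as [d1 [Hd1 H1]].
  destruct (expansion_nr_small g2 (r / 4) Hg2 Hr4) as [d2 [Hd2 H2]].
  set (rho := Rmin d1 d2). assert (H : 0 < rho) by now apply Rmin_glb_lt.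
  destruct (H1 rho H (Rmin_l _ _)) as [v [Nv Ev]]. destruct (H2 rho H (Rmin_r _ _)) as [u [Nu Eu]].
  rewrite E1, Rabs_R0, Rplus_0_l in Nv. rewrite E2, Rabs_R0, Rplus_0_l in Nu.
  set (aa := fun j k => cst (a j k) : ser (ser alg_R)).
  assert (Na : forall j k, nr (nrm2 rho H) (aa j k) (K / r ^ (j + k))).
  { intros j k. apply (nr_le _ _ (Rabs (a j k))); [apply (nr_cst (nrm2 rho H)) | apply Ha]. }
  exists (comp2 aa u v), rho, (4 * K). apply (expansion_of_nr _ _ _ rho H).
  - apply (nr_comp2 (nrm2 rho H) aa u v r K (r / 4) (r / 4)); auto; lra.
  - intros x y Hx Hy. assert (Hd := dom2 rho H x y Hx Hy).
    transitivity (PSeries (fun p => PSeries (fun q => ev (aa p q) (y, (x, tt))) (ev2 v x y)) (ev2 u x y)).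
    + rewrite Ev, Eu by auto. rewrite (proj2 (proj2 Ha)).
      * apply PSeries_ext; intros p. apply PSeries_ext; intros q. symmetry. now apply (ev_cst (nrm2 rho H)).
      * eapply Rle_lt_trans; [apply (ev_bound (nrm2 rho H) v (r / 4)); auto | lra].
      * eapply Rle_lt_trans; [apply (ev_bound (nrm2 rho H) u (r / 4)); auto | lra].
    + symmetry. apply (ev_comp2 (nrm2 rho H) aa u v r K (r / 4) (r / 4)); auto; lra.
Qed.

Lemma analytic1_comp f g : analytic1 f -> analytic2 g -> g 0 0 = 0 -> analytic2 (fun x y => f (g x y)).
Proof.
  intros Hf Hg H0. apply (analytic2_comp (fun x _ => f x) g (fun _ _ => 0)); auto using analytic2_const.
Qed.

Definition expansion1 (c : nat -> R) (r K : R) (f : R -> R) : Prop :=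
  0 < r /\ (forall k, Rabs (c k) <= K / r ^ k) /\ forall x, Rabs x < r -> f x = PSeries c x.

Lemma analytic1_expansion f : analytic1 f -> exists c r K, expansion1 c r K f.
Proof.
  intros [c [r [K [Hr [Hc Hf]]]]]. exists (c O), r, K. split; [auto|split].
  - intros k. apply (Hc O k).
  - intros x Hx. rewrite (Hf x 0) by (auto; rewrite Rabs_R0; auto). now rewrite PSeries_0.
Qed.

Lemma expansion1_analytic c r K f : expansion1 c r K f -> analytic1 f.
Proof.
  intros [Hr [Hc Hf]].
  assert (HK : 0 <= K). { specialize (Hc O). simpl in Hc. assert (X := Rabs_pos (c O)). lra. }
  exists (fun j k => match j with O => c k | S _ => 0 end), r, K. split; [auto|split].
  - intros [|j] k; [apply Hc|]. rewrite Rabs_R0. apply Rmult_le_pos; auto. left; apply Rinv_0_lt_compat, pow_lt, Hr.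
  - intros x y Hx Hy. rewrite Hf by auto. rewrite PSeries_R. symmetry. apply is_series_unique.
    apply (is_series_eq _ (PSeries c x * y ^ 0)); [|apply Rmult_1_r].
    apply (is_series_first (fun j => PSeries (fun k => match j with O => c k | S _ => 0 end) x * y ^ j)).
    intros j. rewrite PSeries_const_0. ring.
Qed.

Lemma expansion1_shift c r K m : 0 < r -> (forall k, Rabs (c k) <= K / r ^ k) ->
  expansion1 (fun k => c (m + k)%nat) r (K / r ^ m) (PSeries (fun k => c (m + k)%nat)).
Proof.
  intros Hr Hc. split; [auto|split; [|auto]]. intros k. rewrite <- div_pow_add; auto.
Qed.

Lemma expansion_coef1 c r K f j : expansion c r K f -> expansion1 (c j) r (K / r ^ j) (PSeries (c j)).
Proof.
  intros [Hr [Hc _]]. split; [auto|split; [|auto]]. intros k. rewrite <- div_pow_add; auto.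
Qed.

Lemma expansion1_ex_pseries c r K f x : expansion1 c r K f -> Rabs x <= r / 2 -> ex_pseries c x.
Proof.
  intros [Hr [Hc _]] Hx. exists (PSeries c x). apply is_pseries_R.
  apply (PSeries_bound c r K x); auto. intros k. apply bound_mul; auto.
Qed.

Lemma expansion_section c r K f x : expansion c r K f -> Rabs x <= r / 2 ->
  expansion1 (fun j => PSeries (c j) x) r (2 * K) (fun y => PSeries (fun j => PSeries (c j) x) y).
Proof.
  intros [Hr [Hc _]] Hx. split; [auto|split; [|auto]]. intros j.
  replace (2 * K / r ^ j) with (2 * (K / r ^ j)) by (unfold Rdiv; ring).
  apply (PSeries_bound (c j) r (K / r ^ j) x); auto.
  intros k. apply bound_mul; auto. rewrite <- div_pow_add; auto.
Qed.

Lemma pseries_factor c r K m x : 0 < r -> (forall k, Rabs (c k) <= K / r ^ k) -> (forall k, (k < m)%nat -> c k = 0) ->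
  Rabs x <= r / 2 -> PSeries c x = x ^ m * PSeries (fun k => c (m + k)%nat) x.
Proof.
  intros Hr Hc Hz Hx. destruct m as [|m]; [simpl; ring_simplify; now apply PSeries_ext|].
  rewrite (PSeries_decr_n c m x).
  - replace (sum_f_R0 _ m) with 0; [rewrite Rplus_0_l; reflexivity|].
    symmetry. apply sum_eq_R0. intros k Hk. rewrite Hz by lia. ring.
  - apply (expansion1_ex_pseries c r K (PSeries c)); auto. split; auto.
Qed.

Lemma expansion_decomp c r K f n : expansion c r K f ->
  let e := fun x y => PSeries (fun j => PSeries (c (S n + j)%nat) x) y in
  analytic2 e /\ e 0 0 = c (S n) O /\
  forall x y, Rabs x <= r / 2 -> Rabs y <= r / 2 ->
    f x y = sum_f_R0 (fun j => PSeries (c j) x * y ^ j) n + y ^ S n * e x y.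
Proof.
  intros Hc e. assert (Hr := proj1 Hc). split; [|split].
  - exists (fun j k => c (S n + j)%nat k), r, (K / r ^ S n). split; [auto|split; [|auto]].
    intros j k. destruct Hc as [_ [Hc _]]. rewrite <- div_pow_add, Nat.add_assoc; auto.
  - unfold e. rewrite !PSeries_0. f_equal. lia.
  - intros x y Hx Hy. rewrite (proj2 (proj2 Hc)) by lra.
    rewrite (PSeries_decr_n (fun j => PSeries (c j) x) n y).
    + reflexivity.
    + apply (expansion1_ex_pseries _ r (2 * K) _ y (expansion_section c r K f x Hc Hx) Hy).
Qed.

(** Put [y = x * u], write [l] for the coefficient of [y] and split off one power of [x] from the
    rest of rows 0 and 1. Then [h] equals [x] times [b0 + l * u + x * Q u], so a zero is a solution
    of [u = - (b0 + x * Q u) / l]. The factor [x] before [Q] makes this a formal contraction. *)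
Lemma implicit_function c r K h : expansion c r K h -> c O O = 0 -> c 1%nat O <> 0 ->
  exists psi d, analytic1 psi /\ psi 0 = 0 /\ 0 < d /\ forall x, Rabs x < d -> h x (psi x) = 0.
Proof.
  intros Hc H0 H1. assert (Hr := proj1 Hc). assert (HK := expansion_K _ _ _ _ Hc).
  set (l := c 1%nat O). set (b0 := fun k => c O (S k)). set (b1 := fun k => c 1%nat (S k)).
  set (e := fun j k => c (2 + j)%nat k).
  set (K' := K / r + K / r / r).
  assert (HKr : 0 <= K / r) by (apply Rmult_le_pos; auto; left; now apply Rinv_0_lt_compat).
  assert (HKrr : 0 <= K / r / r) by (apply Rmult_le_pos; auto; left; now apply Rinv_0_lt_compat).
  assert (HK' : 0 <= K') by (unfold K'; lra).
  assert (Hpk : forall k, 0 < / r ^ k) by (intros; now apply Rinv_0_lt_compat, pow_lt).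
  assert (B0 : forall k, Rabs (b0 k) <= K' / r ^ k).
  { intros k. eapply Rle_trans; [apply (proj1 (proj2 Hc))|].
    replace (K / r ^ (0 + S k)) with (K / r / r ^ k) by (simpl; field; split; [apply Rgt_not_eq, pow_lt|]; lra).
    apply Rmult_le_compat_r; [left; auto | unfold K'; lra]. }
  assert (B1 : forall k, Rabs (b1 k) <= K' / r ^ k).
  { intros k. eapply Rle_trans; [apply (proj1 (proj2 Hc))|].
    replace (K / r ^ (1 + S k)) with (K / r / r / r ^ k) by (simpl; field; split; [apply Rgt_not_eq, pow_lt|]; lra).
    apply Rmult_le_compat_r; [left; auto | unfold K'; lra]. }
  assert (Be : forall j k, Rabs (e j k) <= K' / r ^ (j + k)).
  { intros j k. eapply Rle_trans; [apply (proj1 (proj2 Hc))|].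
    replace (K / r ^ (2 + j + k)) with (K / r / r / r ^ (j + k)) by (simpl; field; split; [apply Rgt_not_eq, pow_lt|]; lra).
    apply Rmult_le_compat_r; [left; auto | unfold K'; lra]. }
  set (ee := fun j k => cst (e j k) : ser alg_R).
  set (X := sh (cst 1) : ser alg_R).
  set (E := fun u : ser alg_R => comp2 ee (sh u) X).
  set (Q := fun u : ser alg_R => add (mul (b1 : ser alg_R) u) (mul (mul u u) (E u))).
  set (P := fun u : ser alg_R => mul (cst (- / l)) (add (b0 : ser alg_R) (sh (Q u)))).
  set (Psi := fun u : ser alg_R * ser alg_R => (P (fst u), snd u)).
  (* [formal_fixpoint] works on pairs; the second component is a constant dummy. *)
  set (Psi' := fun u : ser alg_R * ser alg_R => (P (fst u), cst 0 : ser alg_R)).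
  set (C := Rabs (- / l)). assert (HC : 0 <= C) by apply Rabs_pos.
  (* [2 * K'] bounds [b0], and the added 1 leaves room for [rho * QM]. This allows [M] to be fixed
     before [rho]. *)
  set (M := C * (2 * K' + 1)).
  assert (HM : 0 <= M) by (apply Rmult_le_pos; lra).
  set (QM := 2 * K' * M + M * M * (4 * K')).
  assert (HQM : 0 <= QM).
  { unfold QM. assert (0 <= 2 * K' * M) by (repeat apply Rmult_le_pos; lra).
    assert (0 <= M * M * (4 * K')) by (repeat apply Rmult_le_pos; lra). lra. }
  set (rho := Rmin (r / 2) (Rmin (r / (2 * (M + 1))) (/ (QM + 1)))).
  assert (P1 : 0 < r / (2 * (M + 1))) by (apply Rdiv_lt_0_compat; lra).
  assert (P2 : 0 < / (QM + 1)) by (apply Rinv_0_lt_compat; lra).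
  assert (Hrho : 0 < rho) by (repeat apply Rmin_glb_lt; lra).
  assert (L1 : rho <= r / 2) by apply Rmin_l.
  assert (L2 : rho * M <= r / 2).
  { apply Rle_trans with (r / (2 * (M + 1)) * (M + 1)); [|right; field; lra].
    apply Rmult_le_compat; try lra. eapply Rle_trans; [apply Rmin_r | apply Rmin_l]. }
  assert (L3 : rho * QM <= 1).
  { apply Rle_trans with (/ (QM + 1) * (QM + 1)); [|right; field; lra].
    apply Rmult_le_compat; try lra. eapply Rle_trans; [apply Rmin_r | apply Rmin_r]. }
  assert (Hb : forall s b, 0 < s <= r / 2 -> (forall k, Rabs (b k) <= K' / r ^ k) -> ser_nr nrm_R s b (2 * K')).
  { intros s b Hs Hb. assert (H : 0 < s) by lra.
    assert (Hx : s / r <= 1 / 2).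
    { apply Rmult_le_reg_r with r; auto. unfold Rdiv at 1. rewrite Rmult_assoc, Rinv_l by lra. lra. }
    apply (nr_le (ser_nrm nrm_R s H) _ (K' + 2 * (s / r) * K')); [|nra].
    apply (ser_nr_of_bound nrm_R); auto; [lra|].
    specialize (Hb O). simpl in Hb. simpl. lra. }
  assert (NE : forall s u MM, 0 < s <= r / 2 -> ser_nr nrm_R s u MM -> s * MM <= r / 2 -> ser_nr nrm_R s (E u) (4 * K')).
  { intros s u MM Hs Hu HMM. assert (H : 0 < s) by lra.
    apply (nr_comp2 (ser_nrm nrm_R s H) ee (sh u) X r K' (s * MM) (s * 1)); auto; try lra.
    - intros j k. apply (nr_le _ _ (Rabs (e j k))); [apply (nr_cst (ser_nrm nrm_R s H)) | apply Be].
    - apply (nr_sh nrm_R); auto; lra.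
    - now apply (nr_var nrm_R). }
  assert (NQ : forall s u MM, 0 < s <= r / 2 -> ser_nr nrm_R s u MM -> s * MM <= r / 2 ->
     ser_nr nrm_R s (Q u) (2 * K' * MM + MM * MM * (4 * K'))).
  { intros s u MM Hs Hu HMM. assert (H : 0 < s) by lra.
    apply (nr_add (ser_nrm nrm_R s H)); apply (nr_mul (ser_nrm nrm_R s H)); auto.
    - now apply Hb.
    - now apply (nr_mul (ser_nrm nrm_R s H)).
    - now apply (NE s u MM). }
  destruct (formal_fixpoint Psi') with (N := nrm_R) (rho := rho) (M := M) as [[u u'] [Hu [Hn _]]]; auto.
  { intros n u v [C1 _]. split; [|apply cong_refl]. simpl.
    apply cong_mul; [apply cong_refl|]. apply cong_add; [apply cong_refl|]. apply cong_sh.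
    apply cong_add; [apply cong_mul; [apply cong_refl | exact C1]|].
    apply cong_mul; [exact (cong_mul n _ _ _ _ C1 C1)|].
    exact (cong_comp2 n ee _ _ X X (cong_le (S n) n _ _ (Nat.le_succ_diag_r n) (cong_sh n _ _ C1)) (cong_refl n X)). }
  { intros u Hu1 _. split.
    - apply (nr_le (ser_nrm nrm_R rho Hrho) _ (C * (2 * K' + rho * QM))).
      + apply (nr_scal (ser_nrm nrm_R rho Hrho)). apply (nr_add (ser_nrm nrm_R rho Hrho)).
        * apply Hb; auto.
        * apply (nr_sh nrm_R); [|lra]. apply NQ; auto.
      + unfold M. apply Rmult_le_compat_l; lra.
    - apply (nr_le (ser_nrm nrm_R rho Hrho) _ 0); auto. apply (nr_0 (ser_nrm nrm_R rho Hrho)). }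
  injection Hu. intros _ HP. simpl fst in HP, Hn. clear Hu u' Psi Psi'.
  set (s := rho / 2). assert (Hs : 0 < s) by (unfold s; lra).
  set (N := ser_nrm nrm_R s Hs).
  assert (Hn' : nr N u (2 * M)) by exact Hn.
  assert (Hs2 : s * (2 * M) <= r / 2) by (unfold s; lra).
  assert (Hsr : 0 < s <= r / 2) by (unfold s; lra).
  set (psi := fun x => x * PSeries u x).
  exists psi, s. split; [|split; [|split]]; auto.
  - apply (expansion1_analytic (sh (A := alg_R) u) s (s * (2 * M))). split; [auto|split].
    + intros k. apply (ser_nr_coef nrm_R s (sh u)); auto. apply (nr_sh nrm_R); auto; lra.
    + intros x Hx. symmetry. apply (ev_sh nrm_R s u (2 * M) x tt); auto; [lra | exact I].
  - unfold psi; ring.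
  - intros x Hx.
    assert (Hxs : Rabs x <= s) by lra.
    assert (Hd : dom N (x, tt)) by (split; [exact Hxs | exact I]).
    assert (HQn := NQ s u (2 * M) Hsr Hn Hs2).
    assert (HEn := NE s u (2 * M) Hsr Hn Hs2).
    assert (Nb0 : nr N (b0 : ser alg_R) (2 * K')) by now apply Hb.
    assert (Nb1 : nr N (b1 : ser alg_R) (2 * K')) by now apply Hb.
    assert (Nsh := nr_sh nrm_R s (Q u) _ HQn ltac:(lra)).
    set (U := PSeries u x).
    assert (EU : ev (u : ser alg_R) (x, tt) = U) by reflexivity.
    assert (ES : ev (sh (u : ser alg_R)) (x, tt) = psi x).
    { apply (ev_sh nrm_R s u (2 * M) x tt); auto; exact I. }
    assert (Hpsi : Rabs (psi x) <= r / 2).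
    { rewrite <- ES. eapply Rle_trans; [apply (ev_bound N (sh u) (s * (2 * M)) (x, tt)); auto|exact Hs2].
      apply (nr_sh nrm_R); auto; lra. }
    assert (EE : ev (E u) (x, tt) = PSeries (fun j => PSeries (c (2 + j)%nat) x) (psi x)).
    { etransitivity.
      - apply (ev_comp2 N ee (sh u) X r K' (s * (2 * M)) (s * 1)); auto; try lra.
        + intros j k. apply (nr_le _ _ (Rabs (e j k))); [apply (nr_cst N) | apply Be].
        + apply (nr_sh nrm_R); auto; lra.
        + now apply (nr_var nrm_R).
      - rewrite ES. replace (ev X (x, tt)) with x.
        + apply PSeries_ext; intros j. apply PSeries_ext; intros k. now apply (ev_cst N).
        + symmetry. apply (ev_var nrm_R s); auto; exact I. }
    assert (EQ : ev (Q u) (x, tt) = PSeries b1 x * U + U * U * PSeries (fun j => PSeries (c (2 + j)%nat) x) (psi x)).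
    { etransitivity; [apply (ev_add N _ _ _ _ _ (nr_mul N _ _ _ _ Nb1 Hn') (nr_mul N _ _ _ _ (nr_mul N _ _ _ _ Hn' Hn') HEn) Hd)|].
      apply (f_equal2 Rplus); [exact (ev_mul N _ _ _ _ _ Nb1 Hn' Hd)|].
      etransitivity; [exact (ev_mul N _ _ _ _ _ (nr_mul N _ _ _ _ Hn' Hn') HEn Hd)|].
      apply (f_equal2 Rmult); [exact (ev_mul N _ _ _ _ _ Hn' Hn' Hd) | exact EE]. }
    assert (EP : U = - / l * (PSeries b0 x + x * ev (Q u) (x, tt))).
    { rewrite <- EU at 1. rewrite <- HP at 1.
      etransitivity; [apply (ev_scal N (- / l) _ _ _ (nr_add N _ _ _ _ Nb0 Nsh) Hd)|]. f_equal.
      etransitivity; [apply (ev_add N _ _ _ _ _ Nb0 Nsh Hd)|]. f_equal.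
      apply (ev_sh nrm_R s (Q u) _ x tt HQn Hxs I). }
    destruct (expansion_decomp c r K h 1 Hc) as [_ [_ Hh]].
    rewrite Hh by (auto; lra). simpl sum_f_R0.
    rewrite (pseries_factor (c O) r K 1 x Hr (fun k => proj1 (proj2 Hc) O k)); [|intros k Hk; now replace k with O by lia|lra].
    rewrite (PSeries_decr_1 (c 1%nat) x).
    2:{ apply (expansion1_ex_pseries _ r _ _ x (expansion_coef1 c r K h 1 Hc)). lra. }
    change (PSeries (PS_decr_1 (c 1%nat)) x) with (PSeries b1 x).
    change (PSeries (fun k => c O (1 + k)%nat) x) with (PSeries b0 x). fold l.
    change (psi x) with (x * U) at 1 2.
    rewrite EQ in EP.
    set (EV := PSeries (fun j => PSeries (c (2 + j)%nat) x) (psi x)) in *.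
    assert (Hl : l * U = - (PSeries b0 x + x * (PSeries b1 x * U + U * U * EV))).
    { rewrite EP at 1. field. exact H1. }
    transitivity (x * (PSeries b0 x + l * U + x * (PSeries b1 x * U + U * U * EV))); [|rewrite Hl; ring].
    ring.
Qed.

(** The mean of Gamma is first expanded in [eps], whereas [expansion] has the second variable, there
    beta0, outermost. At half the radius the terms are dominated by
    [K * (1 / 2) ^ j * (1 / 2) ^ k]. *)
Lemma PSeries2_swap (d : nat -> nat -> R) r K x y : 0 < r -> (forall j k, Rabs (d j k) <= K / r ^ (j + k)) ->
  Rabs x <= r / 2 -> Rabs y <= r / 2 ->
  PSeries (fun j => PSeries (d j) x) y = PSeries (fun k => PSeries (fun j => d j k) y) x.
Proof.
  intros Hr Hd Hx Hy.
  assert (HK : 0 <= K). { specialize (Hd O O). simpl in Hd. assert (X := Rabs_pos (d O O)). lra. }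
  assert (Hpow : forall z k, Rabs z <= r / 2 -> Rabs (z ^ k) / r ^ k <= (1 / 2) ^ k).
  { intros z k Hz. rewrite <- RPow_abs. apply Rmult_le_reg_r with (r ^ k); [now apply pow_lt|].
    unfold Rdiv at 1. rewrite Rmult_assoc, Rinv_l, Rmult_1_r by (apply Rgt_not_eq; now apply pow_lt).
    rewrite <- Rpow_mult_distr. apply pow_incr. split; [apply Rabs_pos | lra]. }
  assert (Hg : is_series (fun k => (1 / 2) ^ k) 2).
  { apply (is_series_eq _ (/ (1 - 1 / 2))); [|field]. apply is_series_geom. rewrite Rabs_pos_eq; lra. }
  assert (Hb : forall j k, Rabs (d j k * x ^ k * y ^ j) <= K * (1 / 2) ^ j * (1 / 2) ^ k).
  { intros j k. rewrite !Rabs_mult.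
    assert (Hp : 0 < r ^ j) by now apply pow_lt. assert (Hq : 0 < r ^ k) by now apply pow_lt.
    assert (Hpos : forall z i, 0 <= Rabs (z ^ i) / r ^ i).
    { intros z i. apply Rmult_le_pos; [apply Rabs_pos | left; now apply Rinv_0_lt_compat, pow_lt]. }
    apply Rle_trans with (K / r ^ (j + k) * Rabs (x ^ k) * Rabs (y ^ j)).
    - apply Rmult_le_compat_r; [apply Rabs_pos|]. apply Rmult_le_compat_r; [apply Rabs_pos | apply Hd].
    - replace (K / r ^ (j + k) * Rabs (x ^ k) * Rabs (y ^ j))
        with (K * (Rabs (y ^ j) / r ^ j) * (Rabs (x ^ k) / r ^ k)) by (rewrite pow_add; field; lra).
      apply Rmult_le_compat; auto; [now apply Rmult_le_pos|].
      apply Rmult_le_compat_l; auto. }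
  assert (Hs1 : forall j, is_series (fun k => K * (1 / 2) ^ j * (1 / 2) ^ k) (K * (1 / 2) ^ j * 2)).
  { intros j. apply (is_series_scal (K * (1 / 2) ^ j) (fun k => (1 / 2) ^ k) 2 Hg). }
  assert (Hs2 : is_series (fun j => K * (1 / 2) ^ j * 2) (K * 2 * 2)).
  { apply (is_series_ext_R (fun j => (K * 2) * (1 / 2) ^ j)); [intros; ring|].
    apply (is_series_scal (K * 2) (fun k => (1 / 2) ^ k) 2 Hg). }
  assert (E := is_series_unique _ _ (is_series_swap _ _ _ _ Hb Hs1 Hs2)).
  rewrite !PSeries_R.
  transitivity (Series (fun j => Series (fun k => d j k * x ^ k * y ^ j))).
  - apply Series_ext. intros j. rewrite PSeries_R. symmetry. apply Series_scal_r.
  - rewrite <- E. apply Series_ext. intros k. rewrite PSeries_R.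
    transitivity (Series (fun j => (d j k * y ^ j) * x ^ k)); [apply Series_ext; intros; ring | apply Series_scal_r].
Qed.

(** * Roots of odd multiplicity *)

Lemma analytic1_small f eta : analytic1 f -> f 0 = 0 -> 0 < eta ->
  exists d, 0 < d /\ forall x, Rabs x <= d -> Rabs (f x) <= eta.
Proof.
  intros Hf H0 Heta. destruct (expansion_nr_small _ eta Hf Heta) as [d [Hd H]].
  exists d. split; auto. intros x Hx.
  destruct (H d Hd (Rle_refl d)) as [c [Hc Ec]].
  assert (H00 : Rabs 0 <= d) by (rewrite Rabs_R0; lra).
  rewrite (Ec x 0 Hx H00). eapply Rle_trans; [apply (ev_bound (nrm2 d Hd) c _ _ Hc), dom2; auto|].
  rewrite H0, Rabs_R0. lra.
Qed.

Lemma analytic1_plus f g : analytic1 f -> analytic1 g -> analytic1 (fun x => f x + g x).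
Proof. apply (analytic2_plus (fun x _ => f x) (fun x _ => g x)). Qed.

Lemma analytic1_mult f g : analytic1 f -> analytic1 g -> analytic1 (fun x => f x * g x).
Proof. apply (analytic2_mult (fun x _ => f x) (fun x _ => g x)). Qed.

Lemma analytic1_const c : analytic1 (fun _ => c).
Proof. apply (analytic2_const c). Qed.

Lemma analytic1_id : analytic1 (fun x => x).
Proof. apply analytic2_x. Qed.

Lemma analytic1_pow f n : analytic1 f -> analytic1 (fun x => f x ^ n).
Proof. apply (analytic2_pow (fun x _ => f x)). Qed.

Definition pol (p : nat -> R) (n : nat) (w : R) : R := sum_f_R0 (fun j => p j * w ^ j) n.

Lemma analytic1_pol p n : analytic1 (pol p n).
Proof.
  apply (analytic2_sum (fun j x _ => p j * x ^ j)). intros j _.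
  apply analytic2_mult; [apply analytic2_const | apply analytic2_pow, analytic2_x].
Qed.

Lemma pol_0 p n : pol p n 0 = p O.
Proof.
  induction n as [|n IH]; unfold pol in *; simpl in *; [ring|]. rewrite IH. ring.
Qed.

Lemma pol_horner p n w : pol p (S n) w = p O + w * pol (fun j => p (S j)) n w.
Proof.
  unfold pol. rewrite decomp_sum by lia. simpl pred. rewrite scal_sum. simpl. f_equal; [ring|].
  apply sum_eq. intros; ring.
Qed.

(** The coefficient of degree [n - 1] is followed through the translation because it later rules out
    a root of full multiplicity. *)
Lemma pol_shift p n w0 : exists p', (forall h, pol p n (w0 + h) = pol p' n h) /\ p' n = p n /\
  ((1 <= n)%nat -> p' (n - 1)%nat = p (n - 1)%nat + INR n * w0 * p n).
Proof.
  revert p. induction n as [|n IH]; intros p.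
  - exists p. split; [reflexivity | split; [reflexivity | lia]].
  - destruct (IH (fun j => p (S j))) as [q [Hq [Hn Hs]]].
    exists (fun k => match k with O => p O + w0 * q O
      | S k' => q k' + (if Nat.leb k n then w0 * q k else 0) end).
    split; [|split].
    + intros h. rewrite !pol_horner, Hq, Rmult_plus_distr_r.
      assert (E : w0 * pol q n h + h * pol q n h = w0 * q O + h * pol (fun j => q j + (if Nat.leb (S j) n then w0 * q (S j) else 0)) n h).
      { unfold pol at 3. rewrite (sum_eq _ (fun j => q j * h ^ j + (if Nat.leb (S j) n then w0 * q (S j) else 0) * h ^ j)) by (intros; ring).
        rewrite plus_sum. fold (pol q n h).
        enough (X : w0 * pol q n h = w0 * q O + h * sum_f_R0 (fun j => (if Nat.leb (S j) n then w0 * q (S j) else 0) * h ^ j) n) by (rewrite X; ring).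
        destruct n as [|n]; [unfold pol; simpl; ring|].
        rewrite tech5, pol_horner.
        replace (Nat.leb (S (S n)) (S n)) with false by (symmetry; apply Nat.leb_gt; lia).
        rewrite (sum_eq _ (fun j => (fun j => q (S j)) j * h ^ j * w0)).
        - rewrite <- scal_sum. fold (pol (fun j => q (S j)) n h). ring.
        - intros j Hj. replace (Nat.leb (S j) (S n)) with true by (symmetry; apply Nat.leb_le; lia). ring. }
      transitivity (p O + (w0 * pol q n h + h * pol q n h)); [ring|]. rewrite E. ring.
    + replace (Nat.leb (S n) n) with false by (symmetry; apply Nat.leb_gt; lia). rewrite Hn. ring.
    + intros _. replace (S n - 1)%nat with n by lia. destruct n as [|n].
      * rewrite Hn. simpl. ring.
      * replace (Nat.leb (S n) (S n)) with true by (symmetry; apply Nat.leb_le; lia).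
        rewrite Hn. replace (S n - 1)%nat with n in Hs by lia. rewrite Hs by lia.
        rewrite (S_INR (S n)). ring.
Qed.

Lemma pol_factor p n m w : (forall j, (j < m)%nat -> p j = 0) -> (m <= n)%nat ->
  pol p n w = w ^ m * pol (fun j => p (m + j)%nat) (n - m) w.
Proof.
  revert p n. induction m as [|m IH]; intros p n Hz Hn.
  - rewrite Nat.sub_0_r, pow_O, Rmult_1_l. reflexivity.
  - destruct n as [|n]; [lia|]. rewrite pol_horner, Hz by lia.
    rewrite (IH (fun j => p (S j)) n); [simpl; ring | intros; apply Hz; lia | lia].
Qed.

Lemma pol_abs_le p n w : 1 <= Rabs w -> Rabs (pol p n w) <= sum_f_R0 (fun j => Rabs (p j)) n * Rabs w ^ n.
Proof.
  intros Hw. induction n as [|n IH].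
  - unfold pol; simpl. rewrite Rmult_1_r. lra.
  - change (pol p (S n) w) with (pol p n w + p (S n) * w ^ S n).
    eapply Rle_trans; [apply Rabs_triang|]. rewrite tech5, Rmult_plus_distr_r. apply Rplus_le_compat.
    + eapply Rle_trans; [exact IH|]. apply Rmult_le_compat_l; [apply cond_pos_sum; intros; apply Rabs_pos|].
      apply Rle_pow; auto.
    + rewrite Rabs_mult, RPow_abs. lra.
Qed.

Lemma least_nat (P : nat -> Prop) : (exists n, P n) -> exists n, P n /\ forall j, (j < n)%nat -> ~ P j.
Proof.
  intros [n Hn]. revert Hn. induction n as [n IH] using lt_wf_ind. intros Hn.
  destruct (classic (exists j, (j < n)%nat /\ P j)) as [[j [Hj HP]]|H].
  - now apply (IH j).
  - exists n. split; auto. intros j Hj HP. apply H. now exists j.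
Qed.

(** The supremum [v0] of the set where the polynomial is negative is a zero at
    which the sign changes, hence a zero of odd multiplicity. *)
Lemma odd_multiplicity_root_pos q d : Nat.Odd d -> 0 < q d ->
  exists v0 q' n', Nat.Odd n' /\ (n' <= d)%nat /\ (forall h, pol q d (v0 + h) = pol q' d h) /\
    q' (d - 1)%nat = q (d - 1)%nat + INR d * v0 * q d /\
    (forall j, (j < n')%nat -> q' j = 0) /\ q' n' <> 0.
Proof.
  intros Hd Hq. destruct d as [|d]; [destruct Hd; lia|].
  set (Bs := sum_f_R0 (fun j => Rabs (q j)) d).
  assert (HBs : 0 <= Bs) by (apply cond_pos_sum; intros; apply Rabs_pos).
  (* A Cauchy bound for the roots: where [1 <= Rabs v], the lower terms are at most
     [Bs * Rabs v ^ d], so beyond [B] the leading term decides the sign. *)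
  set (B := 1 + Bs / q (S d)).
  assert (HB : 1 <= B).
  { assert (0 <= Bs / q (S d)) by (apply Rmult_le_pos; auto; left; now apply Rinv_0_lt_compat). unfold B; lra. }
  assert (HqB : q (S d) * B = q (S d) + Bs) by (unfold B; field; lra).
  assert (Hlow : forall v, 1 <= Rabs v -> Rabs (pol q (S d) v - q (S d) * v ^ S d) <= Bs * Rabs v ^ d).
  { intros v Hv. replace (pol q (S d) v - q (S d) * v ^ S d) with (pol q d v) by (unfold pol; simpl; ring).
    now apply pol_abs_le. }
  destruct (completeness (fun v => pol q (S d) v < 0)) as [v0 [Hub Hlub]].
  { exists B. intros v Hv. apply Rnot_lt_le. intros Hlt.
    assert (Ha : Rabs v = v) by (apply Rabs_pos_eq; lra).
    assert (X := Hlow v ltac:(lra)). apply Rabs_le_between in X. rewrite Ha in X.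
    assert (Hp : 0 < v ^ d) by (apply pow_lt; lra). simpl in X.
    assert (Y : 0 <= v ^ d * (q (S d) * v - Bs)).
    { apply Rmult_le_pos; [lra|]. assert (q (S d) * B <= q (S d) * v) by (apply Rmult_le_compat_l; lra). lra. }
    lra. }
  { exists (- B).
    assert (Ha : Rabs (- B) = B) by (rewrite Rabs_Ropp; apply Rabs_pos_eq; lra).
    assert (X := Hlow (- B) ltac:(lra)). apply Rabs_le_between in X. rewrite Ha in X.
    assert (Hp : 0 < B ^ d) by (apply pow_lt; lra).
    assert (E : (- B) ^ S d = - (B * B ^ d)).
    { destruct Hd as [k Hk]. assert (Hdk : d = (2 * k)%nat) by lia. simpl. rewrite Hdk, !pow_mult.
      replace ((- B) ^ 2) with (B ^ 2) by ring. ring. }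
    rewrite E in X.
    assert (Y : 0 < B ^ d * (q (S d) * B - Bs)) by (apply Rmult_lt_0_compat; lra).
    assert (Z : pol q (S d) (- B) <= - (B ^ d * (q (S d) * B - Bs))) by lra. lra. }
  assert (Hpos : forall v, v0 < v -> 0 <= pol q (S d) v).
  { intros v Hv. apply Rnot_lt_le. intros Hl. specialize (Hub v Hl). lra. }
  destruct (pol_shift q (S d) v0) as [q' [Hq' [Hl Hs]]].
  destruct (least_nat (fun j => q' j <> 0)) as [n' [Hn1 Hn2]].
  { exists (S d). rewrite Hl. lra. }
  assert (Hnd : (n' <= S d)%nat).
  { apply Nat.nlt_ge. intros Hlt. apply (Hn2 _ Hlt). rewrite Hl. lra. }
  assert (Hz : forall j, (j < n')%nat -> q' j = 0).
  { intros j Hj. apply NNPP. exact (Hn2 j Hj). }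
  exists v0, q', n'. split; [|split; [|split; [|split; [|split]]]]; auto; [|apply Hs; lia].
  set (R := pol (fun j => q' (n' + j)%nat) (S d - n')).
  assert (HR : forall h, pol q (S d) (v0 + h) = h ^ n' * R h).
  { intros h. rewrite Hq'. now apply pol_factor. }
  assert (HR0 : R 0 = q' n'). { unfold R. rewrite pol_0. f_equal; lia. }
  destruct (analytic1_small (fun h => R h + - R 0) (Rabs (R 0) / 2)) as [e [He Hsm]].
  { apply analytic1_plus; [apply analytic1_pol | apply analytic1_const]. }
  { ring. }
  { apply Rdiv_lt_0_compat; [|lra]. rewrite HR0. now apply Rabs_pos_lt. }
  (* Just to the right of [v0] the polynomial is nonnegative, [h ^ n'] is positive, and the cofactor
     keeps the sign of [R 0]. *)
  assert (Hp0 : 0 < R 0).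
  { apply Rnot_le_lt. intros Hle.
    assert (X := Hsm e ltac:(rewrite Rabs_pos_eq; lra)). rewrite (Rabs_left1 (R 0)) in X by auto.
    apply Rabs_le_between in X. rewrite HR0 in *.
    assert (Y := Hpos (v0 + e) ltac:(lra)). rewrite HR in Y.
    assert (0 < e ^ n') by now apply pow_lt.
    assert (0 < e ^ n' * - R e) by (apply Rmult_lt_0_compat; lra). lra. }
  rewrite (Rabs_pos_eq (R 0)) in Hsm by lra.
  (* If [n'] were even, the polynomial would also be nonnegative on [[v0 - e, v0]], and [v0 - e]
     would be a smaller upper bound of the set. *)
  destruct (Nat.Even_or_Odd n') as [[k Hk]|]; auto. exfalso.
  assert (Hub' : is_upper_bound (fun v => pol q (S d) v < 0) (v0 - e)).
  { intros v Hv. apply Rnot_lt_le. intros Hlt.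
    assert (Hle := Hub v Hv). replace v with (v0 + (v - v0)) in Hv by ring. rewrite HR in Hv.
    assert (X := Hsm (v - v0) ltac:(rewrite Rabs_left1; lra)). apply Rabs_le_between in X.
    assert (0 <= (v - v0) ^ n'). { rewrite Hk, pow_mult. apply pow_le. apply pow2_ge_0. }
    assert (0 <= (v - v0) ^ n' * R (v - v0)) by (apply Rmult_le_pos; lra). lra. }
  specialize (Hlub _ Hub'). lra.
Qed.

Lemma odd_multiplicity_root q d : Nat.Odd d -> q d <> 0 ->
  exists v0 q' n', Nat.Odd n' /\ (n' <= d)%nat /\ (forall h, pol q d (v0 + h) = pol q' d h) /\
    q' (d - 1)%nat = q (d - 1)%nat + INR d * v0 * q d /\
    (forall j, (j < n')%nat -> q' j = 0) /\ q' n' <> 0.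
Proof.
  intros Hd Hq. destruct (Rlt_le_dec 0 (q d)) as [Hp|Hp]; [now apply odd_multiplicity_root_pos|].
  destruct (odd_multiplicity_root_pos (fun j => - q j) d Hd ltac:(lra)) as (v0 & q' & n' & H1 & H2 & H3 & H4 & H5 & H6).
  assert (Hn : forall p h, pol (fun j => - p j) d h = - pol p d h).
  { intros p h. unfold pol. replace (- sum_f_R0 (fun j => p j * h ^ j) d) with (-1 * sum_f_R0 (fun j => p j * h ^ j) d) by ring.
    rewrite scal_sum. apply sum_eq. intros; ring. }
  exists v0, (fun j => - q' j), n'. split; [|split; [|split; [|split; [|split]]]]; auto.
  - intros h. rewrite Hn, <- H3, Hn. ring.
  - rewrite H4. ring.
  - intros j Hj. rewrite H5 by auto. ring.
  - lra.
Qed.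

Lemma odd_power_root m v : Nat.Odd m -> v <> 0 -> exists w, w <> 0 /\ w ^ m = v.
Proof.
  intros Hm Hv.
  assert (Hm0 : (0 < m)%nat) by (destruct Hm; lia).
  assert (HmR : 0 < INR m) by now apply lt_0_INR.
  assert (Hpos : forall u, 0 < u -> exists w, 0 < w /\ w ^ m = u).
  { intros u Hu. exists (Rpower u (/ INR m)). split; [apply exp_pos|].
    rewrite <- Rpower_pow by apply exp_pos. rewrite Rpower_mult, Rinv_l by lra. now apply Rpower_1. }
  destruct (Rlt_le_dec 0 v) as [Hp|Hp].
  - destruct (Hpos v Hp) as [w [H1 H2]]. exists w. split; auto. lra.
  - destruct (Hpos (- v) ltac:(lra)) as [w [H1 H2]]. exists (- w). split; [lra|].
    destruct Hm as [k Hk]. rewrite Hk in *. rewrite Nat.add_1_r in *. simpl pow in *. 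
    replace (k + (k + 0))%nat with (2 * k)%nat in * by lia. rewrite pow_mult in *.
    replace ((- w) ^ 2) with (w ^ 2) by ring. lra.
Qed.

(** For [m >= 1] and [w0 <> 0] the value [kap 0] is nonzero, so [w ^ m] is a local coordinate at
    [w0]: a root of [q] at [w0 ^ m] becomes a root of [q (w ^ m)] at [w0] with the same
    multiplicity. *)
Lemma pow_increment w0 m : exists kap, analytic1 kap /\ kap 0 = INR m * w0 ^ (m - 1) /\
  forall h, (w0 + h) ^ m = w0 ^ m + h * kap h.
Proof.
  induction m as [|m [kap [H1 [H2 H3]]]].
  - exists (fun _ => 0). split; [apply analytic1_const|]. split; [simpl; ring|]. intros; simpl; ring.
  - exists (fun h => w0 ^ m + (w0 + h) * kap h). split; [|split].
    + apply analytic1_plus; [apply analytic1_const|]. apply analytic1_mult; auto.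
      apply analytic1_plus; [apply analytic1_const | apply analytic1_id].
    + rewrite H2, S_INR, Rplus_0_r. replace (S m - 1)%nat with m by lia. destruct m as [|m]; [simpl; ring|].
      replace (S m - 1)%nat with m by lia. simpl pow. ring.
    + intros h. simpl. rewrite H3. ring.
Qed.

Lemma sum_gap (f : nat -> R) N m : (1 <= m)%nat -> (forall j, (N < j)%nat -> (j < N + m)%nat -> f j = 0) ->
  sum_f_R0 f (N + m) = sum_f_R0 f N + f (N + m)%nat.
Proof.
  induction m as [|m IH]; intros Hm Hz; [lia|]. rewrite Nat.add_succ_r, tech5. f_equal.
  destruct m as [|m]; [now rewrite Nat.add_0_r|].
  rewrite IH; [|lia|intros; apply Hz; lia]. rewrite (Hz (N + S m)%nat) by lia. ring.
Qed.

Lemma pol_reindex p e m d w : (1 <= m)%nat ->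
  (forall j, (j <= e + m * d)%nat -> p j <> 0 -> exists i, j = (e + m * i)%nat) ->
  pol p (e + m * d) w = w ^ e * pol (fun i => p (e + m * i)%nat) d (w ^ m).
Proof.
  intros Hm. induction d as [|d IH]; intros Hz.
  - rewrite Nat.mul_0_r, Nat.add_0_r in *. rewrite (pol_factor p e e); [|intros j Hj|lia].
    + rewrite Nat.sub_diag. unfold pol; simpl. rewrite Nat.mul_0_r. ring.
    + apply NNPP. intros Hn. destruct (Hz j ltac:(lia) Hn) as [i Hi]. lia.
  - replace (e + m * S d)%nat with ((e + m * d) + m)%nat by lia.
    unfold pol at 1. rewrite sum_gap; auto.
    + fold (pol p (e + m * d) w). rewrite IH by (intros j Hj; apply Hz; lia).
      unfold pol at 2. rewrite tech5. fold (pol (fun i => p (e + m * i)%nat) d (w ^ m)).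
      rewrite <- pow_mult. replace (e + m * d + m)%nat with (e + m * S d)%nat by lia. rewrite pow_add. ring.
    + intros j Hj1 Hj2. destruct (Req_dec (p j) 0) as [->|Hn]; [ring|]. exfalso.
      destruct (Hz j ltac:(lia) Hn) as [i Hi]. subst j.
      assert (m * d < m * i)%nat by lia. assert (m * i < m * S d)%nat by lia.
      apply Nat.mul_lt_mono_pos_l in H; [|lia]. apply Nat.mul_lt_mono_pos_l in H0; [|lia]. lia.
Qed.

Lemma fact_divide k n : (k <= n)%nat -> Nat.divide (fact k) (fact n).
Proof.
  induction n as [|n IH]; intros H.
  - replace k with O by lia. apply Nat.divide_refl.
  - destruct (Nat.eq_dec k (S n)) as [->|Hne]; [apply Nat.divide_refl|].
    change (fact (S n)) with (S n * fact n)%nat. apply Nat.divide_mul_r. apply IH; lia.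
Qed.

(** In [t! = t * (t - 1)!] the factor [m] divides [t], and [k!] divides [(t - 1)!]. *)
Lemma fact_divide_mul m k t n : Nat.divide m t -> (k < t)%nat -> (t <= n)%nat -> Nat.divide (m * fact k) (fact n).
Proof.
  intros Hm Hk Hn. apply Nat.divide_trans with (fact t); [|now apply fact_divide].
  destruct t as [|t]; [lia|]. change (fact (S t)) with (S t * fact t)%nat.
  destruct Hm as [a Ha]. destruct (fact_divide k t ltac:(lia)) as [b Hb].
  exists (a * b)%nat. rewrite Ha, Hb. lia.
Qed.

(** With [e] the lowest degree present, [p] is [w ^ e * q (w ^ m)] and [n = e + m * d] is odd. If
    [e] is odd, the root 0 has multiplicity [e]. If [e] is even, [m] and [d] are both odd: [q] has a
    real root of odd multiplicity, nonzero because [q 0 <> 0], and this root has a real [m]-th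
    root. *)
Lemma odd_factor p n m : Nat.Odd n -> (1 <= m)%nat -> p n <> 0 -> p (n - 1)%nat = 0 ->
  (exists j, (j < n)%nat /\ p j <> 0) ->
  (forall j, (j < n)%nat -> p j <> 0 -> Nat.divide m (n - j)) ->
  exists w0 n' Q, Nat.Odd n' /\ (n' < n)%nat /\ Nat.divide (m * fact n') (fact n) /\
    analytic1 Q /\ Q 0 <> 0 /\ forall w, pol p n (w0 + w) = w ^ n' * Q w.
Proof.
  intros Hn Hm Hpn Hpn1 Hex Hdiv.
  destruct (least_nat (fun j => p j <> 0)) as [e [He1 He2]]; [now exists n|].
  assert (Hen : (e < n)%nat).
  { destruct Hex as [j [Hj1 Hj2]]. apply Nat.nle_gt. intros Hle. apply (He2 j); auto. lia. }
  assert (Hz : forall j, (j < e)%nat -> p j = 0) by (intros j Hj; apply NNPP, (He2 j Hj)).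
  destruct (Hdiv e Hen He1) as [d Hd].
  destruct (Nat.Even_or_Odd e) as [Hee|Heo].
  - assert (Hnm : n = (e + m * d)%nat) by lia.
    assert (Hmd : Nat.Odd (m * d)).
    { destruct Hn as [a Ha]. destruct Hee as [b Hb]. exists (a - b)%nat. lia. }
    apply Nat.odd_spec in Hmd. rewrite Nat.odd_mul in Hmd. apply andb_prop in Hmd. destruct Hmd as [Hmo Hdo].
    apply Nat.odd_spec in Hmo. apply Nat.odd_spec in Hdo.
    set (q := fun i => p (e + m * i)%nat).
    assert (Hqd : q d <> 0) by (unfold q; now rewrite <- Hnm).
    destruct (odd_multiplicity_root q d Hdo Hqd) as (v0 & q' & n' & O1 & O2 & O3 & O4 & O5 & O6).
    assert (Hn'0 : (0 < n')%nat) by (destruct O1; lia).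
    assert (Hv0 : v0 <> 0).
    { intros Hv0. assert (X := O3 0). rewrite Rplus_0_r, Hv0, !pol_0 in X. rewrite (O5 O Hn'0) in X.
      unfold q in X. rewrite Nat.mul_0_r, Nat.add_0_r in X. auto. }
    destruct (odd_power_root m v0 Hmo Hv0) as [w0 [Hw0 Hwm]].
    destruct (pow_increment w0 m) as [kap [K1 [K2 K3]]].
    set (Rr := pol (fun j => q' (n' + j)%nat) (d - n')).
    exists w0, n', (fun w => (w0 + w) ^ e * (kap w ^ n' * Rr (w * kap w))).
    assert (Hd0 : (0 < d)%nat) by (destruct Hdo; lia).
    assert (Hmd' : (d <= m * d)%nat) by nia.
    split; [|split; [|split; [|split; [|split]]]]; auto.
    (* Multiplicity [n] would force [m = 1], [e = 0] and a root [v0] of full multiplicity. But as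
       [p (n - 1)] is 0, coefficient [d - 1] of [q'] is then [INR d * v0 * q d], which is
       nonzero. *)
    + destruct (Nat.eq_dec (m * d) n) as [E|E]; [|lia].
      destruct (Nat.eq_dec m 1) as [E1|E1]; [|nia].
      assert (Hdn : d = n) by lia. assert (e = O) by lia.
      assert (Hq1 : q' (d - 1)%nat <> 0).
      { rewrite O4. unfold q at 1. replace (e + m * (d - 1))%nat with (n - 1)%nat by nia. rewrite Hpn1, Rplus_0_l.
        apply Rmult_integral_contrapositive. split; auto. apply Rmult_integral_contrapositive. split; auto.
        apply not_0_INR; lia. }
      apply Nat.nle_gt. intros Hle. apply Hq1. apply O5. lia.
    (* [m * n'!] divides [m * d!]. This divides [(m * d)!], where [m * d] is the top factor and
       [(d - 1)!] divides the rest; finally [m * d <= n]. *)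
    + apply Nat.divide_trans with (m * fact d)%nat; [apply Nat.mul_divide_mono_l, fact_divide; lia|].
      destruct d as [|d']; [lia|].
      apply Nat.divide_trans with (fact (m * S d')); [|apply fact_divide; lia].
      remember (m * S d')%nat as t eqn:Et. destruct t as [|t]; [lia|].
      change (fact (S t)) with (S t * fact t)%nat. rewrite Et at 1.
      change (fact (S d')) with (S d' * fact d')%nat. rewrite Nat.mul_assoc.
      apply Nat.mul_divide_mono_l, fact_divide. lia.
    + apply analytic1_mult.
      * apply analytic1_pow, analytic1_plus; [apply analytic1_const | apply analytic1_id].
      * apply analytic1_mult; [now apply analytic1_pow|].
        apply (analytic1_comp Rr (fun w _ => w * kap w)); [apply analytic1_pol| |ring].
        apply (analytic1_mult (fun w => w) kap); auto using analytic1_id.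
    + rewrite Rplus_0_r, Rmult_0_l. unfold Rr. rewrite pol_0, Nat.add_0_r, K2.
      repeat (apply Rmult_integral_contrapositive; split); auto; try (apply pow_nonzero; auto).
      apply Rmult_integral_contrapositive. split; [apply not_0_INR; lia | now apply pow_nonzero].
    + intros w. rewrite Hnm at 1. rewrite pol_reindex; auto.
      * rewrite K3, Hwm. fold q. rewrite O3. rewrite (pol_factor q' d n'); auto. fold Rr.
        rewrite Rpow_mult_distr. ring.
      * intros j Hj Hp. assert (Hej : (e <= j)%nat) by (apply Nat.nlt_ge; intros Hlt; now apply (He2 j Hlt)).
        destruct (Nat.eq_dec j n) as [->|Hne]; [now exists d|].
        destruct (Hdiv j ltac:(lia) Hp) as [b Hb]. exists (d - b)%nat.
        assert (b <= d)%nat by nia. nia.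
  - exists 0, e, (pol (fun j => p (e + j)%nat) (n - e)).
    split; [|split; [|split; [|split; [|split]]]]; auto.
    (* [m * (e / m + 1)] is the least multiple of [m] above [e]. It is at most [n] because [m]
       divides [n - e], which is positive. *)
    + assert (Hdiv1 := Nat.div_mod_eq e m). assert (Hm1 := Nat.mod_upper_bound e m ltac:(lia)).
      apply (fact_divide_mul m e (m * (e / m + 1))%nat n).
      * exists (e / m + 1)%nat. lia.
      * lia.
      * assert (m <= n - e)%nat by (destruct d; nia). nia.
    + apply analytic1_pol.
    + now rewrite pol_0, Nat.add_0_r.
    + intros w. rewrite Rplus_0_l. apply pol_factor; auto. lia.
Qed.

Lemma Rpower_root_pow x N : 0 < x -> (1 <= N)%nat -> Rpower x (/ INR N) ^ N = x.
Proof.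
  intros Hx HN. assert (HNR : 0 < INR N) by (apply lt_0_INR; lia).
  rewrite <- Rpower_pow by apply exp_pos. rewrite Rpower_mult, Rinv_l by lra. now apply Rpower_1.
Qed.

Lemma Rpower_root_lt x N d : 0 < x -> (1 <= N)%nat -> 0 < d -> x < d ^ N -> Rpower x (/ INR N) < d.
Proof.
  intros Hx HN Hd Hlt. apply Rnot_le_lt. intros Hle.
  assert (X := pow_incr d (Rpower x (/ INR N)) N (conj (Rlt_le _ _ Hd) Hle)).
  rewrite Rpower_root_pow in X by auto. lra.
Qed.

(** * Newton polygon and real Puiseux branches *)

Lemma CV_radius_ge a r K : 0 < r -> (forall k, Rabs (a k) * r ^ k <= K) -> Rbar_le r (CV_radius a).
Proof.
  intros Hr H. apply (proj1 (CV_radius_bounded a)). exists K. intros n.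
  rewrite Rabs_mult, (Rabs_right (r ^ n)); auto. apply Rle_ge, pow_le; lra.
Qed.

Lemma INR_le_pow2 j : INR (S j) <= 2 ^ j.
Proof.
  induction j as [|j IH]; [simpl; lra|]. rewrite S_INR. simpl pow.
  assert (1 <= 2 ^ j) by (apply pow_R1_Rle; lra). lra.
Qed.

(** The factor [INR (S j)] is at most [2 ^ j], which halving the radius absorbs. *)
Lemma expansion_deriv_y c r K f : expansion c r K f -> exists f',
  expansion (fun j k => INR (S j) * c (S j) k) (r / 2) (K / r) f' /\
  forall x y, Rabs x < r / 2 -> Rabs y < r / 2 -> is_derive (f x) y (f' x y).
Proof.
  intros Hc. assert (Hr := proj1 Hc). assert (HK := expansion_K _ _ _ _ Hc).
  exists (fun x y => PSeries (fun j => PSeries (fun k => INR (S j) * c (S j) k) x) y).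
  split.
  - split; [lra|split; auto].
    intros j k. rewrite Rabs_mult, (Rabs_pos_eq (INR (S j))) by apply pos_INR.
    apply Rle_trans with (2 ^ (j + k) * (K / r / r ^ (j + k))).
    + apply Rmult_le_compat; auto using pos_INR, Rabs_pos.
      * eapply Rle_trans; [apply INR_le_pow2|]. apply Rle_pow; [lra|lia].
      * eapply Rle_trans; [apply (proj1 (proj2 Hc))|]. right. simpl. field.
        split; [lra|]. apply Rgt_not_eq, pow_lt, Hr.
    + right. replace ((r / 2) ^ (j + k)) with (r ^ (j + k) / 2 ^ (j + k))
        by (unfold Rdiv; rewrite Rpow_mult_distr, pow_inv; reflexivity).
      assert (0 < r ^ (j + k)) by now apply pow_lt. assert (0 < 2 ^ (j + k)) by (apply pow_lt; lra).
      field. lra.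
  - intros x y Hx Hy.
    assert (Hs := expansion_section c r K f x Hc ltac:(lra)).
    apply (is_derive_ext_loc (PSeries (fun j => PSeries (c j) x))).
    + assert (Hd : 0 < r / 2 - Rabs y) by lra. exists (mkposreal _ Hd). intros z Hz.
      symmetry. apply (proj2 (proj2 Hc)); [lra|].
      replace z with (y + (z - y)) by ring. eapply Rle_lt_trans; [apply Rabs_triang|].
      assert (Rabs (z - y) < r / 2 - Rabs y) by exact Hz. lra.
    + rewrite (PSeries_ext _ (PS_derive (fun j => PSeries (c j) x))).
      * apply is_derive_PSeries. apply Rbar_lt_le_trans with r; [simpl; lra|].
        apply (CV_radius_ge _ r (2 * K)); auto. intros j. apply bound_mul; auto. apply Hs.
      * intros j. unfold PS_derive. apply PSeries_scal.
Qed.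

(** The factorial quotients are recorded only as some positive [l], since later steps ask merely
    whether a coefficient vanishes. *)
Lemma expansion_Derive_n c r K f m : expansion c r K f -> exists c' r' K' f',
  expansion c' r' K' f' /\ (forall j k, exists l, 0 < l /\ c' j k = l * c (m + j)%nat k) /\
  forall x y, Rabs x < r' -> Rabs y < r' -> Derive_n (f x) m y = f' x y.
Proof.
  intros Hc. induction m as [|m (c' & r' & K' & f' & H1 & H2 & H3)].
  - exists c, r, K, f. split; [auto|split]; [|reflexivity]. intros j k. exists 1. split; [lra | simpl; ring].
  - destruct (expansion_deriv_y c' r' K' f' H1) as [f2 [H4 H5]].
    exists (fun j k => INR (S j) * c' (S j) k), (r' / 2), (K' / r'), f2. split; [auto|split].
    + intros j k. destruct (H2 (S j) k) as [l [Hl E]]. exists (INR (S j) * l). split.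
      * apply Rmult_lt_0_compat; auto. apply lt_0_INR; lia.
      * rewrite E. replace (m + S j)%nat with (S m + j)%nat by lia. ring.
    + assert (Hr' := proj1 H1). intros x y Hx Hy. simpl.
      rewrite (Derive_ext_loc _ (f' x)).
      * apply is_derive_unique. now apply H5.
      * assert (Hd : 0 < r' / 2 - Rabs y) by lra. exists (mkposreal _ Hd). intros z Hz.
        apply H3; [lra|].
        replace z with (y + (z - y)) by ring. eapply Rle_lt_trans; [apply Rabs_triang|].
        assert (Rabs (z - y) < r' / 2 - Rabs y) by exact Hz. lra.
Qed.

Lemma expansion_row0_unique c r K f a r' K' d : expansion c r K f -> 0 < r' -> 0 < d ->
  (forall j, Rabs (a j) <= K' / r' ^ j) -> (forall y, Rabs y < d -> f 0 y = PSeries a y) ->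
  forall j, c j O = a j.
Proof.
  intros Hc Hr' Hd Ha H. assert (Hr := proj1 Hc). assert (HK := expansion_K _ _ _ _ Hc).
  assert (HK' : 0 <= K'). { specialize (Ha O). simpl in Ha. assert (X := Rabs_pos (a O)). lra. }
  set (s := Rmin r r'). assert (Hs : 0 < s) by now apply Rmin_glb_lt.
  apply (PSeries_coef_unique _ a s K K' (Rmin d r) Hs); [now apply Rmin_glb_lt| | |].
  - intros j. apply bound_mul; auto. eapply Rle_trans; [apply (proj1 (proj2 Hc))|].
    rewrite Nat.add_0_r. apply div_pow_le; auto. split; auto. apply Rmin_l.
  - intros j. apply bound_mul; auto. eapply Rle_trans; [apply Ha|].
    apply div_pow_le; auto. split; auto. apply Rmin_r.
  - intros y Hy. rewrite <- H by (eapply Rlt_le_trans; [exact Hy | apply Rmin_l]).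
    rewrite (proj2 (proj2 Hc)).
    + apply PSeries_ext. intros j. now rewrite PSeries_0.
    + now rewrite Rabs_R0.
    + eapply Rlt_le_trans; [exact Hy | apply Rmin_r].
Qed.

Lemma expansion_order c r K f S' n d : expansion c r K f -> analytic1 S' -> 0 < d ->
  (forall y, Rabs y < d -> f 0 y = y ^ n * S' y) -> (forall j, (j < n)%nat -> c j O = 0) /\ c n O = S' 0.
Proof.
  intros Hc HS Hd H.
  destruct (analytic1_expansion S' HS) as [b [r' [K' [Hr' [Hb Hf]]]]].
  assert (HK' : 0 <= K'). { specialize (Hb O). simpl in Hb. assert (X := Rabs_pos (b O)). lra. }
  assert (E : forall j, c j O = PS_incr_n b n j).
  { apply (expansion_row0_unique c r K f _ r' (K' * r' ^ n) (Rmin d r') Hc Hr'); [now apply Rmin_glb_lt| |].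
    - intros j. rewrite PS_incr_n_simplify. destruct (le_lt_dec n j) as [Hl|Hl].
      + eapply Rle_trans; [apply Hb|]. replace (r' ^ j) with (r' ^ (j - n) * r' ^ n).
        * right. field. split; apply Rgt_not_eq; now apply pow_lt.
        * rewrite <- pow_add. f_equal; lia.
      + unfold zero; simpl. rewrite Rabs_R0. apply Rmult_le_pos.
        * apply Rmult_le_pos; auto. apply pow_le; lra.
        * left. now apply Rinv_0_lt_compat, pow_lt.
    - intros y Hy. rewrite PSeries_incr_n, H by (eapply Rlt_le_trans; [exact Hy | apply Rmin_l]).
      rewrite Hf; auto. eapply Rlt_le_trans; [exact Hy | apply Rmin_r]. }
  split.
  - intros j Hj. rewrite E, PS_incr_n_simplify. destruct (le_lt_dec n j); [lia|reflexivity].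
  - rewrite E, PS_incr_n_simplify. destruct (le_lt_dec n n); [|lia]. rewrite Nat.sub_diag.
    rewrite Hf by (rewrite Rabs_R0; auto). now rewrite PSeries_0.
Qed.

(** The [m]-th derivative of [h] in the second variable has a simple zero at the origin, so it
    vanishes along a curve [psi]. Recentring at that curve kills the coefficient of [z ^ m] for
    every [x]. Since [psi 0 = 0], the row [x = 0] is unchanged. *)
Lemma tschirnhaus c r K h m : expansion c r K h -> (forall j, (j <= m)%nat -> c j O = 0) -> c (S m) O <> 0 ->
  exists psi c' r' K', analytic1 psi /\ psi 0 = 0 /\ expansion c' r' K' (fun x z => h x (psi x + z)) /\
    (forall k, c' m k = 0) /\ (forall j, (j <= m)%nat -> c' j O = 0) /\ c' (S m) O <> 0.
Proof.
  intros Hc Hz Hnz. assert (Hr := proj1 Hc).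
  destruct (expansion_Derive_n c r K h m Hc) as (c1 & r1 & K1 & f1 & E1 & E2 & E3).
  assert (Z0 : c1 O O = 0).
  { destruct (E2 O O) as [l [_ E]]. rewrite E, Nat.add_0_r, Hz by lia. ring. }
  assert (Z1 : c1 1%nat O <> 0).
  { destruct (E2 1%nat O) as [l [Hl E]]. rewrite E, Nat.add_1_r.
    apply Rmult_integral_contrapositive. split; auto. lra. }
  destruct (implicit_function c1 r1 K1 f1 E1 Z0 Z1) as [psi [d [P1 [P2 [Hd P3]]]]].
  assert (Ht : analytic2 (fun x z => h x (psi x + z))).
  { apply (analytic2_comp h (fun x _ => x) (fun x z => psi x + z)).
    - now exists c, r, K.
    - apply analytic2_x.
    - apply analytic2_plus; [exact P1 | apply analytic2_y].
    - reflexivity.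
    - rewrite P2. ring. }
  destruct Ht as [c' [r' [K' Hc']]]. assert (Hr' := proj1 Hc'). assert (Hr1 := proj1 E1).
  exists psi, c', r', K'. split; auto. split; auto. split; auto. split.
  - destruct (analytic1_small psi (r1 / 2) P1 P2 ltac:(lra)) as [d2 [Hd2 P4]].
    set (s := Rmin (Rmin (r' / 2) r1) (Rmin d d2)).
    assert (Hs : 0 < s) by (repeat apply Rmin_glb_lt; lra).
    assert (S1 : s <= r' / 2) by (eapply Rle_trans; apply Rmin_l).
    assert (S2 : s <= r1) by (eapply Rle_trans; [apply Rmin_l | apply Rmin_r]).
    assert (S3 : s <= d) by (eapply Rle_trans; [apply Rmin_r | apply Rmin_l]).
    assert (S4 : s <= d2) by (eapply Rle_trans; [apply Rmin_r | apply Rmin_r]).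
    assert (Hv : forall x, Rabs x < s -> PSeries (c' m) x = 0).
    { intros x Hx.
      assert (Hsec := expansion_section c' r' K' _ x Hc' ltac:(lra)).
      assert (D1 : Derive_n (fun z => h x (psi x + z)) m 0 = PSeries (c' m) x * INR (fact m)).
      { rewrite (Derive_n_ext_loc _ (PSeries (fun j => PSeries (c' j) x))).
        - apply Derive_n_coef. apply (CV_radius_pos _ r' (2 * K')); auto. intros j. apply bound_mul; auto. apply Hsec.
        - exists (mkposreal r' Hr'). intros z Hz'. apply (proj2 (proj2 Hc')); [lra|].
          replace z with (z - 0) by ring. exact Hz'. }
      assert (D2 : Derive_n (fun z => h x (psi x + z)) m 0 = 0).
      { rewrite (Derive_n_ext _ (fun z => h x (z + psi x))) by (intros; f_equal; ring).
        rewrite (Derive_n_comp_trans (h x)), Rplus_0_l. rewrite E3.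
        - apply P3. lra.
        - lra.
        - specialize (P4 x ltac:(lra)). lra. }
      rewrite D1 in D2. apply Rmult_integral in D2. destruct D2 as [D2|D2]; auto.
      exfalso. now apply (INR_fact_neq_0 m). }
    apply (PSeries_coef_unique (c' m) (fun _ => 0) r' (K' / r' ^ m) 0 s Hr' Hs).
    + intros k. apply bound_mul; auto. apply (expansion_coef1 c' r' K' _ m Hc').
    + intros k. rewrite Rabs_R0. lra.
    + intros x Hx. rewrite PSeries_const_0. now apply Hv.
  - assert (E : forall j, c' j O = c j O).
    { apply (expansion_row0_unique c' r' K' _ (fun j => c j O) r K r Hc' Hr Hr).
      - intros j. rewrite <- (Nat.add_0_r j) at 2. apply Hc.
      - intros y Hy. rewrite P2, Rplus_0_l. rewrite (proj2 (proj2 Hc)); auto; [|now rewrite Rabs_R0].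
        apply PSeries_ext. intros j. now rewrite PSeries_0. }
    split.
    + intros j Hj. rewrite E. now apply Hz.
    + now rewrite E.
Qed.

(** [a / m] is the first slope of the Newton polygon, in lowest terms. *)
Lemma newton_slope (c : nat -> nat -> R) n :
  (forall j, (j < n)%nat -> c j O = 0) -> (exists j k, (j < n)%nat /\ c j k <> 0) ->
  exists a m, (1 <= a)%nat /\ (1 <= m)%nat /\
    (forall j k, (j < n)%nat -> c j k <> 0 -> (a * (n - j) <= m * k)%nat) /\
    (exists j k, (j < n)%nat /\ c j k <> 0 /\ (a * (n - j) = m * k)%nat) /\
    (forall j k, (j < n)%nat -> (a * (n - j) = m * k)%nat -> Nat.divide m (n - j)).
Proof.
  intros H0 [j1 [k1 [Hj1 Hc1]]].
  assert (Hdv : forall j, (j < n)%nat -> exists b, fact n = (b * (n - j))%nat).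
  { intros j Hj. destruct (fact_divide (n - j) n ltac:(lia)) as [b Hb].
    destruct (n - j)%nat as [|i] eqn:Ei; [lia|]. exists (b * fact i)%nat.
    rewrite Hb. change (fact (S i)) with (S i * fact i)%nat. lia. }
  (* [v] is the slope [k / (n - j)] multiplied by [n!]. The scaling makes all slopes natural
     numbers, so a least one exists. *)
  destruct (least_nat (fun v => exists j k, (j < n)%nat /\ c j k <> 0 /\ (v * (n - j) = k * fact n)%nat))
    as [v [[j0 [k0 [Hj0 [Hc0 Hv]]]] Hmin]].
  { destruct (Hdv j1 Hj1) as [b Hb]. exists (k1 * b)%nat, j1, k1. repeat split; auto. rewrite Hb. lia. }
  assert (Hk0 : (k0 <> 0)%nat) by (intros ->; apply Hc0; auto).
  assert (Hf := lt_O_fact n).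
  assert (Hslope : forall j k, (j < n)%nat -> c j k <> 0 -> (k0 * (n - j) <= k * (n - j0))%nat).
  { intros j k Hj Hc. destruct (Hdv j Hj) as [b Hb].
    assert (Hvb : (v <= k * b)%nat).
    { apply Nat.nlt_ge. intros Hlt. apply (Hmin _ Hlt). exists j, k. repeat split; auto. rewrite Hb. lia. }
    apply (Nat.mul_le_mono_pos_r _ _ (fact n)); auto.
    replace (k0 * (n - j) * fact n)%nat with (v * (n - j0) * (n - j))%nat by (rewrite Hv; lia).
    replace (k * (n - j0) * fact n)%nat with (k * b * (n - j0) * (n - j))%nat by (rewrite Hb; lia).
    apply Nat.mul_le_mono_r, Nat.mul_le_mono_r. exact Hvb. }
  set (g := Nat.gcd k0 (n - j0)).
  assert (Hg : (g <> 0)%nat) by (unfold g; intros E; apply Nat.gcd_eq_0 in E; lia).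
  destruct (Nat.gcd_divide_l k0 (n - j0)) as [a Ha]. destruct (Nat.gcd_divide_r k0 (n - j0)) as [m Hm].
  fold g in Ha, Hm.
  assert (Hcop : Nat.gcd a m = 1%nat).
  { assert (E : (Nat.gcd a m * g = g)%nat) by (rewrite <- Nat.gcd_mul_mono_r, <- Ha, <- Hm; reflexivity).
    apply (Nat.mul_cancel_r _ _ g Hg). lia. }
  exists a, m. split; [|split; [|split; [|split]]].
  - destruct a; lia.
  - destruct m; lia.
  - intros j k Hj Hc. specialize (Hslope j k Hj Hc). rewrite Ha, Hm in Hslope.
    apply (Nat.mul_le_mono_pos_r _ _ g); lia.
  - exists j0, k0. repeat split; auto. rewrite Hm, Ha. clearbody g. lia.
  - intros j k Hj E. apply (Nat.gauss m a); [exists k; lia|]. now rewrite Nat.gcd_comm.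
Qed.

Lemma analytic1_small_lt f eta : analytic1 f -> f 0 = 0 -> 0 < eta ->
  exists d, 0 < d /\ forall x, Rabs x < d -> Rabs (f x) < eta.
Proof.
  intros Hf H0 Heta. destruct (analytic1_small f (eta / 2) Hf H0 ltac:(lra)) as [d [Hd H]].
  exists d. split; auto. intros x Hx. specialize (H x ltac:(lra)). lra.
Qed.

(** The substitution [x = xi ^ m], [z = xi ^ a * w] along the first slope divides
    [h] by [xi ^ (a n)] and leaves a polynomial in [w] at [xi = 0]. *)
Lemma newton_transform c r K h n a m : expansion c r K h -> (1 <= n)%nat -> (1 <= a)%nat -> (1 <= m)%nat ->
  (forall j k, (j < n)%nat -> c j k <> 0 -> (a * (n - j) <= m * k)%nat) ->
  exists (p : nat -> R) (H : R -> R -> R),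
    p n = c n O /\
    (forall j, (j < n)%nat -> p j <> 0 -> exists k, p j = c j k /\ (a * (n - j) = m * k)%nat) /\
    (forall j k, (j < n)%nat -> (a * (n - j) = m * k)%nat -> p j = c j k) /\
    (forall w0, analytic2 (fun xi w => H xi (w0 + w))) /\
    (forall w, H 0 w = pol p n w) /\
    (forall w0, exists d, 0 < d /\ forall xi w, Rabs xi < d -> Rabs w < d ->
       h (xi ^ m) (xi ^ a * (w0 + w)) = xi ^ (a * n) * H xi (w0 + w)).
Proof.
  intros Hc Hn Ha Hm Hslope. assert (Hr := proj1 Hc).
  destruct n as [|n]; [lia|]. clear Hn.
  (* [o j] is [a * (S n - j) / m] rounded up. No coefficient of row [j] lies below the edge, so the
     row is divisible by [x ^ o j]. *)
  set (o := fun j => ((a * (S n - j) + (m - 1)) / m)%nat).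
  assert (Ho : forall j, (a * (S n - j) <= m * o j)%nat /\ (m * o j < a * (S n - j) + m)%nat).
  { intros j. unfold o. set (X := (a * (S n - j) + (m - 1))%nat).
    assert (D1 := Nat.div_mod_eq X m). assert (D2 := Nat.mod_upper_bound X m ltac:(lia)). lia. }
  assert (Hoz : forall j k, (j <= n)%nat -> (k < o j)%nat -> c j k = 0).
  { intros j k Hj Hk. apply NNPP. intros Hne. specialize (Hslope j k ltac:(lia) Hne).
    destruct (Ho j) as [_ H2]. nia. }
  (* The power of [xi] left in row [j] after the substitution and the division by [xi ^ (a * S n)].
     It is 0 exactly when the edge meets the row at an integer point, and only such rows contribute
     to [p] below degree [S n]. *)
  set (ex := fun j => (m * o j - a * (S n - j))%nat).
  set (at_ := fun j => PSeries (fun k => c j (o j + k)%nat)).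
  destruct (expansion_decomp c r K h n Hc) as [He [He0 Hdec]].
  set (e := fun x y => PSeries (fun j => PSeries (c (S n + j)%nat) x) y) in *.
  change (e 0 0 = c (S n) O) in He0.
  assert (Hat : forall j, analytic1 (at_ j)).
  { intros j. apply (expansion1_analytic _ _ _ _ (expansion1_shift (c j) r (K / r ^ j) (o j) Hr (proj1 (proj2 (expansion_coef1 c r K h j Hc))))). }
  set (p := fun j => if Nat.eq_dec j (S n) then c (S n) O else if Nat.eq_dec (ex j) 0 then c j (o j) else 0).
  set (H := fun xi w => sum_f_R0 (fun j => xi ^ ex j * at_ j (xi ^ m) * w ^ j) n + w ^ S n * e (xi ^ m) (xi ^ a * w)).
  assert (Hpow0 : forall k, (1 <= k)%nat -> 0 ^ k = 0) by (intros k Hk; apply pow_ne_zero; lia).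
  exists p, H. split; [|split; [|split; [|split; [|split]]]].
  - unfold p. destruct (Nat.eq_dec (S n) (S n)); [reflexivity|lia].
  - intros j Hj Hp. unfold p in *. destruct (Nat.eq_dec j (S n)); [lia|].
    destruct (Nat.eq_dec (ex j) 0) as [E|E]; [|lra].
    exists (o j). split; auto. unfold ex in E. destruct (Ho j). lia.
  - intros j k Hj E. unfold p. destruct (Nat.eq_dec j (S n)); [lia|].
    destruct (Ho j) as [O1 O2].
    assert (Hk : o j = k) by nia.
    destruct (Nat.eq_dec (ex j) 0) as [Ex|Ex]; [now rewrite Hk|]. exfalso. apply Ex. unfold ex. rewrite Hk. lia.
  - intros w0.
    assert (Aw : analytic2 (fun _ w => w0 + w)) by (apply analytic2_plus; [apply analytic2_const | apply analytic2_y]).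
    assert (Ax : forall k, analytic2 (fun xi _ => xi ^ k)) by (intros k; apply (analytic2_pow (fun x _ => x)), analytic2_x).
    apply analytic2_plus.
    + apply (analytic2_sum (fun j xi w => xi ^ ex j * at_ j (xi ^ m) * (w0 + w) ^ j)). intros j Hj.
      apply analytic2_mult; [apply analytic2_mult; [apply Ax|]|].
      * apply (analytic1_comp (at_ j) (fun xi _ => xi ^ m)); auto.
      * apply (analytic2_pow (fun _ w => w0 + w)), Aw.
    + apply analytic2_mult; [apply (analytic2_pow (fun _ w => w0 + w)), Aw|].
      apply (analytic2_comp e (fun xi _ => xi ^ m) (fun xi w => xi ^ a * (w0 + w))); auto.
      * apply analytic2_mult; auto.
      * rewrite Hpow0 by lia. ring.
  - intros w. unfold H, pol. rewrite tech5. f_equal.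
    + apply sum_eq. intros j Hj. unfold p. destruct (Nat.eq_dec j (S n)); [lia|].
      rewrite (Hpow0 m) by lia. unfold at_. rewrite PSeries_0, Nat.add_0_r.
      destruct (Nat.eq_dec (ex j) 0) as [E|E]; [rewrite E; simpl; ring|].
      rewrite Hpow0 by lia. ring.
    + rewrite !Hpow0, Rmult_0_l, He0 by lia. unfold p.
      destruct (Nat.eq_dec (S n) (S n)); [ring|lia].
  - intros w0.
    destruct (analytic1_small_lt (fun xi => xi ^ m) (r / 2)) as [d1 [Hd1 D1]];
      [apply analytic1_pow, analytic1_id | now apply Hpow0 | lra |].
    assert (Hw0 : 0 <= Rabs w0) by apply Rabs_pos.
    destruct (analytic1_small_lt (fun xi => xi ^ a * (Rabs w0 + 1)) (r / 2)) as [d2 [Hd2 D2]].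
    { apply analytic1_mult; [apply analytic1_pow, analytic1_id | apply analytic1_const]. }
    { rewrite Hpow0 by lia. ring. }
    { lra. }
    exists (Rmin 1 (Rmin d1 d2)). split; [repeat apply Rmin_glb_lt; lra|].
    intros xi w Hxi Hw.
    assert (X0 := Rlt_le_trans _ _ _ Hw (Rmin_l _ _)).
    assert (X1 := Rlt_le_trans _ _ _ Hxi (Rle_trans _ _ _ (Rmin_r _ _) (Rmin_l _ _))).
    assert (X2 := Rlt_le_trans _ _ _ Hxi (Rle_trans _ _ _ (Rmin_r _ _) (Rmin_r _ _))).
    specialize (D1 xi X1). specialize (D2 xi X2).
    rewrite Hdec.
    + unfold H. rewrite (Rmult_plus_distr_l (xi ^ (a * S n))), scal_sum. f_equal.
      * apply sum_eq. intros j Hj.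
        rewrite (pseries_factor (c j) r (K / r ^ j) (o j) _ Hr (proj1 (proj2 (expansion_coef1 c r K h j Hc)))
          (fun k Hk => Hoz j k Hj Hk)) by lra.
        unfold at_. rewrite Rpow_mult_distr, <- !pow_mult.
        destruct (Ho j) as [O1 O2].
        assert (Ep : xi ^ (m * o j) * xi ^ (a * j) = xi ^ ex j * xi ^ (a * S n)).
        { rewrite <- !pow_add. f_equal. unfold ex. nia. }
        transitivity (xi ^ (m * o j) * xi ^ (a * j) * (PSeries (fun k => c j (o j + k)%nat) (xi ^ m) * (w0 + w) ^ j)); [ring|].
        rewrite Ep. ring.
      * rewrite Rpow_mult_distr, <- pow_mult. transitivity (xi ^ (a * S n) * (w0 + w) ^ S n * e (xi ^ m) (xi ^ a * (w0 + w))); [reflexivity | ring].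
    + lra.
    + left. eapply Rle_lt_trans; [|exact D2]. rewrite !Rabs_mult. apply Rmult_le_compat_l; [apply Rabs_pos|].
      rewrite (Rabs_pos_eq (Rabs w0 + 1)) by lra. eapply Rle_trans; [apply Rabs_triang|]. lra.
Qed.

Lemma puiseux_odd n : forall c r K h, expansion c r K h -> Nat.Odd n ->
  (forall j, (j < n)%nat -> c j O = 0) -> c n O <> 0 ->
  exists phi d, analytic1 phi /\ phi 0 = 0 /\ 0 < d /\ forall s, Rabs s < d -> h (s ^ fact n) (phi s) = 0.
Proof.
  induction n as [n IH] using lt_wf_ind. intros c r K h Hc Hodd Hz Hnz.
  assert (Hn : (1 <= n)%nat) by (destruct Hodd; lia).
  destruct n as [|n']; [lia|]. set (n := S n') in *.
  destruct (tschirnhaus c r K h n' Hc) as (psi & c1 & r1 & K1 & P1 & P2 & Hc1 & T1 & T2 & T3).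
  { intros j Hj. apply Hz. unfold n; lia. }
  { exact Hnz. }
  assert (Hr1 := proj1 Hc1).
  assert (Hfn := lt_O_fact n).
  assert (Hpow0 : forall k, (1 <= k)%nat -> 0 ^ k = 0) by (intros k Hk; apply pow_ne_zero; lia).
  assert (Apow : forall k, analytic1 (fun s => s ^ k)) by (intros k; apply analytic1_pow, analytic1_id).
  assert (Apsi : analytic1 (fun s => psi (s ^ fact n))).
  { apply (analytic1_comp psi (fun s _ => s ^ fact n)); auto. apply Apow. }
  destruct (classic (exists j k, (j < n)%nat /\ c1 j k <> 0)) as [Hex|Hnex].
  (* Without nonzero coefficients below degree [n] the translated function vanishes on [z = 0], so
     [psi] itself is the branch. *)
  2:{ exists (fun s => psi (s ^ fact n)).
      destruct (analytic1_small_lt (fun s => s ^ fact n) (r1 / 2) (Apow _) (Hpow0 _ Hfn) ltac:(lra)) as [d [Hd D]].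
      exists d. split; auto. split; [rewrite Hpow0; auto|]. split; auto.
      intros s Hs. specialize (D s Hs).
      destruct (expansion_decomp c1 r1 K1 _ n' Hc1) as [_ [_ Hdec]].
      assert (B : Rabs 0 <= r1 / 2) by (rewrite Rabs_R0; lra).
      specialize (Hdec (s ^ fact n) 0 (Rlt_le _ _ D) B). cbv beta in Hdec. rewrite Rplus_0_r in Hdec.
      rewrite Hdec. rewrite (Hpow0 (S n')), Rmult_0_l, Rplus_0_r by lia.
      apply sum_eq_R0. intros j Hj.
      rewrite (PSeries_ext _ (fun _ => 0)), PSeries_const_0; [ring|].
      intros k. apply NNPP. intros Hne. apply Hnex. exists j, k. split; auto. unfold n; lia. }
  destruct (newton_slope c1 n) as (a & m & Ha & Hm & N1 & (j0 & k0 & Hj0 & Hc0 & E0) & N3); auto.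
  { intros j Hj. apply T2. unfold n in Hj; lia. }
  destruct (newton_transform c1 r1 K1 _ n a m Hc1 Hn Ha Hm N1) as (p & H & Q1 & Q2 & Q3 & Q4 & Q5 & Q6).
  destruct (odd_factor p n m Hodd Hm) as (w0 & n1 & S1 & O1 & O2 & O3 & O4 & O5 & O6).
  { rewrite Q1. exact T3. }
  { destruct (Req_dec (p (n - 1)%nat) 0) as [|Hne]; auto.
    destruct (Q2 (n - 1)%nat ltac:(lia) Hne) as [k [Ek _]]. rewrite Ek.
    replace (n - 1)%nat with n' by (unfold n; lia). apply T1. }
  { exists j0. split; auto. rewrite (Q3 j0 k0); auto. }
  { intros j Hj Hp. destruct (Q2 j Hj Hp) as [k [_ Ek]]. now apply (N3 j k). }
  destruct (Q4 w0) as (c2 & r2 & K2 & Hc2).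
  destruct (expansion_order c2 r2 K2 _ S1 n1 1 Hc2 O4 Rlt_0_1) as [R1 R2].
  { intros y _. rewrite Q5. apply O6. }
  destruct (IH n1 O2 c2 r2 K2 _ Hc2 O1 R1) as (phi1 & d1 & F1 & F2 & Hd1 & F3).
  { rewrite R2. exact O5. }
  destruct O3 as [L HL].
  assert (HL0 : (1 <= L)%nat) by (destruct L; [rewrite Nat.mul_0_l in HL|]; lia).
  assert (Hfn1 := lt_O_fact n1).
  (* [s ^ xe] plays the part of [xi]. As [fact n = L * (m * fact n1)], its [m]-th power is
     [s ^ fact n], while [s ^ xe = (s ^ L) ^ fact n1] is the form demanded by the induction
     hypothesis at [s ^ L]. *)
  set (xe := (L * fact n1)%nat). assert (Hxe : (1 <= xe)%nat) by (unfold xe; nia).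
  assert (Aphi : analytic1 (fun s => phi1 (s ^ L))).
  { apply (analytic1_comp phi1 (fun s _ => s ^ L)); auto. apply Apow. }
  set (phi := fun s => psi (s ^ fact n) + (s ^ xe) ^ a * (w0 + phi1 (s ^ L))).
  assert (A2 : analytic1 (fun s => (s ^ xe) ^ a * (w0 + phi1 (s ^ L)))).
  { apply analytic1_mult; [apply (analytic1_pow (fun s => s ^ xe)), Apow|].
    apply analytic1_plus; [apply analytic1_const | exact Aphi]. }
  destruct (Q6 w0) as [d2 [Hd2 G]].
  destruct (analytic1_small_lt (fun s => s ^ L) d1 (Apow _) (Hpow0 _ HL0) Hd1) as [d3 [Hd3 D3]].
  destruct (analytic1_small_lt (fun s => s ^ xe) d2 (Apow _) (Hpow0 _ Hxe) Hd2) as [d4 [Hd4 D4]].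
  destruct (analytic1_small_lt (fun s => phi1 (s ^ L)) d2) as [d5 [Hd5 D5]]; auto.
  { now rewrite Hpow0. }
  exists phi, (Rmin d3 (Rmin d4 d5)). split; [|split; [|split]].
  - now apply analytic1_plus.
  - unfold phi. rewrite !Hpow0, P2 by lia. ring.
  - repeat apply Rmin_glb_lt; auto.
  - intros s Hs.
    assert (X3 := Rlt_le_trans _ _ _ Hs (Rmin_l _ _)).
    assert (X4 := Rlt_le_trans _ _ _ Hs (Rle_trans _ _ _ (Rmin_r _ _) (Rmin_l _ _))).
    assert (X5 := Rlt_le_trans _ _ _ Hs (Rle_trans _ _ _ (Rmin_r _ _) (Rmin_r _ _))).
    specialize (G (s ^ xe) (phi1 (s ^ L)) (D4 s X4) (D5 s X5)). cbv beta in G.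
    assert (Ef : (s ^ xe) ^ m = s ^ fact n).
    { rewrite <- pow_mult. f_equal. unfold xe. rewrite HL. lia. }
    rewrite Ef in G. unfold phi. rewrite G.
    assert (Ex : s ^ xe = (s ^ L) ^ fact n1) by (rewrite <- pow_mult; reflexivity).
    rewrite Ex at 2. rewrite (F3 (s ^ L) (D3 s X3)). ring.
Qed.

(** * Periodic antiderivatives *)

(** Coquelicot leaves equations typed in the carrier of a structure, where [ring] and [field] fail. *)
Ltac Req := match goal with |- @eq _ ?a ?b => change (@eq R a b) end.

Lemma is_derive_val (f : R -> R) (x l l' : R) : is_derive f x l -> l = l' -> is_derive f x l'.
Proof. now intros H <-. Qed.

Lemma ex_RInt_cont (f : R -> R) a b : (forall t, continuous f t) -> ex_RInt f a b.
Proof. intros H. apply (ex_RInt_continuous (V := R_CompleteNormedModule)). intros; apply H. Qed.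

Lemma RInt_plus_cont (f g : R -> R) a b :
  (forall t, continuous f t) -> (forall t, continuous g t) ->
  RInt (fun t => f t + g t) a b = RInt f a b + RInt g a b.
Proof. intros Hf Hg. apply (RInt_plus (V := R_CompleteNormedModule) f g); now apply ex_RInt_cont. Qed.

Lemma RInt_scal_cont (f : R -> R) a b c :
  (forall t, continuous f t) -> RInt (fun t => c * f t) a b = c * RInt f a b.
Proof. intros Hf. apply (RInt_scal (V := R_CompleteNormedModule) f a b c); now apply ex_RInt_cont. Qed.

Lemma RInt_Chasles_cont (f : R -> R) a b c :
  (forall t, continuous f t) -> RInt f a b + RInt f b c = RInt f a c.
Proof. intros Hf. apply (RInt_Chasles (V := R_CompleteNormedModule) f a b c); now apply ex_RInt_cont. Qed.

Lemma RInt_abs_le (f : R -> R) a b M :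
  (forall t, continuous f t) -> (forall t, Rabs (f t) <= M) -> Rabs (RInt f a b) <= Rabs (b - a) * M.
Proof.
  intros Hc HM.
  assert (aux : forall x y, x <= y -> Rabs (RInt f x y) <= (y - x) * M).
  { intros x y Hxy. rewrite Rmult_comm.
    apply (abs_RInt_le_const f x y M) in Hxy as H; auto.
    - lra.
    - now apply ex_RInt_cont. }
  destruct (Rle_dec a b) as [H|H].
  - rewrite (Rabs_pos_eq (b - a)) by lra. now apply aux.
  - rewrite <- (opp_RInt_swap f b a) by now apply ex_RInt_cont.
    unfold opp; simpl. rewrite Rabs_Ropp, (Rabs_left1 (b - a)) by lra.
    replace (- (b - a)) with (a - b) by ring. apply aux; lra.
Qed.

Lemma is_series_RInt (a : nat -> R -> R) (M : nat -> R) (S x y : R) :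
  (forall p t, continuous (a p) t) -> (forall p t, Rabs (a p t) <= M p) -> is_series M S ->
  is_series (fun p => RInt (a p) x y) (RInt (fun t => Series (fun p => a p t)) x y).
Proof.
  intros Hc HM HS.
  assert (HM0 : forall i, 0 <= M i).
  { intros i. eapply Rle_trans; [apply Rabs_pos | apply (HM i 0)]. }
  assert (Hcs : forall t, continuous (fun t => Series (fun p => a p t)) t).
  { intros t. apply (continuous_normal_series (fun _ => True) a M S); auto. apply open_true. }
  assert (Hcn : forall n t, continuous (fun t => sum_n (fun p => a p t) n) t).
  { intros n t; induction n as [|n IH].
    - apply (continuous_ext (a O)); auto. intros s; now rewrite sum_O.
    - apply (continuous_ext (fun s => plus (sum_n (fun p => a p s) n) (a (Datatypes.S n) s))).
      intros s; now rewrite sum_Sn.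
      now apply (continuous_plus (V := R_NormedModule)). }
  assert (Hsum : forall n, sum_n (fun p => RInt (a p) x y) n = RInt (fun t => sum_n (fun p => a p t) n) x y).
  { induction n as [|n IH].
    - rewrite sum_O. apply RInt_ext. intros t _; now rewrite sum_O.
    - rewrite sum_Sn, IH. rewrite <- (RInt_plus (V := R_CompleteNormedModule)); try (apply ex_RInt_cont; auto).
      apply RInt_ext. intros t _; now rewrite sum_Sn. }
  assert (Hex : forall t, ex_series (fun i => a i t)) by (intros t; apply (ex_series_dom _ M S); auto).
  change (is_lim_seq (sum_n (fun p => RInt (a p) x y)) (RInt (fun t => Series (fun p => a p t)) x y)).
  assert (Hl : is_lim_seq (fun n => Rabs (y - x) * (S - sum_n M n)) 0).
  { replace (Finite 0) with (Finite (Rabs (y - x) * (S - S))) by (f_equal; ring).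
    apply is_lim_seq_mult'; [apply is_lim_seq_const|].
    apply is_lim_seq_minus'; [apply is_lim_seq_const | exact HS]. }
  apply is_lim_seq_spec. intros eps.
  destruct (proj2 (is_lim_seq_spec _ _) Hl eps) as [N HN].
  exists N. intros n Hn. specialize (HN n Hn).
  eapply Rle_lt_trans; [|apply HN]. rewrite Rminus_0_r.
  rewrite Hsum.
  assert (E : RInt (fun t => sum_n (fun p => a p t) n) x y - RInt (fun t => Series (fun p => a p t)) x y
    = RInt (fun t => sum_n (fun p => a p t) n - Series (fun p => a p t)) x y).
  { symmetry. apply (RInt_minus (V := R_CompleteNormedModule)); apply ex_RInt_cont; auto. }
  rewrite E.
  eapply Rle_trans; [apply RInt_abs_le with (M := S - sum_n M n)|].
  - intros t. apply (continuous_minus (V := R_NormedModule)); auto.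
  - intros t. rewrite (Series_incr_n _ (Datatypes.S n)); [|lia|auto].
    simpl pred. rewrite <- sum_n_Reals.
    replace (_ - (_ + _)) with (- (Series (fun k => a (Datatypes.S n + k)%nat t))) by ring.
    rewrite Rabs_Ropp.
    apply (series_abs_le _ (fun k => M (Datatypes.S n + k)%nat)); auto.
    now apply is_series_tail.
  - apply Rle_abs.
Qed.

Definition cper (T : R) (f : R -> R) : Prop := (forall t, continuous f t) /\ periodic T f.

Definition mean (T : R) (f : R -> R) : R := RInt f 0 T / T.

Definition primJ (T : R) (f : R -> R) (t : R) : R := RInt f 0 t - t * mean T f.

(** The zero-mean periodic antiderivative of [f - mean f]. *)
Definition opJ (T : R) (f : R -> R) (t : R) : R := primJ T f t - mean T (primJ T f).

Section Periodic.
Variable T : R.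
Hypothesis HT : 0 < T.

Lemma cper_ext f g : (forall t, f t = g t) -> cper T f -> cper T g.
Proof. intros H. now replace g with f by now apply functional_extensionality. Qed.

Lemma cper_const c : cper T (fun _ => c).
Proof. split; [intros; apply continuous_const | now intros t]. Qed.

Lemma cper_plus f g : cper T f -> cper T g -> cper T (fun t => f t + g t).
Proof.
  intros [H1 H2] [H3 H4]. split.
  - intros t; now apply (continuous_plus (V := R_NormedModule)).
  - intros t. now rewrite H2, H4.
Qed.

Lemma cper_mult f g : cper T f -> cper T g -> cper T (fun t => f t * g t).
Proof.
  intros [H1 H2] [H3 H4]. split.
  - intros t; now apply (continuous_mult (K := R_AbsRing)).
  - intros t. now rewrite H2, H4.
Qed.

Lemma cper_scal c f : cper T f -> cper T (fun t => c * f t).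
Proof. intros H. apply (cper_mult (fun _ => c)); auto using cper_const. Qed.

Lemma periodic_Z (f : R -> R) (k : Z) t : periodic T f -> f (t + IZR k * T) = f t.
Proof.
  intros H.
  assert (Hn : forall n s, f (s + INR n * T) = f s).
  { induction n as [|n IH]; intros s.
    - simpl. f_equal; ring.
    - rewrite S_INR. replace (s + (INR n + 1) * T) with ((s + INR n * T) + T) by ring. now rewrite H. }
  destruct (Z_le_dec 0 k) as [Hk|Hk].
  - rewrite <- (Z2Nat.id k) by auto. now rewrite <- INR_IZR_INZ.
  - rewrite <- (Hn (Z.to_nat (- k)) (t + IZR k * T)). f_equal.
    rewrite INR_IZR_INZ, Z2Nat.id, opp_IZR by lia. ring.
Qed.

Lemma periodic_reduce t : exists k : Z, 0 <= t + IZR k * T <= T.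
Proof.
  exists (- (up (t / T) - 1))%Z. destruct (archimed (t / T)) as [H1 H2].
  rewrite opp_IZR, minus_IZR. set (u := IZR (up (t / T))) in *.
  assert (E : t = t / T * T) by (field; lra).
  rewrite E at 1 2. split; nra.
Qed.

Lemma periodic_bound (f : R -> R) M :
  periodic T f -> (forall t, 0 <= t <= T -> Rabs (f t) <= M) -> forall t, Rabs (f t) <= M.
Proof.
  intros Hp H t. destruct (periodic_reduce t) as [k Hk].
  rewrite <- (periodic_Z f k t Hp). auto.
Qed.

Lemma is_derive_RInt_cont (f : R -> R) a t :
  (forall t, continuous f t) -> is_derive (RInt f a) t (f t).
Proof.
  intros H. apply (is_derive_RInt f (RInt f a) a); auto.
  apply filter_forall. intros x. apply (RInt_correct (V := R_CompleteNormedModule)). now apply ex_RInt_cont.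
Qed.

Lemma constant_of_derive_0 (f : R -> R) x y : (forall t, is_derive f t 0) -> f x = f y.
Proof.
  intros H.
  destruct (MVT_gen f x y (fun _ => 0)) as [c [_ Hc]].
  - intros; apply H.
  - intros z _. apply (continuity_pt_filterlim f z). apply (ex_derive_continuous f z). eexists; apply H.
  - lra.
Qed.

Lemma RInt_period_shift f s : cper T f -> RInt f s (s + T) = RInt f 0 T.
Proof.
  intros [Hc Hp].
  assert (E : RInt f 0 (s + T) - RInt f 0 s = RInt f 0 (0 + T) - RInt f 0 0).
  2:{ rewrite RInt_point, Rplus_0_l in E. unfold zero in E; simpl in E.
      rewrite <- (RInt_Chasles_cont f 0 s (s + T)) in E by auto. Req. lra. }
  apply (constant_of_derive_0 (fun s => RInt f 0 (s + T) - RInt f 0 s)). intros t.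
  apply (is_derive_val _ _ (f (t + T) * 1 - f t)); [|rewrite Hp; ring].
  apply (is_derive_minus (V := R_NormedModule)).
  - evar_last. apply (is_derive_comp (fun x => RInt f 0 x) (fun s => s + T)).
    + now apply is_derive_RInt_cont.
    + instantiate (1 := 1). auto_derive; auto.
    + unfold scal; simpl; unfold mult; simpl. Req. ring.
  - now apply is_derive_RInt_cont.
Qed.

Lemma mean_shift f s : cper T f -> mean T (fun t => f (t + s)) = mean T f.
Proof.
  intros H. unfold mean. f_equal.
  rewrite <- (RInt_period_shift f s H).
  assert (E := RInt_comp_lin (V := R_CompleteNormedModule) f 1 s 0 T
    (ex_RInt_cont f _ _ (proj1 H))).
  replace (1 * 0 + s) with s in E by ring. replace (1 * T + s) with (s + T) in E by ring.
  rewrite <- E. apply RInt_ext. intros t _. unfold scal; simpl; unfold mult; simpl.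
  now rewrite !Rmult_1_l.
Qed.

Lemma mean_bound f M : cper T f -> (forall t, Rabs (f t) <= M) -> Rabs (mean T f) <= M.
Proof.
  intros [Hc _] HM. unfold mean, Rdiv. rewrite Rabs_mult, (Rabs_pos_eq (/ T)); [|left; now apply Rinv_0_lt_compat].
  apply Rmult_le_reg_r with T; auto. rewrite Rmult_assoc, Rinv_l, Rmult_1_r by lra.
  eapply Rle_trans; [now apply RInt_abs_le|]. rewrite Rabs_pos_eq by lra. lra.
Qed.

Lemma mean_const c : mean T (fun _ => c) = c.
Proof.
  unfold mean. rewrite RInt_const. unfold scal; simpl; unfold mult; simpl. field. lra.
Qed.

Lemma mean_plus f g : cper T f -> cper T g -> mean T (fun t => f t + g t) = mean T f + mean T g.
Proof.
  intros [H _] [H' _]. unfold mean.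
  rewrite RInt_plus_cont by auto. field. lra.
Qed.

Lemma mean_scal c f : cper T f -> mean T (fun t => c * f t) = c * mean T f.
Proof.
  intros [H _]. unfold mean.
  rewrite RInt_scal_cont by auto. field. lra.
Qed.

Lemma is_derive_primJ f t : cper T f -> is_derive (primJ T f) t (f t - mean T f).
Proof.
  intros [H _]. apply (is_derive_minus (V := R_NormedModule)).
  - now apply is_derive_RInt_cont.
  - auto_derive; auto. ring.
Qed.

Lemma is_derive_opJ f t : cper T f -> is_derive (opJ T f) t (f t - mean T f).
Proof.
  intros H. apply (is_derive_val _ _ (f t - mean T f - 0)); [|ring].
  apply (is_derive_minus (V := R_NormedModule)).
  - now apply is_derive_primJ.
  - apply (is_derive_const (V := R_NormedModule)).
Qed.

Lemma cper_primJ f : cper T f -> cper T (primJ T f).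
Proof.
  intros H. split.
  - intros t. apply (ex_derive_continuous (primJ T f)). eexists; now apply is_derive_primJ.
  - intros t. unfold primJ.
    rewrite <- (RInt_Chasles_cont f 0 t (t + T)) by apply H.
    rewrite RInt_period_shift; auto. unfold mean. field. lra.
Qed.

Lemma cper_opJ f : cper T f -> cper T (opJ T f).
Proof.
  intros H. apply (cper_ext (fun t => primJ T f t + - mean T (primJ T f))); [intros; unfold opJ; ring|].
  apply cper_plus; [now apply cper_primJ | apply cper_const].
Qed.

Lemma mean_opJ f : cper T f -> mean T (opJ T f) = 0.
Proof.
  intros H. transitivity (mean T (fun t => primJ T f t + - mean T (primJ T f))).
  - f_equal.
  - rewrite mean_plus; auto using cper_primJ, cper_const. rewrite mean_const. ring.
Qed.

Lemma primJ_bound f M : cper T f -> (forall t, Rabs (f t) <= M) -> forall t, Rabs (primJ T f t) <= 2 * T * M.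
Proof.
  intros H HM. apply periodic_bound; [now apply cper_primJ|].
  intros t Ht. unfold primJ, Rminus. eapply Rle_trans; [apply Rabs_triang|].
  rewrite Rabs_Ropp, Rabs_mult.
  assert (B1 := RInt_abs_le f 0 t M (proj1 H) HM). rewrite (Rabs_pos_eq (t - 0)) in B1 by lra.
  assert (B2 := mean_bound f M H HM). rewrite (Rabs_pos_eq t) by lra.
  assert (0 <= M) by (eapply Rle_trans; [apply Rabs_pos | apply (HM 0)]).
  assert (0 <= Rabs (mean T f)) by apply Rabs_pos. nra.
Qed.

Lemma opJ_bound f M : cper T f -> (forall t, Rabs (f t) <= M) -> forall t, Rabs (opJ T f t) <= 4 * T * M.
Proof.
  intros H HM t. unfold opJ, Rminus. eapply Rle_trans; [apply Rabs_triang|]. rewrite Rabs_Ropp.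
  assert (B1 := primJ_bound f M H HM t).
  assert (B2 := mean_bound (primJ T f) _ (cper_primJ f H) (primJ_bound f M H HM)). lra.
Qed.

Lemma mean_of_derive f g : cper T f -> cper T g -> (forall t, is_derive f t (g t)) -> mean T g = 0.
Proof.
  intros [Hf Hp] [Hg _] H. unfold mean.
  assert (E : is_RInt g 0 T (minus (f T) (f 0))).
  { apply (is_RInt_derive f g); auto. }
  rewrite (is_RInt_unique _ _ _ _ E).
  replace (f T) with (f 0). { rewrite minus_eq_zero. unfold zero; simpl. field. lra. }
  rewrite <- (Rplus_0_l T) at 1. now rewrite Hp.
Qed.

(** The derivative of a periodic function has mean 0, so both sides have the same derivative; their
    means agree as well. *)
Lemma opJ_of_derive f g : cper T f -> cper T g -> (forall t, is_derive f t (g t)) ->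
  forall t, f t = opJ T g t + mean T f.
Proof.
  intros Hf Hg H t.
  assert (Hm := mean_of_derive f g Hf Hg H).
  assert (E : forall s, f s = opJ T g s + (f 0 - opJ T g 0)).
  { intros s. enough (f s - opJ T g s = f 0 - opJ T g 0) by lra.
    apply (constant_of_derive_0 (fun s => f s - opJ T g s)). intros u.
    apply (is_derive_val _ _ (g u - (g u - mean T g))); [|lra].
    apply (is_derive_minus (V := R_NormedModule)); auto. now apply is_derive_opJ. }
  rewrite E. f_equal.
  replace (mean T f) with (mean T (fun s => opJ T g s + (f 0 - opJ T g 0))).
  - rewrite (mean_plus (opJ T g) (fun _ => f 0 - opJ T g 0)); [|now apply cper_opJ|apply cper_const].
    rewrite mean_opJ, mean_const; auto. ring.
  - f_equal. apply functional_extensionality. intros s. symmetry. apply E.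
Qed.

Lemma opJ_plus f g t : cper T f -> cper T g -> opJ T (fun s => f s + g s) t = opJ T f t + opJ T g t.
Proof.
  intros Hf Hg.
  assert (C1 := cper_opJ f Hf). assert (C2 := cper_opJ g Hg).
  assert (C3 : cper T (fun s => f s + g s)) by now apply cper_plus.
  assert (CG : cper T (fun s => (f s - mean T f) + (g s - mean T g))).
  { repeat apply cper_plus; auto; apply cper_const. }
  assert (E1 := opJ_of_derive (fun s => opJ T f s + opJ T g s) _ (cper_plus _ _ C1 C2) CG).
  assert (E2 := opJ_of_derive (opJ T (fun s => f s + g s)) _ (cper_opJ _ C3) CG).
  rewrite mean_plus, !mean_opJ in E1; auto. rewrite mean_opJ in E2; auto.
  rewrite E2; [|intros s; evar_last; [now apply is_derive_opJ | rewrite mean_plus; auto; ring]].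
  rewrite E1; [ring|].
  intros s. apply (is_derive_plus (V := R_NormedModule)); now apply is_derive_opJ.
Qed.

Lemma opJ_scal c f t : cper T f -> opJ T (fun s => c * f s) t = c * opJ T f t.
Proof.
  intros Hf.
  assert (E : forall s, primJ T (fun s => c * f s) s = c * primJ T f s).
  { intros s. unfold primJ. rewrite mean_scal; auto.
    rewrite RInt_scal_cont by apply Hf. ring. }
  assert (E' : mean T (primJ T (fun s => c * f s)) = c * mean T (primJ T f)).
  { rewrite <- mean_scal by now apply cper_primJ. f_equal.
    apply functional_extensionality. intros s. apply E. }
  unfold opJ. rewrite E, E'. ring.
Qed.

Lemma opJ_const c t : opJ T (fun _ => c) t = 0.
Proof.
  assert (E : forall s, primJ T (fun _ => c) s = 0).
  { intros s. unfold primJ. rewrite mean_const, RInt_const. unfold scal; simpl; unfold mult; simpl. ring. }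
  unfold opJ. rewrite E. replace (primJ T (fun _ => c)) with (fun _ : R => 0).
  - rewrite mean_const. ring.
  - apply functional_extensionality. intros s. now rewrite E.
Qed.

Section NormalSeries.
Variables (a : nat -> R -> R) (M : nat -> R) (S : R).
Hypothesis Ha : forall p, cper T (a p).
Hypothesis HM : forall p t, Rabs (a p t) <= M p.
Hypothesis HS : is_series M S.

Lemma is_series_mean : is_series (fun p => mean T (a p)) (mean T (fun s => Series (fun p => a p s))).
Proof.
  unfold mean, Rdiv.
  apply (is_series_ext_R (fun p => / T * RInt (a p) 0 T)); [intros; ring|].
  rewrite Rmult_comm.
  apply (is_series_scal (/ T) (fun p => RInt (a p) 0 T)). apply (is_series_RInt a M S); auto.
  intros p; apply Ha.
Qed.

Lemma is_series_primJ t : is_series (fun p => primJ T (a p) t) (primJ T (fun s => Series (fun p => a p s)) t).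
Proof.
  unfold primJ. apply (is_series_minus (fun p => RInt (a p) 0 t)).
  - apply (is_series_RInt a M S); auto. intros p; apply Ha.
  - apply (is_series_scal t (fun p => mean T (a p))). apply is_series_mean.
Qed.
End NormalSeries.

Lemma is_series_opJ (a : nat -> R -> R) (M : nat -> R) (S t : R) :
  (forall p, cper T (a p)) -> (forall p t, Rabs (a p t) <= M p) -> is_series M S ->
  is_series (fun p => opJ T (a p) t) (opJ T (fun s => Series (fun p => a p s)) t).
Proof.
  intros Ha HM HS. unfold opJ. apply (is_series_minus (fun p => primJ T (a p) t)).
  - now apply (is_series_primJ a M S).
  - replace (primJ T (fun s => Series (fun p => a p s))) with (fun s => Series (fun p => primJ T (a p) s)).
    + apply (is_series_mean (fun p => primJ T (a p)) (fun p => 2 * T * M p) (2 * T * S)).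
      * intros p; now apply cper_primJ.
      * intros p. apply primJ_bound; auto.
      * apply (is_series_scal (2 * T) M S HS).
    + apply functional_extensionality. intros s. apply is_series_unique.
      now apply (is_series_primJ a M S).
Qed.

(** [L] lifts coefficientwise to formal power series whose coefficients are functions of time. *)
Record timeop (L : (R -> R) -> R -> R) (C : R) : Prop := {
  timeop_pos : 0 <= C;
  timeop_cper : forall f, cper T f -> cper T (L f);
  timeop_bound : forall f M, cper T f -> (forall t, Rabs (f t) <= M) -> forall t, Rabs (L f t) <= C * M;
  timeop_scal : forall c f t, cper T f -> L (fun s => c * f s) t = c * L f t;
  timeop_series : forall a M S t,
    (forall p, cper T (a p)) -> (forall p t, Rabs (a p t) <= M p) -> is_series M S ->
    is_series (fun p => L (a p) t) (L (fun s => Series (fun p => a p s)) t) }.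

Lemma timeop_opJ : timeop (opJ T) (4 * T).
Proof.
  split.
  - lra.
  - apply cper_opJ.
  - intros; now apply opJ_bound.
  - intros; now apply opJ_scal.
  - intros; now apply (is_series_opJ a M S).
Qed.

Lemma timeop_mean : timeop (fun f _ => mean T f) 1.
Proof.
  split.
  - lra.
  - intros; apply cper_const.
  - intros. rewrite Rmult_1_l. now apply mean_bound.
  - intros; now apply mean_scal.
  - intros; now apply (is_series_mean a M S).
Qed.

(** [loc p t] splits a point of the algebra into the time [t] and the remaining parameters [p]. At
    fixed parameters an element of finite norm is a continuous periodic function of time, on which
    [opJ] and [mean] can act. *)
Definition slices {A : alg} (N : nrm A) {P : Type} (PD : P -> Prop) (loc : P -> R -> pt A) : Prop :=
  (forall p t, PD p -> dom N (loc p t)) /\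
  (forall a M p, nr N a M -> PD p -> cper T (fun t => ev a (loc p t))).

Definition lifts {A : alg} (N : nrm A) {P : Type} (PD : P -> Prop) (loc : P -> R -> pt A)
    (L : (R -> R) -> R -> R) (C : R) (op : A -> A) : Prop :=
  (forall a M, nr N a M -> nr N (op a) (C * M)) /\
  (forall a M p t, nr N a M -> PD p -> ev (op a) (loc p t) = L (fun s => ev a (loc p s)) t).

Definition smap {A : alg} (op : A -> A) (c : ser A) : ser A := fun k => op (c k).

Definition nrmT : nrm alg_fun := nrm_fun (fun _ => True) open_true T.

Lemma nrmT_cper (f : alg_fun) M : nr nrmT f M <-> cper T f /\ (forall t, Rabs (f t) <= M).
Proof.
  split.
  - intros [_ H]. split; [split; intros t; apply (H t I) | intros t; apply (H t I)].
  - intros [[H1 H2] H3]. split.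
    + eapply Rle_trans; [apply Rabs_pos | apply (H3 0)].
    + intros t _. repeat split; auto.
Qed.

Lemma slices_fun : slices nrmT (fun _ : unit => True) (fun _ t => t : pt alg_fun).
Proof.
  split; [intros; exact I|]. intros a M p H _. apply (proj1 (nrmT_cper a M) H).
Qed.

Lemma lifts_fun L C : timeop L C -> lifts nrmT (fun _ : unit => True) (fun _ t => t : pt alg_fun) L C L.
Proof.
  intros HL. split; auto.
  intros a M H. apply nrmT_cper in H. destruct H as [H1 H2]. apply nrmT_cper. split.
  - now apply (timeop_cper L C).
  - now apply (timeop_bound L C).
Qed.

Section LiftSer.
Context {A : alg} (N : nrm A) {P : Type} (PD : P -> Prop) (loc : P -> R -> pt A).
Variables (rho : R) (Hrho : 0 < rho).
Hypothesis Hsl : slices N PD loc.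

Definition sPD (x : R * P) : Prop := Rabs (fst x) <= rho /\ PD (snd x).
Definition sloc (x : R * P) (t : R) : pt (ser A) := (fst x, loc (snd x) t).

Lemma ser_terms_cper (c : ser A) M h p :
  ser_nr N rho c M -> PD p -> Rabs h <= rho -> exists m S,
  (forall k, cper T (fun t => h ^ k * ev (c k) (loc p t))) /\
  (forall k t, Rabs (h ^ k * ev (c k) (loc p t)) <= m k) /\ is_series m S.
Proof.
  intros [m [S [Hm [HS _]]]] Hp Hh. exists (fun k => m k * rho ^ k), S. split; [|split]; auto.
  - intros k. apply cper_scal. now apply (proj2 Hsl (c k) (m k) p).
  - intros k t. rewrite Rmult_comm. apply (ser_term_le N); auto. now apply (proj1 Hsl).
Qed.

Lemma slices_ser : slices (ser_nrm N rho Hrho) sPD sloc.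
Proof.
  split.
  - intros [h p] t [Hh Hp]; split; auto. now apply (proj1 Hsl).
  - intros c M [h p] Hc [Hh Hp]; simpl fst in *; simpl snd in *.
    destruct (ser_terms_cper c M h p Hc Hp Hh) as [m [S [H1 [H2 H3]]]].
    apply (cper_ext (fun t => Series (fun k => h ^ k * ev (c k) (loc p t)))).
    { intros t. simpl. rewrite PSeries_R. apply Series_ext. intros k; ring. }
    split.
    + intros t. apply (continuous_normal_series (fun _ => True) (fun k t => h ^ k * ev (c k) (loc p t)) m S); auto.
      * apply open_true.
      * intros k s _. split; [apply (H1 k) | apply H2].
    + intros t. apply Series_ext. intros k. apply (proj2 (H1 k)).
Qed.

(** Applying [op] to each coefficient agrees with applying [L] to the sum because [L] commutes with
    normally convergent series ([timeop_series]). *)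
Lemma lifts_ser L C op :
  timeop L C -> lifts N PD loc L C op -> lifts (ser_nrm N rho Hrho) sPD sloc L C (smap op).
Proof.
  intros HL [H1 H2]. split.
  - intros c M [m [S [Hm [HS Hl]]]]. exists (fun k => C * m k), (C * S). split; [|split].
    + intros k. now apply H1.
    + apply (is_series_ext_R (fun k => C * (m k * rho ^ k))); [intros; ring|].
      apply (is_series_scal C _ S HS).
    + apply Rmult_le_compat_l; auto. apply (timeop_pos L C HL).
  - intros c M [h p] t Hc [Hh Hp]; simpl fst in *; simpl snd in *.
    destruct (ser_terms_cper c M h p Hc Hp Hh) as [m [S [K1 [K2 K3]]]].
    assert (X := timeop_series L C HL _ m S t K1 K2 K3).
    destruct Hc as [m' [S' [Hm _]]].
    replace (fun s => ev c (sloc (h, p) s)) with (fun s => Series (fun k => h ^ k * ev (c k) (loc p s))).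
    + rewrite <- (is_series_unique _ _ X). simpl. rewrite PSeries_R. apply Series_ext. intros k.
      unfold smap. rewrite (H2 (c k) (m' k)); auto.
      rewrite (timeop_scal L C HL); [ring|]. now apply (proj2 Hsl (c k) (m' k) p).
    + apply functional_extensionality. intros s. simpl. rewrite PSeries_R. apply Series_ext. intros k; ring.
Qed.
End LiftSer.
End Periodic.

Lemma cper_shift T f s : cper T f -> cper T (fun t => f (t + s)).
Proof.
  intros [H1 H2]. split.
  - intros t. apply (continuous_comp (fun t => t + s) f); auto.
    apply (ex_derive_continuous (fun t => t + s)). auto_derive; auto.
  - intros t. replace (t + T + s) with (t + s + T) by ring. apply H2.
Qed.

Lemma is_derive_shift (f : R -> R) s t l : is_derive f (t + s) l -> is_derive (fun t => f (t + s)) t l.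
Proof.
  intros H. evar_last. apply (is_derive_comp f (fun t => t + s) t l 1); [exact H|].
  - auto_derive; auto.
  - unfold scal; simpl; unfold mult; simpl. Req. ring.
Qed.

(** * Fourier coefficients *)

Section Fourier.
Variable q : Z.
Hypothesis hq : (1 <= q)%Z.
Let T := period q.

Lemma IZR_q_pos : 0 < IZR q.
Proof. apply IZR_lt; lia. Qed.

Lemma period_pos : 0 < period q.
Proof. unfold period. assert (H := IZR_q_pos). assert (H' := PI_RGT_0). nra. Qed.

Lemma cos_Z_period x k : cos (x + 2 * PI * IZR k) = cos x.
Proof.
  destruct (Z_le_dec 0 k) as [Hk|Hk].
  - rewrite <- (Z2Nat.id k) by auto. rewrite <- INR_IZR_INZ.
    rewrite <- (cos_period x (Z.to_nat k)). f_equal. ring.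
  - rewrite <- (cos_period (x + 2 * PI * IZR k) (Z.to_nat (- k))).
    f_equal. rewrite INR_IZR_INZ, Z2Nat.id, opp_IZR by lia. ring.
Qed.

Lemma sin_Z_period x k : sin (x + 2 * PI * IZR k) = sin x.
Proof.
  rewrite <- !cos_shift, <- (cos_Z_period (PI / 2 - x) (- k)). f_equal. rewrite opp_IZR. ring.
Qed.

Definition cosn (nu : Z) (t : R) : R := cos (IZR nu * t / IZR q).
Definition sinn (nu : Z) (t : R) : R := sin (IZR nu * t / IZR q).

Lemma cper_cosn nu : cper T (cosn nu).
Proof.
  assert (H := IZR_q_pos). split.
  - intros t. apply (ex_derive_continuous (cosn nu)). unfold cosn. auto_derive. lra.
  - intros t. unfold cosn. rewrite <- (cos_Z_period (IZR nu * t / IZR q) nu). f_equal. unfold T, period. field. lra.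
Qed.

Lemma cper_sinn nu : cper T (sinn nu).
Proof.
  assert (H := IZR_q_pos). split.
  - intros t. apply (ex_derive_continuous (sinn nu)). unfold sinn. auto_derive. lra.
  - intros t. unfold sinn. rewrite <- (sin_Z_period (IZR nu * t / IZR q) nu). f_equal. unfold T, period. field. lra.
Qed.

Lemma fourier_mean (f : R -> R) nu :
  fourier q f nu = (mean T (fun t => f t * cosn nu t), - mean T (fun t => f t * sinn nu t)).
Proof. reflexivity. Qed.

Lemma fourier_0 f : fourier q f 0 = RtoC (mean T f).
Proof.
  rewrite fourier_mean. unfold RtoC. f_equal.
  - f_equal. apply functional_extensionality. intros t. unfold cosn.
    replace (0 * t / IZR q) with 0 by (field; apply Rgt_not_eq, IZR_q_pos). rewrite cos_0. ring.
  - replace (fun t => f t * sinn 0 t) with (fun _ : R => 0).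
    + rewrite mean_const by apply period_pos. ring.
    + apply functional_extensionality. intros t. unfold sinn.
      replace (0 * t / IZR q) with 0 by (field; apply Rgt_not_eq, IZR_q_pos). rewrite sin_0. ring.
Qed.

Lemma fourier_lin f g c nu : cper T f -> cper T g ->
  fourier q (fun t => f t + c * g t) nu = Cplus (fourier q f nu) (Cmult (RtoC c) (fourier q g nu)).
Proof.
  intros Hf Hg. rewrite !fourier_mean.
  assert (E : forall h, cper T h -> mean T (fun t => (f t + c * g t) * h t)
    = mean T (fun t => f t * h t) + c * mean T (fun t => g t * h t)).
  { intros h Hh. rewrite <- mean_scal by (auto using period_pos; now apply cper_mult).
    rewrite <- mean_plus; [|apply period_pos|now apply cper_mult|apply cper_scal; now apply cper_mult].
    f_equal. apply functional_extensionality. intros t. ring. }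
  rewrite !E by auto using cper_cosn, cper_sinn.
  unfold Cplus, Cmult, RtoC; simpl. f_equal; ring.
Qed.

Lemma fourier_opJ f nu : cper T f -> nu <> 0%Z ->
  fourier q (opJ T f) nu = Cdiv (fourier q f nu) (Cmult Ci (RtoC (IZR nu / IZR q))).
Proof.
  intros Hf Hnu. rewrite !fourier_mean.
  assert (Hq := IZR_q_pos). assert (HT := period_pos). fold T in HT.
  assert (Hn : IZR nu <> 0) by now apply not_0_IZR.
  set (l := IZR nu / IZR q).
  assert (Hl : l <> 0). { unfold l, Rdiv. apply Rmult_integral_contrapositive. split; auto. apply Rinv_neq_0_compat; lra. }
  assert (CJ := cper_opJ T HT f Hf). assert (Cc := cper_cosn nu). assert (Cs := cper_sinn nu).
  assert (Dc : forall t, is_derive (cosn nu) t (- l * sinn nu t)).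
  { intros t. unfold cosn, sinn, l. auto_derive; [lra|]. unfold Rdiv. ring. }
  assert (Ds : forall t, is_derive (sinn nu) t (l * cosn nu t)).
  { intros t. unfold cosn, sinn, l. auto_derive; [lra|]. unfold Rdiv. ring. }
  set (m := mean T f).
  assert (DJ : forall t, is_derive (opJ T f) t (f t - m)) by (intros; now apply is_derive_opJ).
  (* Integration by parts, written as the vanishing mean of a derivative. The extra multiple of
     [cosn] cancels the term [- m] in the derivative of [opJ T f]. *)
  assert (E1 : mean T (fun t => f t * sinn nu t + l * (opJ T f t * cosn nu t)) = 0).
  { apply (mean_of_derive T HT (fun t => opJ T f t * sinn nu t + (- m / l) * cosn nu t)).
    - apply cper_plus; [now apply cper_mult | now apply cper_scal].
    - apply cper_plus; [now apply cper_mult | now apply cper_scal, cper_mult].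
    - intros t. evar_last.
      + apply (is_derive_plus (V := R_NormedModule)).
        * apply (is_derive_mult (opJ T f) (sinn nu)); [apply DJ | apply Ds | apply Rmult_comm].
        * apply (is_derive_scal (cosn nu)), Dc.
      + unfold plus, mult, scal; simpl; unfold mult; simpl. Req. field. auto. }
  assert (E2 : mean T (fun t => f t * cosn nu t + (- l) * (opJ T f t * sinn nu t)) = 0).
  { apply (mean_of_derive T HT (fun t => opJ T f t * cosn nu t + (m / l) * sinn nu t)).
    - apply cper_plus; [now apply cper_mult | now apply cper_scal].
    - apply cper_plus; [now apply cper_mult | now apply cper_scal, cper_mult].
    - intros t. evar_last.
      + apply (is_derive_plus (V := R_NormedModule)).
        * apply (is_derive_mult (opJ T f) (cosn nu)); [apply DJ | apply Dc | apply Rmult_comm].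
        * apply (is_derive_scal (sinn nu)), Ds.
      + unfold plus, mult, scal; simpl; unfold mult; simpl. Req. field. auto. }
  rewrite mean_plus, mean_scal in E1; auto; try (repeat (apply cper_scal || apply cper_mult); auto).
  rewrite mean_plus, mean_scal in E2; auto; try (repeat (apply cper_scal || apply cper_mult); auto).
  unfold Cdiv, Cmult, Cinv, Ci, RtoC; simpl.
  f_equal.
  - apply Rmult_eq_reg_l with l; auto. transitivity (- mean T (fun t => f t * sinn nu t)); [lra|]. field. auto.
  - apply Rmult_eq_reg_l with l; auto. transitivity (- mean T (fun t => f t * cosn nu t)); [lra|]. field. auto.
Qed.

(** [opJ] annihilates constants, so [fourier_opJ] equates 0 with the coefficient divided by a
    nonzero number; no integral is computed. *)
Lemma fourier_const c nu : nu <> 0%Z -> fourier q (fun _ => c) nu = RtoC 0.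
Proof.
  intros Hnu. assert (HT := period_pos). fold T in HT.
  assert (E := fourier_opJ (fun _ => c) nu (cper_const T c) Hnu).
  replace (opJ T (fun _ => c)) with (fun _ : R => 0) in E.
  2:{ apply functional_extensionality. intros t. now rewrite opJ_const. }
  assert (Z : fourier q (fun _ => 0) nu = RtoC 0).
  { rewrite fourier_mean. unfold RtoC.
    replace (fun t => 0 * cosn nu t) with (fun _ : R => 0) by (apply functional_extensionality; intros; ring).
    replace (fun t => 0 * sinn nu t) with (fun _ : R => 0) by (apply functional_extensionality; intros; ring).
    rewrite mean_const by auto. f_equal. ring. }
  rewrite Z in E.
  assert (HD : Cmult Ci (RtoC (IZR nu / IZR q)) <> RtoC 0).
  { assert (Hq := IZR_q_pos). assert (Hn : IZR nu <> 0) by now apply not_0_IZR.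
    unfold Cmult, Ci, RtoC; simpl. intros X. injection X. intros X1 _.
    apply Hn. apply Rmult_eq_reg_r with (/ IZR q); [|apply Rinv_neq_0_compat; lra].
    unfold Rdiv in X1. lra. }
  set (D := Cmult Ci (RtoC (IZR nu / IZR q))) in *. clearbody D.
  transitivity (Cmult (RtoC 0) D).
  - rewrite E. field. exact HD.
  - ring.
Qed.

Lemma trig_moment_zero f : cper T f -> (forall nu, fourier q f nu = RtoC 0) ->
  forall nu c, mean T (fun t => f t * cos (IZR nu * t / IZR q + c)) = 0.
Proof.
  intros Hf H nu c. assert (HT := period_pos). fold T in HT.
  specialize (H nu). rewrite fourier_mean in H. injection H. intros H1 H2.
  replace (fun t => f t * cos (IZR nu * t / IZR q + c)) with
    (fun t => cos c * (f t * cosn nu t) + (- sin c) * (f t * sinn nu t)).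
  - assert (Cc := cper_cosn nu). assert (Cs := cper_sinn nu).
    rewrite mean_plus, !mean_scal; auto; try (repeat (apply cper_scal || apply cper_mult); auto).
    rewrite H2. replace (mean T (fun t => f t * sinn nu t)) with 0 by lra. ring.
  - apply functional_extensionality. intros t. rewrite cos_plus. unfold cosn, sinn. ring.
Qed.

Lemma cper_cos_shift nu c : cper T (fun t => cos (IZR nu * t / IZR q + c)).
Proof.
  assert (H := IZR_q_pos). split.
  - intros t. apply (ex_derive_continuous (fun t => cos (IZR nu * t / IZR q + c))). auto_derive. lra.
  - intros t. rewrite <- (cos_Z_period (IZR nu * t / IZR q + c) nu). f_equal. unfold T, period. field. lra.
Qed.

(** [kern x0 b ^ n] concentrates at [x0]; it is a trigonometric polynomial. *)
Definition kern (x0 b t : R) : R := b + cos ((t - x0) / IZR q).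

Lemma cper_kern x0 b : cper T (kern x0 b).
Proof.
  apply cper_plus; [apply cper_const|].
  apply (cper_ext T (fun t => cos (IZR 1 * t / IZR q + (- x0 / IZR q)))).
  - intros t. f_equal. field. apply Rgt_not_eq, IZR_q_pos.
  - apply cper_cos_shift.
Qed.

Lemma cper_pow f n : cper T f -> cper T (fun t => f t ^ n).
Proof.
  intros H; induction n as [|n IH]; simpl; [apply cper_const | now apply cper_mult].
Qed.

(** The product formula for cosines trades one kernel factor for the frequencies [nu + 1] and
    [nu - 1] with shifted phases, which is why the induction quantifies over [nu] and [c]. *)
Lemma kern_moment_zero f x0 b : cper T f -> (forall nu, fourier q f nu = RtoC 0) ->
  forall n nu c, mean T (fun t => f t * kern x0 b t ^ n * cos (IZR nu * t / IZR q + c)) = 0.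
Proof.
  intros Hf H. assert (HT := period_pos). fold T in HT.
  induction n as [|n IH]; intros nu c.
  - rewrite <- (trig_moment_zero f Hf H nu c). f_equal. apply functional_extensionality. intros t. simpl. ring.
  - set (g := fun t => f t * kern x0 b t ^ n).
    assert (Hg : cper T g) by (apply cper_mult; auto; apply cper_pow, cper_kern).
    replace (fun t => f t * kern x0 b t ^ S n * cos (IZR nu * t / IZR q + c)) with
      (fun t => b * (g t * cos (IZR nu * t / IZR q + c)) +
        (1/2 * (g t * cos (IZR (nu + 1) * t / IZR q + (c - x0 / IZR q))) +
         1/2 * (g t * cos (IZR (nu - 1) * t / IZR q + (c + x0 / IZR q))))).
    + assert (C1 := cper_cos_shift nu c). assert (C2 := cper_cos_shift (nu + 1) (c - x0 / IZR q)).
      assert (C3 := cper_cos_shift (nu - 1) (c + x0 / IZR q)).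
      rewrite !mean_plus, !mean_scal; auto;
        repeat first [assumption | apply cper_plus | apply cper_scal | apply cper_mult].
      unfold g. rewrite !IH. ring.
    + apply functional_extensionality. intros t. unfold g, kern. simpl.
      set (u := IZR nu * t / IZR q + c). set (v := (t - x0) / IZR q).
      replace (IZR (nu + 1) * t / IZR q + (c - x0 / IZR q)) with (u + v)
        by (unfold u, v; rewrite plus_IZR; field; apply Rgt_not_eq, IZR_q_pos).
      replace (IZR (nu - 1) * t / IZR q + (c + x0 / IZR q)) with (u - v)
        by (unfold u, v; rewrite minus_IZR; field; apply Rgt_not_eq, IZR_q_pos).
      rewrite cos_plus, cos_minus. field.
Qed.

Lemma cos_decreasing_abs x y : 0 <= x -> x <= y -> y <= 2 * PI - x -> cos y <= cos x.
Proof.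
  intros H1 H2 H3. destruct (Rle_dec y PI) as [Hy|Hy].
  - apply cos_decr_1; lra.
  - replace (cos y) with (cos (2 * PI - y))
      by (rewrite <- (cos_neg y), <- (cos_Z_period (- y) 1); f_equal; ring).
    apply cos_decr_1; lra.
Qed.

(** All moments of [f] against powers of the kernel vanish. Around [x0], where [f] is positive,
    these powers grow geometrically, while elsewhere they stay bounded by 1. *)
Lemma fourier_positive_absurd f x0 : cper T f -> (forall nu, fourier q f nu = RtoC 0) ->
  0 < x0 < T -> 0 < f x0 -> False.
Proof.
  intros Hf H Hx0 Hpos. assert (HT := period_pos). fold T in HT. assert (Hq := IZR_q_pos).
  destruct (proj1 (continuous_eps f x0) (proj1 Hf x0) (f x0 / 2) ltac:(lra)) as [d0 [Hd0 Hd]].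
  set (d := Rmin (d0 / 2) (Rmin (x0 / 2) ((T - x0) / 2))).
  assert (Hdp : 0 < d) by (unfold d; repeat apply Rmin_glb_lt; lra).
  assert (Hd1 : d <= d0 / 2) by apply Rmin_l.
  assert (Hd2 : d <= x0 / 2) by (eapply Rle_trans; [apply Rmin_r | apply Rmin_l]).
  assert (Hd3 : d <= (T - x0) / 2) by (eapply Rle_trans; [apply Rmin_r | apply Rmin_r]).
  set (eta := f x0 / 2). assert (Heta : 0 < eta) by (unfold eta; lra).
  assert (Hf1 : forall t, Rabs (t - x0) <= d -> eta <= f t).
  { intros t Ht. assert (X := Hd t ltac:(lra)). apply Rabs_def2 in X. unfold eta; lra. }
  (* With this [b] the kernel equals 1 at distance [d] from [x0]: farther away it is at most 1 in
     absolute value, closer it exceeds 1. *)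
  set (b := 1 - cos (d / IZR q)). set (k := kern x0 b).
  assert (HTq : T = 2 * PI * IZR q) by reflexivity.
  assert (Hdq : forall x y, x <= y -> x / IZR q <= y / IZR q).
  { intros x y Hxy. apply Rmult_le_compat_r; auto. left; now apply Rinv_0_lt_compat. }
  assert (HdT : d / IZR q <= PI).
  { replace PI with ((PI * IZR q) / IZR q) by (field; lra). apply Hdq. lra. }
  assert (Hd0q : 0 < d / IZR q) by (apply Rdiv_lt_0_compat; lra).
  assert (Hcosabs : forall t, cos ((t - x0) / IZR q) = cos (Rabs (t - x0) / IZR q)).
  { intros t. unfold Rabs; destruct (Rcase_abs (t - x0)); auto.
    rewrite <- cos_neg. f_equal. field. lra. }
  assert (Hout : forall t, 0 <= t <= T -> d <= Rabs (t - x0) -> Rabs (k t) <= 1).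
  { intros t Ht Hdt. unfold k, kern, b. rewrite Hcosabs.
    assert (Hc : cos (Rabs (t - x0) / IZR q) <= cos (d / IZR q)).
    { apply cos_decreasing_abs; [lra | now apply Hdq|].
      replace (2 * PI - d / IZR q) with ((2 * PI * IZR q - d) / IZR q) by (field; lra).
      apply Hdq. rewrite <- HTq. unfold Rabs; destruct (Rcase_abs (t - x0)); lra. }
    assert (X := COS_bound (Rabs (t - x0) / IZR q)). assert (X' := COS_bound (d / IZR q)).
    apply Rabs_le. lra. }
  assert (Hin : forall e t, 0 <= e <= d -> Rabs (t - x0) <= e -> 1 + (cos (e / IZR q) - cos (d / IZR q)) <= k t).
  { intros e t He Het. unfold k, kern, b. rewrite Hcosabs.
    assert (Hc : cos (e / IZR q) <= cos (Rabs (t - x0) / IZR q)).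
    { apply cos_decreasing_abs.
      - apply Rmult_le_pos; [apply Rabs_pos | left; now apply Rinv_0_lt_compat].
      - now apply Hdq.
      - assert (Rabs (t - x0) / IZR q <= e / IZR q) by now apply Hdq.
        assert (e / IZR q <= d / IZR q) by now apply Hdq. lra. }
    lra. }
  set (g := cos (d / 2 / IZR q) - cos (d / IZR q)).
  assert (Hg : 0 < g).
  { unfold g. assert (d / 2 / IZR q < d / IZR q).
    { apply Rmult_lt_compat_r; [now apply Rinv_0_lt_compat | lra]. }
    assert (0 < d / 2 / IZR q) by (apply Rdiv_lt_0_compat; lra).
    assert (cos (d / IZR q) < cos (d / 2 / IZR q)); [|lra].
    apply cos_decreasing_1; lra. }
  destruct (continuity_ab_maj (fun t => Rabs (f t)) 0 T ltac:(lra)) as [xm [Hxm _]].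
  { intros c _. apply continuity_pt_filterlim. apply (continuous_comp f Rabs); [apply (proj1 Hf) | apply continuous_Rabs]. }
  set (M := Rabs (f xm)).
  assert (HM : forall t, 0 <= t <= T -> Rabs (f t) <= M) by (intros t Ht; apply (Hxm t Ht)).
  assert (HM0 : 0 <= M) by apply Rabs_pos.
  assert (Hzero : forall n, RInt (fun t => f t * k t ^ n) 0 T = 0).
  { intros n. assert (X := kern_moment_zero f x0 b Hf H n 0 0).
    replace (fun t => f t * kern x0 b t ^ n * cos (0 * t / IZR q + 0)) with (fun t => f t * k t ^ n) in X.
    - unfold mean in X. apply Rmult_eq_reg_r with (/ T); [|apply Rinv_neq_0_compat; lra].
      unfold Rdiv in X. lra.
    - apply functional_extensionality. intros t. replace (0 * t / IZR q + 0) with 0 by (field; lra).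
      rewrite cos_0. unfold k. ring. }
  assert (Hc : forall n, cper T (fun t => f t * k t ^ n)).
  { intros n. apply cper_mult; auto. apply cper_pow, cper_kern. }
  (* The whole integral is 0, the middle piece is at least [eta * (1 + g) ^ n * d], and the two
     outer pieces together are at least [- T * M]. *)
  assert (Hlow : forall n, eta * (1 + g) ^ n * d <= T * M).
  { intros n. specialize (Hzero n). set (h := fun t => f t * k t ^ n) in *.
    assert (Hch : forall t, continuous h t) by apply (Hc n).
    rewrite <- (RInt_Chasles_cont h 0 (x0 - d / 2) T), <- (RInt_Chasles_cont h (x0 - d / 2) (x0 + d / 2) T) in Hzero; auto.
    assert (Hp : forall t, Rabs (t - x0) <= d -> 0 <= h t).
    { intros t Ht. unfold h. apply Rmult_le_pos; [specialize (Hf1 t Ht); lra|].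
      apply pow_le. specialize (Hin d t ltac:(lra) Ht). lra. }
    assert (HhM : forall t, 0 <= t <= T -> - M <= h t).
    { intros t Ht. destruct (Rle_dec (Rabs (t - x0)) d) as [Hc1|Hc1].
      - specialize (Hp t Hc1). lra.
      - assert (Rabs (h t) <= M); [|apply Rabs_le_between in H0; lra].
        unfold h. rewrite Rabs_mult, <- (Rmult_1_r M). apply Rmult_le_compat; auto using Rabs_pos.
        rewrite <- RPow_abs, <- (pow1 n). apply pow_incr. split; [apply Rabs_pos|].
        apply Hout; auto. lra. }
    assert (I : forall x y c, x <= y -> (forall t, x < t < y -> c <= h t) -> c * (y - x) <= RInt h x y).
    { intros x y c Hxy Hb.
      replace (c * (y - x)) with (RInt (fun _ => c) x y).
      - apply RInt_le; auto; [apply ex_RInt_const | now apply ex_RInt_cont].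
      - rewrite RInt_const. unfold scal; simpl; unfold mult; simpl. ring. }
    assert (I1 := I 0 (x0 - d / 2) (- M) ltac:(lra) ltac:(intros; apply HhM; lra)).
    assert (I3 := I (x0 + d / 2) T (- M) ltac:(lra) ltac:(intros; apply HhM; lra)).
    assert (I2 : eta * (1 + g) ^ n * (x0 + d / 2 - (x0 - d / 2)) <= RInt h (x0 - d / 2) (x0 + d / 2)).
    { apply I; [lra|]. intros t Ht.
      assert (Ha : Rabs (t - x0) <= d / 2) by (apply Rabs_le; lra).
      unfold h. apply Rmult_le_compat.
      - lra.
      - apply pow_le; lra.
      - apply Hf1; lra.
      - apply pow_incr. split; [lra|]. unfold g. apply Hin; lra. }
    replace (x0 + d / 2 - (x0 - d / 2)) with d in I2 by field.
    assert (0 <= M * d) by (apply Rmult_le_pos; lra). lra. }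
  assert (Hlim := is_lim_seq_geom_p (1 + g) ltac:(lra)).
  apply is_lim_seq_spec in Hlim. destruct (Hlim (T * M / (eta * d))) as [n Hn].
  specialize (Hn n (Nat.le_refl _)). specialize (Hlow n).
  assert (He : 0 < eta * d) by nra.
  assert (X : T * M / (eta * d) * (eta * d) < (1 + g) ^ n * (eta * d)) by now apply Rmult_lt_compat_r.
  replace (T * M / (eta * d) * (eta * d)) with (T * M) in X by (field; lra). lra.
Qed.

(** Applied to the difference and to its opposite, the previous lemma gives equality inside the
    period; continuity covers the endpoint 0, and periodicity the rest. *)
Lemma fourier_unique f g : cper T f -> cper T g -> (forall nu, fourier q f nu = fourier q g nu) ->
  forall t, f t = g t.
Proof.
  intros Hf Hg H. assert (HT := period_pos). fold T in HT.
  assert (A0 : forall h, cper T h -> (forall nu, fourier q h nu = RtoC 0) -> forall t, 0 < t < T -> h t <= 0).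
  { intros h Hh Hz t Ht. apply Rnot_lt_le. intros Hl. now apply (fourier_positive_absurd h t). }
  assert (L : forall u v, cper T u -> cper T v -> (forall nu, fourier q u nu = fourier q v nu) ->
    forall nu, fourier q (fun t => u t + (-1) * v t) nu = RtoC 0).
  { intros u v Hu Hv E nu. rewrite fourier_lin, E; auto. ring. }
  assert (A1 : forall t, 0 < t < T -> f t + -1 * g t = 0).
  { intros t Ht.
    assert (X1 := A0 (fun t => f t + -1 * g t) (cper_plus T _ _ Hf (cper_scal T (-1) g Hg)) (L f g Hf Hg H) t Ht).
    assert (X2 := A0 (fun t => g t + -1 * f t) (cper_plus T _ _ Hg (cper_scal T (-1) f Hf)) (L g f Hg Hf (fun nu => eq_sym (H nu))) t Ht).
    simpl in *. lra. }
  set (h := fun t => f t + -1 * g t).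
  assert (Hh : cper T h) by (apply cper_plus; auto; now apply cper_scal).
  assert (h0 : h 0 = 0).
  { destruct (Req_dec (h 0) 0) as [E|E]; auto. exfalso.
    destruct (proj1 (continuous_eps h 0) (proj1 Hh 0) (Rabs (h 0)) (Rabs_pos_lt _ E)) as [d [Hd X]].
    assert (Hm : 0 < Rmin (d / 2) (T / 2)) by (apply Rmin_glb_lt; lra).
    assert (Hl := Rmin_l (d / 2) (T / 2)). assert (Hr := Rmin_r (d / 2) (T / 2)).
    specialize (X (Rmin (d / 2) (T / 2))). rewrite Rminus_0_r, Rabs_pos_eq in X by lra.
    specialize (X ltac:(lra)).
    assert (Z : h (Rmin (d / 2) (T / 2)) = 0) by (apply A1; lra).
    rewrite Z, Rminus_0_l, Rabs_Ropp in X. lra. }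
  assert (A2 : forall t, Rabs (h t) <= 0).
  { apply (periodic_bound T HT h 0 (proj2 Hh)). intros t Ht.
    assert (Z : h t = 0).
    { destruct (Req_dec t 0) as [->|]; auto. destruct (Req_dec t T) as [->|].
      - rewrite <- h0, <- (proj2 Hh 0). now rewrite Rplus_0_l.
      - apply A1. lra. }
    rewrite Z, Rabs_R0. lra. }
  intros t. specialize (A2 t). assert (X := Rabs_pos (h t)).
  assert (Z : h t = 0). { destruct (Req_dec (h t) 0) as [E|E]; auto. apply Rabs_pos_lt in E. lra. }
  unfold h in Z. lra.
Qed.
End Fourier.

(** * Uniform Taylor expansion along the unperturbed orbit *)

Lemma open_ball0 (d : R) : open (fun h : R => Rabs h < d).
Proof.
  apply (open_comp Rabs (fun y => y < d)); [|apply open_lt].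
  intros x _. apply continuous_Rabs.
Qed.

(** The triple series is recomposed with [w * h + u], [v] and [h], where [h] is a function of local
    time and [u], [v] are series variables. The single number [d] is both a radius and, through
    [/ d], a bound, so that one later compactness argument handles both. *)
Lemma local_expand (f : R -> R -> R -> R) (w x y z : R) :
  analytic3_at f x y z ->
  exists (d : R) (c : nat -> nat -> R -> R), 0 < d /\
    (forall i j h, Rabs h < d -> continuous (c i j) h /\ Rabs (c i j h) * d ^ (i + j) <= / d) /\
    (forall h u v, Rabs h < d -> Rabs u < d -> Rabs v < d ->
       f (x + w * h + u) (y + v) (z + h) = PSeries (fun i => PSeries (fun j => c i j h) v) u).
Proof.
  intros [a [r [K [Hr [Ha Hf]]]]].
  assert (HK : 0 <= K).
  { eapply Rle_trans; [|apply (Ha O O O)]. simpl. rewrite Rmult_1_r. apply Rabs_pos. }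
  assert (Hw := Rabs_pos w).
  set (rho := r / (2 * (Rabs w + 1))).
  assert (Hrho : 0 < rho) by (apply Rdiv_lt_0_compat; lra).
  assert (Hrw : (Rabs w + 1) * rho = r / 2) by (unfold rho; field; lra).
  assert (Hr2 : rho <= r / 2) by nra.
  set (N0 := nrm_fun (fun h => Rabs h < rho) (open_ball0 rho) 0).
  set (N1 := ser_nrm N0 rho Hrho). set (N2 := ser_nrm N1 rho Hrho).
  assert (Hlin : forall b, nr N0 (fun h => b * h) (Rabs b * rho)).
  { intros b. split; [apply Rmult_le_pos; auto using Rabs_pos; lra|]. intros t Ht. repeat split.
    - apply (ex_derive_continuous (fun h => b * h)). auto_derive; auto.
    - rewrite Rabs_mult. apply Rmult_le_compat_l; auto using Rabs_pos. lra.
    - f_equal; ring. }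
  set (id0 := (fun h : R => 1 * h) : alg_fun). set (w0 := (fun h : R => w * h) : alg_fun).
  set (U := add (lift (lift w0)) (sh (cst 1)) : ser (ser alg_fun)).
  set (V := lift (sh (cst 1)) : ser (ser alg_fun)).
  set (Z := lift (lift id0) : ser (ser alg_fun)).
  assert (HU0 : nr N2 (lift (lift w0)) (Rabs w * rho)) by (apply (nr_lift N1), (nr_lift N0), Hlin).
  assert (HU1 : nr N2 (sh (cst 1)) (rho * 1)) by (now apply (nr_var N1)).
  assert (HU : nr N2 U (Rabs w * rho + rho * 1)) by now apply nr_add.
  assert (HV0 : nr N1 (sh (cst 1)) (rho * 1)) by now apply (nr_var N0).
  assert (HV : nr N2 V (rho * 1)) by now apply (nr_lift N1).
  assert (HZ : nr N2 Z (Rabs 1 * rho)) by (apply (nr_lift N1), (nr_lift N0), Hlin).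
  rewrite Rabs_R1 in HZ.
  assert (HA : forall p s t, nr N2 (cst (a p s t)) (K / r ^ (p + s + t))).
  { intros p s t. apply (nr_le N2 _ (Rabs (a p s t))); [apply nr_cst|]. now apply bound_div. }
  set (c := comp3 (fun p s t => cst (a p s t)) U V Z).
  assert (Hc : nr N2 c (8 * K)).
  { apply (nr_comp3 N2 _ U V Z r K (Rabs w * rho + rho * 1) (rho * 1) (1 * rho)); auto; lra. }
  assert (Hev : forall h u v, Rabs h < rho -> Rabs u <= rho -> Rabs v <= rho ->
    ev c (u, (v, h)) = f (x + w * h + u) (y + v) (z + h)).
  { intros h u v Hh Hu Hv.
    assert (Hd : dom N2 (u, (v, h))) by (repeat split; auto).
    assert (Hd1 : dom N1 (v, h)) by (repeat split; auto).
    unfold c. rewrite (ev_comp3 N2 _ U V Z r K (Rabs w * rho + rho * 1) (rho * 1) (1 * rho)); auto; try lra.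
    assert (EU : ev U (u, (v, h)) = w * h + u).
    { unfold U. rewrite (ev_add N2 _ _ _ _ _ HU0 HU1 Hd). rewrite (ev_lift N1), (ev_lift N0); auto.
      rewrite (ev_var N1 rho); auto. }
    assert (EV : ev V (u, (v, h)) = v).
    { unfold V. rewrite (ev_lift N1); auto. now rewrite (ev_var N0 rho). }
    assert (EZ : ev Z (u, (v, h)) = h).
    { unfold Z. rewrite (ev_lift N1), (ev_lift N0); auto. simpl. unfold id0; ring. }
    rewrite EU, EV, EZ.
    replace (x + w * h + u) with (x + (w * h + u)) by ring. rewrite Hf; try lra.
    - apply PSeries_ext; intros i. apply PSeries_ext; intros j. apply PSeries_ext; intros k.
      now apply (ev_cst N2).
    - eapply Rle_lt_trans; [apply Rabs_triang|]. rewrite Rabs_mult.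
      assert (Rabs w * Rabs h <= Rabs w * rho) by (apply Rmult_le_compat_l; lra). lra. }
  assert (Hcc : forall i j, nr N0 (c i j) (8 * K / rho ^ (i + j))).
  { intros i j. rewrite div_pow_add by auto.
    apply (ser_nr_coef N0 rho); auto. apply (ser_nr_coef N1 rho); auto. }
  (* The second entry makes the norm [8 * K] at most [/ d]. *)
  exists (Rmin rho (/ (8 * K + 1))), c.
  assert (Hk : 0 < / (8 * K + 1)) by (apply Rinv_0_lt_compat; lra).
  set (d := Rmin rho (/ (8 * K + 1))).
  assert (Hd : 0 < d) by now apply Rmin_glb_lt.
  assert (Hdr : d <= rho) by apply Rmin_l.
  assert (Hdk : d <= / (8 * K + 1)) by apply Rmin_r.
  split; [|split]; auto.
  - intros i j h Hh. destruct (Hcc i j) as [_ X]. destruct (X h) as [X1 [X2 _]]; [lra|].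
    split; auto. apply Rle_trans with (8 * K).
    + apply Rle_trans with (Rabs (c i j h) * rho ^ (i + j)).
      * apply Rmult_le_compat_l; [apply Rabs_pos|]. apply pow_incr; lra.
      * now apply bound_mul.
    + apply Rle_trans with (8 * K + 1); [lra|].
      rewrite <- (Rinv_inv (8 * K + 1)). apply Rinv_le_contravar; auto.
  - intros h u v Hh Hu Hv. rewrite <- Hev; try lra. reflexivity.
Qed.

(** A local expansion is chosen independently at each time. Uniqueness of coefficients glues them:
    near [t] the chosen values agree with one continuous family, and over a period, during which
    [w * t] gains [2 * PI * p], they repeat. Compactness of the period then gives a common radius
    and bound. *)
Lemma forcing_expand (W : R -> Prop) (F : R -> R -> R -> R) (A0 t0 w : R) (p q : Z) :
  open W -> analytic_forcing W F -> W A0 -> (1 <= q)%Z -> w = IZR p / IZR q ->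
  exists (c : nat -> nat -> R -> R) (r K : R), 0 < r /\
    (forall i j, nr (nrmT (period q)) (c i j) (K / r ^ (i + j))) /\
    (forall t u v, Rabs u < r -> Rabs v < r ->
       F (w * t + u) (A0 + v) (t + t0) = PSeries (fun i => PSeries (fun j => c i j t) v) u).
Proof.
  intros HW [HF [HF1 HF2]] HA0 hq Hw.
  assert (HT := period_pos q hq). assert (Hq := IZR_q_pos q hq). set (T := period q) in *.
  assert (Hloc := fun t => local_expand F w (w * t) A0 (t + t0) (HF _ _ _ HA0)).
  apply functional_choice in Hloc. destruct Hloc as [d Hloc]. apply functional_choice in Hloc. destruct Hloc as [cc Hloc].
  set (c := fun i j t => cc t i j 0).
  assert (Hd : forall t, 0 < d t) by (intros t; apply (Hloc t)).
  destruct (HW A0 HA0) as [dW HdW].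
  assert (HWv : forall v, Rabs v < dW -> W (A0 + v)).
  { intros v Hv. apply HdW. replace v with (A0 + v - A0) in Hv by ring. exact Hv. }
  assert (Hper : forall t u v, Rabs v < dW ->
    F (w * (t + T) + u) (A0 + v) (t + T + t0) = F (w * t + u) (A0 + v) (t + t0)).
  { intros t u v Hv. assert (Hw' := HWv v Hv).
    replace (w * (t + T) + u) with ((w * t + u) + IZR p * (2 * PI)).
    2:{ rewrite Hw. unfold T, period. field. lra. }
    rewrite (periodic_Z (2 * PI) (fun a => F a (A0 + v) (t + T + t0)) p) by (intros a; now apply HF1).
    replace (t + T + t0) with ((t + t0) + IZR q * (2 * PI)) by (unfold T, period; ring).
    apply (periodic_Z (2 * PI) (fun s => F (w * t + u) (A0 + v) s) q). intros s; now apply HF2. }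
  assert (Hshrink : forall t s, Rabs (s - t) < d t -> forall r, 0 < r <= d t -> forall i j,
     Rabs (cc t i j (s - t)) * r ^ (i + j) <= / d t).
  { intros t s Hs r Hr i j. destruct (Hloc t) as [_ [X _]]. destruct (X i j _ Hs) as [_ Y].
    eapply Rle_trans; [|apply Y]. apply Rmult_le_compat_l; [apply Rabs_pos|]. apply pow_incr; lra. }
  assert (Hexp : forall t s u v, Rabs (s - t) < d t -> Rabs u < d t -> Rabs v < d t ->
     F (w * s + u) (A0 + v) (s + t0) = PSeries (fun i => PSeries (fun j => cc t i j (s - t)) v) u).
  { intros t s u v Hs Hu Hv. destruct (Hloc t) as [_ [_ X]]. rewrite <- X; auto. f_equal; ring. }
  assert (Hself : forall t, Rabs (t - t) < d t) by (intros t; rewrite Rminus_diag, Rabs_R0; auto).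
  assert (Hc0 : forall i j t, c i j t = cc t i j (t - t)) by (intros; unfold c; now rewrite Rminus_diag).
  assert (Huniq : forall t s, Rabs (s - t) < d t -> forall i j, c i j s = cc t i j (s - t)).
  { intros t s Hs. set (r := Rmin (d s) (d t)).
    assert (Hr : 0 < r) by now apply Rmin_glb_lt.
    assert (R1 : r <= d s) by apply Rmin_l. assert (R2 : r <= d t) by apply Rmin_r.
    apply (PSeries2_coef_unique (fun i j => c i j s) (fun i j => cc t i j (s - t)) r (/ d s) (/ d t)); [exact Hr| | |].
    - intros i j. rewrite Hc0. apply Hshrink; auto.
    - intros i j. apply Hshrink; auto.
    - intros u v Hu Hv. rewrite <- (Hexp t s u v) by lra. rewrite (Hexp s s u v) by (auto; lra).
      apply PSeries_ext; intros i; apply PSeries_ext; intros j. now rewrite Hc0. }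
  assert (Hcper : forall i j t, c i j (t + T) = c i j t).
  { intros i j t. revert i j.
    set (r := Rmin dW (Rmin (d (t + T)) (d t))).
    assert (Hr : 0 < r) by (repeat apply Rmin_glb_lt; auto; apply cond_pos).
    assert (R0 : r <= dW) by apply Rmin_l.
    assert (R1 : r <= d (t + T)) by (eapply Rle_trans; [apply Rmin_r | apply Rmin_l]).
    assert (R2 : r <= d t) by (eapply Rle_trans; [apply Rmin_r | apply Rmin_r]).
    apply (PSeries2_coef_unique (fun i j => c i j (t + T)) (fun i j => c i j t) r (/ d (t + T)) (/ d t)); [exact Hr| | |].
    - intros i j. rewrite Hc0. apply Hshrink; auto.
    - intros i j. rewrite Hc0. apply Hshrink; auto.
    - intros u v Hu Hv.
      transitivity (F (w * (t + T) + u) (A0 + v) (t + T + t0)).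
      + rewrite (Hexp (t + T) (t + T) u v) by (auto; lra).
        apply PSeries_ext; intros i; apply PSeries_ext; intros j. now rewrite Hc0.
      + rewrite Hper by lra. rewrite (Hexp t t u v) by (auto; lra).
        apply PSeries_ext; intros i; apply PSeries_ext; intros j. now rewrite Hc0. }
  assert (Hcont : forall i j t, continuous (c i j) t).
  { intros i j t. apply (continuous_ext_loc _ (fun s => cc t i j (s - t))).
    - exists (mkposreal _ (Hd t)). intros s Hs. symmetry. apply Huniq, Hs.
    - apply (continuous_comp (fun s => s - t) (cc t i j)).
      + apply (ex_derive_continuous (fun s => s - t)). auto_derive; auto.
      + rewrite Rminus_diag. destruct (Hloc t) as [_ [X _]]. apply X. rewrite Rabs_R0; auto. }
  (* Each [t] in the period lies near some [s] with [eta <= d s]; as the coefficients near [s] are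
     bounded by means of [/ d s], the same [eta] gives the uniform bound. *)
  destruct (compactness_value_1d 0 T (fun t => mkposreal _ (Hd t))) as [eta Heta].
  assert (Hcov : forall t, 0 <= t <= T -> exists s, Rabs (t - s) < d s /\ eta <= d s).
  { intros t Ht. apply NNPP. intros Hn. apply (Heta t Ht). intros [s [_ [H1 H2]]].
    apply Hn. exists s. split; auto. }
  set (r := Rmin eta dW).
  assert (Hr : 0 < r) by (apply Rmin_glb_lt; apply cond_pos).
  assert (R1 : r <= eta) by apply Rmin_l. assert (R2 : r <= dW) by apply Rmin_r.
  exists c, r, (/ r). split; [|split]; auto.
  - intros i j. apply nrmT_cper. split; [split; auto; intros t; apply Hcper|].
    apply (periodic_bound T HT); [intros t; apply Hcper|].
    intros t Ht. destruct (Hcov t Ht) as [s [H1 H2]].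
    apply bound_div; auto. rewrite (Huniq s t H1).
    eapply Rle_trans; [apply Hshrink; auto; lra|]. apply Rinv_le_contravar; lra.
  - intros t u v Hu Hv. destruct (periodic_reduce T HT t) as [k Hk].
    assert (P1 : periodic T (fun t => F (w * t + u) (A0 + v) (t + t0))).
    { intros s. apply Hper. lra. }
    assert (P2 : periodic T (fun t => PSeries (fun i => PSeries (fun j => c i j t) v) u)).
    { intros s. apply PSeries_ext; intros i; apply PSeries_ext; intros j. apply Hcper. }
    rewrite <- (periodic_Z T _ k t P1), <- (periodic_Z T _ k t P2). cbv beta.
    destruct (Hcov _ Hk) as [s [H1 H2]].
    rewrite (Hexp s) by (auto; lra).
    apply PSeries_ext; intros i; apply PSeries_ext; intros j. symmetry. now apply Huniq.
Qed.

(** * The auxiliary system *)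

(** Algebras of functions of time depending on further variables, in which
    [opJ] and [mean] act on the time variable. *)
Record talg (T : R) := TAlg {
  ta :> alg;
  tn : nrm ta;
  tP : Type;
  tPD : tP -> Prop;
  tloc : tP -> R -> pt ta;
  temb : (R -> R) -> ta;
  tJ : ta -> ta;
  tM : ta -> ta;
  t_slices : slices T tn tPD tloc;
  t_J : lifts tn tPD tloc (opJ T) (4 * T) tJ;
  t_M : lifts tn tPD tloc (fun f _ => mean T f) 1 tM;
  t_emb_nr : forall f M, nr (nrmT T) f M -> nr tn (temb f) M;
  t_emb_ev : forall f M p t, nr (nrmT T) f M -> tPD p -> ev (temb f) (tloc p t) = f t }.
Arguments tn {T}. Arguments tP {T}. Arguments tPD {T}. Arguments tloc {T}. Arguments temb {T}.
Arguments tJ {T}. Arguments tM {T}.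
Arguments t_slices {T}. Arguments t_J {T}. Arguments t_M {T}. Arguments t_emb_nr {T}. Arguments t_emb_ev {T}.

Definition talg_fun (T : R) (HT : 0 < T) : talg T.
Proof.
  refine (TAlg T alg_fun (nrmT T) unit (fun _ => True) (fun _ t => t) (fun f => f)
    (opJ T) (fun f _ => mean T f) _ _ _ _ _).
  - apply slices_fun.
  - apply lifts_fun, timeop_opJ, HT.
  - apply lifts_fun, timeop_mean, HT.
  - auto.
  - auto.
Defined.

Definition talg_ser (T : R) (HT : 0 < T) (A : talg T) (rho : R) (Hrho : 0 < rho) : talg T.
Proof.
  refine (TAlg T (ser A) (ser_nrm (tn A) rho Hrho) (R * tP A) (sPD (tPD A) rho) (sloc (tloc A))
    (fun f => lift (temb A f)) (smap (tJ A)) (smap (tM A)) _ _ _ _ _).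
  - apply slices_ser, t_slices.
  - apply (lifts_ser T); [apply t_slices | now apply timeop_opJ | apply t_J].
  - apply (lifts_ser T); [apply t_slices | now apply timeop_mean | apply t_M].
  - intros f M H. apply (nr_lift (tn A)). now apply (t_emb_nr A).
  - intros f M [h p] t H [_ Hp]. unfold sloc; simpl fst; simpl snd.
    rewrite (ev_lift (tn A)); [|now apply (t_slices A)]. now apply (t_emb_ev A f M).
Defined.

(** * Integral, differential and Fourier forms of the auxiliary system *)

Definition int_eq (T w1 : R) (g f : R -> R) (y : R) (beta B : R -> R) : Prop :=
  (forall t, beta t = y + (opJ T f t + w1 * opJ T (opJ T g) t)) /\
  (forall t, B t = opJ T g t + (- / w1) * mean T f).

(** [mu] is the defect in the equation for [B]: the auxiliary system yields [mu = mean T g], and the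
    true differential equations correspond to [mu = 0]. *)
Definition diff_eq (T w1 : R) (g f : R -> R) (y mu : R) (beta B : R -> R) : Prop :=
  (forall t, is_derive beta t (f t + w1 * B t)) /\
  (forall t, is_derive B t (g t - mu)) /\ mean T beta = y.

Section Equations.
Variables (q : Z) (w1 : R).
Hypothesis hq : (1 <= q)%Z.
Hypothesis hw1 : w1 <> 0.
Let T := period q.
Let HT : 0 < T := period_pos q hq.
Variables (g f : R -> R).
Hypothesis Hg : cper T g.
Hypothesis Hf : cper T f.

Lemma int_eq_cper y beta B : int_eq T w1 g f y beta B -> cper T beta /\ cper T B.
Proof.
  intros [H1 H2]. split.
  - apply (cper_ext T (fun t => y + (opJ T f t + w1 * opJ T (opJ T g) t))); [intros; now rewrite H1|].
    apply cper_plus; [apply cper_const|]. apply cper_plus; [now apply cper_opJ|].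
    now apply cper_scal, cper_opJ, cper_opJ.
  - apply (cper_ext T (fun t => opJ T g t + (- / w1) * mean T f)); [intros; now rewrite H2|].
    apply cper_plus; [now apply cper_opJ | apply cper_const].
Qed.

Lemma int_eq_diff_eq y beta B :
  int_eq T w1 g f y beta B -> diff_eq T w1 g f y (mean T g) beta B.
Proof.
  intros [H1 H2]. split; [|split].
  - intros t. apply (is_derive_ext (fun t => y + (opJ T f t + w1 * opJ T (opJ T g) t))); [intros; now rewrite H1|].
    evar_last.
    + apply (is_derive_plus (V := R_NormedModule)); [apply (is_derive_const (V := R_NormedModule))|].
      apply (is_derive_plus (V := R_NormedModule)); [now apply is_derive_opJ|].
      apply (is_derive_scal (opJ T (opJ T g))). apply is_derive_opJ. now apply cper_opJ.
    + rewrite H2, mean_opJ by auto. unfold plus, zero; simpl. Req. field. auto.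
  - intros t. apply (is_derive_ext (fun t => opJ T g t + (- / w1) * mean T f)); [intros; now rewrite H2|].
    evar_last.
    + apply (is_derive_plus (V := R_NormedModule)); [now apply is_derive_opJ|].
      apply (is_derive_const (V := R_NormedModule)).
    + unfold plus, zero; simpl. Req. ring.
  - replace beta with (fun t => y + (opJ T f t + w1 * opJ T (opJ T g) t))
      by (apply functional_extensionality; intros; now rewrite H1).
    assert (C1 := cper_opJ T HT f Hf). assert (C2 := cper_opJ T HT _ (cper_opJ T HT g Hg)).
    assert (C3 := cper_scal T w1 _ C2).
    rewrite (mean_plus T HT (fun _ => y) (fun t => opJ T f t + w1 * opJ T (opJ T g) t) (cper_const T y) (cper_plus T _ _ C1 C3)).
    rewrite (mean_plus T HT _ _ C1 C3), mean_const, mean_scal, !mean_opJ; auto; [ring|].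
    now apply cper_opJ.
Qed.

(** Periodicity restores the lost constants: the derivative of [beta] has mean 0, which fixes the
    mean of [B]. The defect [mu] drops out because [opJ] annihilates constants. *)
Lemma diff_eq_int_eq y mu beta B : cper T beta -> cper T B ->
  diff_eq T w1 g f y mu beta B -> int_eq T w1 g f y beta B.
Proof.
  intros Cb CB [H1 [H2 H3]].
  assert (Cfb : cper T (fun t => f t + w1 * B t)) by (apply cper_plus; auto; now apply cper_scal).
  assert (Cg : cper T (fun t => g t + - mu)) by (apply cper_plus; auto; apply cper_const).
  assert (E1 : forall t, B t = opJ T g t + mean T B).
  { intros t. rewrite (opJ_of_derive T HT B (fun t => g t + - mu) CB Cg H2).
    rewrite (opJ_plus T HT g (fun _ => - mu) t Hg (cper_const T _)), opJ_const by auto. ring. }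
  assert (E2 : mean T B = - / w1 * mean T f).
  { assert (X := mean_of_derive T HT beta _ Cb Cfb H1).
    rewrite mean_plus, mean_scal in X; auto; [|now apply cper_scal].
    apply Rmult_eq_reg_l with w1; auto. transitivity (- mean T f); [lra|]. field. auto. }
  split.
  - intros t. rewrite (opJ_of_derive T HT beta _ Cb Cfb H1 t), H3.
    rewrite (opJ_plus T HT f (fun t => w1 * B t)); auto; [|now apply cper_scal].
    rewrite opJ_scal by auto.
    replace B with (fun t => opJ T g t + mean T B) at 1
      by (apply functional_extensionality; intros; now rewrite <- E1).
    rewrite (opJ_plus T HT (opJ T g) (fun _ => mean T B)); [|now apply cper_opJ|apply cper_const].
    rewrite opJ_const by auto. ring.
  - intros t. now rewrite <- E2.
Qed.

Definition four_eq (y : R) (beta B : R -> R) : Prop :=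
  let D := fun nu : Z => (Ci * RtoC (IZR nu / IZR q))%C in
  fourier q beta 0 = RtoC y /\
  (forall nu, nu <> 0%Z ->
     fourier q beta nu = (fourier q f nu / D nu + RtoC w1 * (fourier q g nu / (D nu * D nu)))%C) /\
  (forall nu, nu <> 0%Z -> fourier q B nu = (fourier q g nu / D nu)%C) /\
  fourier q B 0 = (- (fourier q f 0 / RtoC w1))%C.

Lemma mode_neq_0 nu : nu <> 0%Z -> Cmult Ci (RtoC (IZR nu / IZR q)) <> RtoC 0.
Proof.
  intros Hnu. assert (Hq := IZR_q_pos q hq). assert (Hn : IZR nu <> 0) by now apply not_0_IZR.
  unfold Cmult, Ci, RtoC; simpl. intros X. injection X. intros X1 _.
  apply Hn. apply Rmult_eq_reg_r with (/ IZR q); [|apply Rinv_neq_0_compat; lra].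
  unfold Rdiv in X1. lra.
Qed.

Lemma int_eq_four_eq y beta B : int_eq T w1 g f y beta B -> four_eq y beta B.
Proof.
  intros HI. assert (HI' := int_eq_diff_eq y beta B HI). destruct HI' as [_ [_ Hm]].
  destruct HI as [H1 H2].
  assert (C1 := cper_opJ T HT f Hf). assert (Cg := cper_opJ T HT g Hg).
  assert (C2 := cper_opJ T HT _ Cg). assert (C3 := cper_scal T w1 _ C2).
  split; [|split; [|split]].
  - rewrite fourier_0 by auto. fold T. now rewrite Hm.
  - intros nu Hnu.
    replace beta with (fun t => (opJ T f t + w1 * opJ T (opJ T g) t) + y * 1)
      by (apply functional_extensionality; intros; rewrite H1; ring).
    rewrite (fourier_lin q hq (fun t => opJ T f t + w1 * opJ T (opJ T g) t) (fun _ => 1) y nu); [|now apply cper_plus|apply cper_const].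
    rewrite (fourier_lin q hq (opJ T f) (opJ T (opJ T g)) w1 nu); auto.
    rewrite fourier_const by auto. unfold T. rewrite !fourier_opJ; auto.
    assert (HD := mode_neq_0 nu Hnu). set (D := Cmult Ci (RtoC (IZR nu / IZR q))) in *. clearbody D.
    field. exact HD.
  - intros nu Hnu.
    replace B with (fun t => opJ T g t + (- / w1 * mean T f) * 1)
      by (apply functional_extensionality; intros; rewrite H2; ring).
    rewrite (fourier_lin q hq (opJ T g) (fun _ => 1)); auto; [|apply cper_const].
    rewrite fourier_const by auto. unfold T. rewrite fourier_opJ; auto. ring.
  - rewrite !fourier_0 by auto. fold T.
    replace B with (fun t => opJ T g t + (- / w1 * mean T f))
      by (apply functional_extensionality; intros; now rewrite H2).
    rewrite (mean_plus T HT (opJ T g) (fun _ => - / w1 * mean T f)); auto; [|apply cper_const].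
    rewrite mean_opJ, mean_const by auto. rewrite <- RtoC_div by auto. rewrite <- RtoC_opp. f_equal. field. auto.
Qed.

(** The integral formulas define a periodic pair with the Fourier coefficients prescribed by
    [four_eq], so [fourier_unique] identifies it with the given one. *)
Lemma four_eq_int_eq y beta B : cper T beta -> cper T B -> four_eq y beta B -> int_eq T w1 g f y beta B.
Proof.
  intros Cb CB [E1 [E2 [E3 E4]]].
  set (beta' := fun t => y + (opJ T f t + w1 * opJ T (opJ T g) t)).
  set (B' := fun t => opJ T g t + (- / w1) * mean T f).
  assert (HI : int_eq T w1 g f y beta' B') by (split; auto).
  destruct (int_eq_cper y beta' B' HI) as [Cb' CB'].
  destruct (int_eq_four_eq y beta' B' HI) as [F1 [F2 [F3 F4]]].
  split.
  - apply (fourier_unique q hq beta beta'); auto. intros nu.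
    destruct (Z.eq_dec nu 0) as [->|Hn]; [now rewrite E1, F1 | now rewrite E2, F2].
  - apply (fourier_unique q hq B B'); auto. intros nu.
    destruct (Z.eq_dec nu 0) as [->|Hn]; [now rewrite E4, F4 | now rewrite E3, F3].
Qed.
End Equations.

Definition expands (F : R -> R -> R -> R) (w A0 t0 T : R) (c : nat -> nat -> R -> R) (r K : R) : Prop :=
  (forall i j, nr (nrmT T) (c i j) (K / r ^ (i + j))) /\
  (forall t u v, Rabs u < r -> Rabs v < r ->
     F (w * t + u) (A0 + v) (t + t0) = PSeries (fun i => PSeries (fun j => c i j t) v) u).

(** The explicit factor [v * v] matters: for [B = eps * Bh] the remainder has order 2 in [eps], so
    dividing Phi by [eps] still leaves a factor [eps] for the formal contraction. *)
Definition expands_om (om : R -> R) (A0 : R) (w2 : nat -> R) (r K : R) : Prop :=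
  (forall k, Rabs (w2 k) <= K / r ^ k) /\
  (forall v, Rabs v < r -> om (A0 + v) - om A0 - Derive om A0 * v = v * v * PSeries w2 v).

Section Aux.
Variables (om : R -> R) (A0 : R) (q : Z).
Hypothesis hq : (1 <= q)%Z.
Let w1 := Derive om A0.
Hypothesis hw1 : w1 <> 0.
Let T := period q.
Let HT : 0 < T := period_pos q hq.
Variables (w2 : nat -> R) (r K : R).
Hypothesis hr : 0 < r.
Hypothesis Hw2 : expands_om om A0 w2 r K.
Variables (F G : R -> R -> R -> R) (t0 : R) (Fc Gc : nat -> nat -> R -> R).
Hypothesis HF : expands F (om A0) A0 t0 T Fc r K.
Hypothesis HG : expands G (om A0) A0 t0 T Gc r K.

Lemma K_nonneg : 0 <= K.
Proof. assert (X := nr_pos _ _ _ (proj1 HF O O)). simpl in X. lra. Qed.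

Section Generic.
Context (A : talg T).
Variable Y : ser A.

Let lifted (c : nat -> nat -> R -> R) : nat -> nat -> ser A := fun i j => lift (temb A (c i j)).

(** The unknowns are [(beta - Y) / eps] and [B / eps]. *)
Definition aux_beta (u : ser A * ser A) : ser A := add Y (sh (fst u)).
Definition aux_B (u : ser A * ser A) : ser A := sh (snd u).
Definition aux_G (u : ser A * ser A) : ser A := comp2 (lifted Gc) (aux_beta u) (aux_B u).
Definition aux_F (u : ser A * ser A) : ser A :=
  add (comp2 (lifted Fc) (aux_beta u) (aux_B u))
      (sh (mul (mul (snd u) (snd u)) (comp1 (fun k => cst (w2 k)) (aux_B u)))).
Definition aux_map (u : ser A * ser A) : ser A * ser A :=
  (add (smap (tJ A) (aux_F u)) (mul (cst w1) (smap (tJ A) (smap (tJ A) (aux_G u)))),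
   add (smap (tJ A) (aux_G u)) (mul (cst (- / w1)) (smap (tM A) (aux_F u)))).

(** The unknowns enter the forcing terms only behind an [sh], and the quadratic term of [aux_F] is
    itself behind one, so one order is gained. The operators [tJ] and [tM] act coefficientwise and
    preserve it. *)
Lemma aux_map_cong n u v : cong2 n u v -> cong2 (S n) (aux_map u) (aux_map v).
Proof.
  intros [H1 H2].
  assert (Cb : cong (S n) (aux_beta u) (aux_beta v)) by (apply cong_add; [apply cong_refl | now apply cong_sh]).
  assert (CB : cong (S n) (aux_B u) (aux_B v)) by now apply cong_sh.
  assert (CG : cong (S n) (aux_G u) (aux_G v)) by exact (cong_comp2 (S n) (lifted Gc) _ _ _ _ Cb CB).
  assert (CF : cong (S n) (aux_F u) (aux_F v)).
  { apply cong_add; [exact (cong_comp2 (S n) (lifted Fc) _ _ _ _ Cb CB)|]. apply cong_sh. apply cong_mul; [now apply cong_mul|].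
    apply cong_comp1; [intros; apply cong_refl|]. exact (cong_le (S n) n _ _ (Nat.le_succ_diag_r n) CB). }
  split; (apply cong_add; [|try (apply cong_mul; [apply cong_refl|])]).
  - exact (cong_map (tJ A) (S n) _ _ CF).
  - exact (cong_map (tJ A) (S n) _ _ (cong_map (tJ A) (S n) _ _ CG)).
  - exact (cong_map (tJ A) (S n) _ _ CG).
  - exact (cong_map (tM A) (S n) _ _ CF).
Qed.

Variables (rho : R) (Hrho : 0 < rho) (MY M : R).
Let SA := talg_ser T HT A rho Hrho.
Hypothesis HY : nr (tn SA) Y MY.
Hypothesis Hsmall : MY + rho * M <= r / 2.

Variable u : ser A * ser A.
Hypothesis Hu1 : nr (tn SA) (fst u) M.
Hypothesis Hu2 : nr (tn SA) (snd u) M.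

Lemma MY_nonneg : 0 <= MY.
Proof. apply (nr_pos _ _ _ HY). Qed.

Lemma nr_aux_beta : nr (tn SA) (aux_beta u) (MY + rho * M).
Proof. apply nr_add; auto. apply (nr_sh (tn A)); [exact Hu1 | lra]. Qed.

Lemma nr_aux_B : nr (tn SA) (aux_B u) (rho * M).
Proof. apply (nr_sh (tn A)); [exact Hu2 | lra]. Qed.

Lemma nr_lifted F' c : expands F' (om A0) A0 t0 T c r K -> forall i j, nr (tn SA) (lifted c i j) (K / r ^ (i + j)).
Proof. intros [H _] i j. apply (t_emb_nr SA (c i j)). apply H. Qed.

Lemma rhoM_small : rho * M <= r / 2.
Proof. assert (X := MY_nonneg). lra. Qed.

Lemma nr_aux_comp F' c : expands F' (om A0) A0 t0 T c r K ->
  nr (tn SA) (comp2 (lifted c) (aux_beta u) (aux_B u)) (4 * K).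
Proof.
  intros H. apply (nr_comp2 (tn SA) _ _ _ r K (MY + rho * M) (rho * M)); auto using nr_aux_beta, nr_aux_B, rhoM_small.
  apply (nr_lifted F' c H).
Qed.

Lemma nr_aux_W : nr (tn SA) (comp1 (fun k => cst (w2 k)) (aux_B u)) (2 * K).
Proof.
  apply (nr_comp1 (tn SA) _ _ r K (rho * M)); auto using nr_aux_B, rhoM_small.
  intros k. apply (nr_le _ _ (Rabs (w2 k))); [apply nr_cst | apply (proj1 Hw2)].
Qed.

Lemma nr_aux_F : nr (tn SA) (aux_F u) (4 * K + rho * (M * M * (2 * K))).
Proof.
  apply nr_add; [exact (nr_aux_comp F Fc HF)|]. apply (nr_sh (tn A)); [|lra].
  apply (nr_mul (tn SA)); [now apply (nr_mul (tn SA)) | apply nr_aux_W].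
Qed.

Lemma nr_aux_G : nr (tn SA) (aux_G u) (4 * K).
Proof. exact (nr_aux_comp G Gc HG). Qed.

Lemma nr_aux_map :
  nr (tn SA) (fst (aux_map u)) (4 * T * (4 * K + rho * (M * M * (2 * K))) + Rabs w1 * (4 * T * (4 * T * (4 * K)))) /\
  nr (tn SA) (snd (aux_map u)) (4 * T * (4 * K) + Rabs (- / w1) * (1 * (4 * K + rho * (M * M * (2 * K))))).
Proof.
  assert (H1 := nr_aux_F). assert (H2 := nr_aux_G).
  split; apply nr_add.
  - exact (proj1 (t_J SA) _ _ H1).
  - apply nr_scal. exact (proj1 (t_J SA) _ _ (proj1 (t_J SA) _ _ H2)).
  - exact (proj1 (t_J SA) _ _ H2).
  - apply nr_scal. exact (proj1 (t_M SA) _ _ H1).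
Qed.

Section Eval.
Variables (x : R) (p : tP A).
Hypothesis Hx : Rabs x <= rho.
Hypothesis Hp : tPD A p.
Variable y : R.
Hypothesis Hy : forall t, ev Y (tloc SA (x, p) t) = y.

Let P : tP SA := (x, p).
Let HP : tPD SA P := conj Hx Hp.
Let Hdom t : dom (tn SA) (tloc SA P t) := proj1 (t_slices SA) P t HP.

Definition sol_beta (t : R) : R := y + x * ev (fst u) (tloc SA P t).
Definition sol_B (t : R) : R := x * ev (snd u) (tloc SA P t).

Lemma ev_aux_beta t : ev (aux_beta u) (tloc SA P t) = sol_beta t.
Proof.
  unfold aux_beta. rewrite (ev_add (tn SA) _ _ MY (rho * M)); auto.
  - rewrite Hy. unfold sol_beta. f_equal. apply (ev_sh (tn A) rho _ M); auto. apply (proj1 (t_slices A)); auto.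
  - apply (nr_sh (tn A)); [exact Hu1 | lra].
Qed.

Lemma ev_aux_B t : ev (aux_B u) (tloc SA P t) = sol_B t.
Proof.
  unfold aux_B, sol_B. apply (ev_sh (tn A) rho _ M); auto. apply (proj1 (t_slices A)); auto.
Qed.

Lemma sol_beta_small t : Rabs (sol_beta t) <= r / 2.
Proof.
  rewrite <- ev_aux_beta. eapply Rle_trans; [apply (ev_bound (tn SA)); auto using nr_aux_beta | exact Hsmall].
Qed.

Lemma sol_B_small t : Rabs (sol_B t) <= r / 2.
Proof.
  rewrite <- ev_aux_B. eapply Rle_trans; [apply (ev_bound (tn SA)); auto using nr_aux_B | exact rhoM_small].
Qed.

Lemma ev_lifted F' c i j t : expands F' (om A0) A0 t0 T c r K -> ev (lifted c i j) (tloc SA P t) = c i j t.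
Proof. intros [H _]. apply (t_emb_ev SA (c i j) _ P t (H i j) HP). Qed.

Lemma ev_aux_comp F' c t : expands F' (om A0) A0 t0 T c r K ->
  ev (comp2 (lifted c) (aux_beta u) (aux_B u)) (tloc SA P t) = F' (om A0 * t + sol_beta t) (A0 + sol_B t) (t + t0).
Proof.
  intros H. rewrite (ev_comp2 (tn SA) _ _ _ r K (MY + rho * M) (rho * M)); auto using nr_aux_beta, nr_aux_B, rhoM_small.
  - rewrite ev_aux_beta, ev_aux_B. rewrite (proj2 H).
    + apply PSeries_ext; intros i. apply PSeries_ext; intros j. now apply (ev_lifted F').
    + assert (X := sol_beta_small t). lra.
    + assert (X := sol_B_small t). lra.
  - apply (nr_lifted F' c H).
Qed.

Lemma ev_aux_G t : x * ev (aux_G u) (tloc SA P t) = Gamma G om A0 t0 x sol_beta sol_B t.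
Proof. unfold aux_G. now rewrite (ev_aux_comp G). Qed.

Lemma ev_aux_F t : x * ev (aux_F u) (tloc SA P t) = Phi F om A0 t0 x sol_beta sol_B t.
Proof.
  unfold aux_F.
  assert (HM : nr (tn SA) (mul (mul (snd u) (snd u)) (comp1 (fun k => cst (w2 k)) (aux_B u))) (M * M * (2 * K))).
  { apply (nr_mul (tn SA)); [now apply (nr_mul (tn SA)) | apply nr_aux_W]. }
  assert (HN1 := nr_aux_comp F Fc HF).
  assert (HN2 : nr (tn SA) (sh (mul (mul (snd u) (snd u)) (comp1 (fun k => cst (w2 k)) (aux_B u)))) (rho * (M * M * (2 * K)))).
  { apply (nr_sh (tn A)); [exact HM | lra]. }
  assert (E : ev (sh (mul (mul (snd u) (snd u)) (comp1 (fun k => cst (w2 k)) (aux_B u)))) (tloc SA P t)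
    = x * (ev (snd u) (tloc SA P t) * ev (snd u) (tloc SA P t) * PSeries w2 (sol_B t))).
  { transitivity (x * ev (mul (mul (snd u) (snd u)) (comp1 (fun k => cst (w2 k)) (aux_B u))) (tloc SA P t)).
    - apply (ev_sh (tn A) rho _ (M * M * (2 * K))); auto. apply (proj1 (t_slices A)); auto.
    - f_equal. etransitivity; [exact (ev_mul (tn SA) _ _ (M * M) (2 * K) _ (nr_mul (tn SA) _ _ _ _ Hu2 Hu2) nr_aux_W (Hdom t))|].
      apply (f_equal2 Rmult); [exact (ev_mul (tn SA) _ _ M M _ Hu2 Hu2 (Hdom t))|].
      etransitivity.
      + apply (ev_comp1 (tn SA) _ _ r K (rho * M)); [exact hr | | exact nr_aux_B | exact rhoM_small | exact (Hdom t)].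
        intros k. apply (nr_le _ _ (Rabs (w2 k))); [apply nr_cst | apply (proj1 Hw2)].
      + rewrite ev_aux_B. apply PSeries_ext. intros k. apply (ev_cst (tn SA)), Hdom. }
  assert (EA : ev (add (comp2 (lifted Fc) (aux_beta u) (aux_B u))
      (sh (mul (mul (snd u) (snd u)) (comp1 (fun k => cst (w2 k)) (aux_B u))))) (tloc SA P t)
    = F (om A0 * t + sol_beta t) (A0 + sol_B t) (t + t0)
      + x * (ev (snd u) (tloc SA P t) * ev (snd u) (tloc SA P t) * PSeries w2 (sol_B t))).
  { etransitivity; [exact (ev_add (tn SA) _ _ _ _ _ HN1 HN2 (Hdom t))|].
    apply (f_equal2 Rplus); [exact (ev_aux_comp F Fc t HF) | exact E]. }
  transitivity (x * (F (om A0 * t + sol_beta t) (A0 + sol_B t) (t + t0)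
      + x * (ev (snd u) (tloc SA P t) * ev (snd u) (tloc SA P t) * PSeries w2 (sol_B t)))); [f_equal; exact EA|].
  unfold Phi.
  assert (X := sol_B_small t).
  assert (Y' := proj2 Hw2 (sol_B t) ltac:(lra)).
  replace (x * F (om A0 * t + sol_beta t) (A0 + sol_B t) (t + t0) + om (A0 + sol_B t) - om A0 - Derive om A0 * sol_B t)
    with (x * F (om A0 * t + sol_beta t) (A0 + sol_B t) (t + t0) + (om (A0 + sol_B t) - om A0 - Derive om A0 * sol_B t)) by ring.
  rewrite Y'. unfold sol_B. ring.
Qed.

Let g := Gamma G om A0 t0 x sol_beta sol_B.
Let f := Phi F om A0 t0 x sol_beta sol_B.

Lemma cper_ev_G : cper T (fun t => ev (aux_G u) (tloc SA P t)).
Proof. apply (proj2 (t_slices SA) _ (4 * K)); auto using nr_aux_G. Qed.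

Lemma cper_ev_F : cper T (fun t => ev (aux_F u) (tloc SA P t)).
Proof. apply (proj2 (t_slices SA) _ _ _ nr_aux_F); auto. Qed.

Lemma cper_Gamma : cper T g.
Proof.
  apply (cper_ext T (fun t => x * ev (aux_G u) (tloc SA P t))); [apply ev_aux_G|].
  apply cper_scal, cper_ev_G.
Qed.

Lemma cper_Phi : cper T f.
Proof.
  apply (cper_ext T (fun t => x * ev (aux_F u) (tloc SA P t))); [apply ev_aux_F|].
  apply cper_scal, cper_ev_F.
Qed.

Lemma opJ_Gamma t : opJ T g t = x * opJ T (fun s => ev (aux_G u) (tloc SA P s)) t.
Proof.
  rewrite <- opJ_scal; [|exact HT|apply cper_ev_G].
  f_equal. apply functional_extensionality. intros s. symmetry. apply ev_aux_G.
Qed.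

Lemma opJ_Phi t : opJ T f t = x * opJ T (fun s => ev (aux_F u) (tloc SA P s)) t.
Proof.
  rewrite <- opJ_scal; [|exact HT|apply cper_ev_F].
  f_equal. apply functional_extensionality. intros s. symmetry. apply ev_aux_F.
Qed.

Lemma ev_aux_map1 t : x * ev (fst (aux_map u)) (tloc SA P t) = opJ T f t + w1 * opJ T (opJ T g) t.
Proof.
  assert (H1 := nr_aux_F). assert (H2 := nr_aux_G).
  assert (H3 := proj1 (t_J SA) _ _ H1). assert (H4 := proj1 (t_J SA) _ _ H2). assert (H5 := proj1 (t_J SA) _ _ H4).
  assert (E : ev (fst (aux_map u)) (tloc SA P t) = opJ T (fun s => ev (aux_F u) (tloc SA P s)) t
    + w1 * opJ T (opJ T (fun s => ev (aux_G u) (tloc SA P s))) t).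
  { etransitivity; [exact (ev_add (tn SA) _ _ _ _ _ H3 (nr_scal (tn SA) w1 _ _ H5) (Hdom t))|].
    apply (f_equal2 Rplus); [exact (proj2 (t_J SA) _ _ P t H1 HP)|].
    etransitivity; [exact (ev_scal (tn SA) w1 _ _ _ H5 (Hdom t))|]. f_equal.
    etransitivity; [exact (proj2 (t_J SA) _ _ P t H4 HP)|].
    apply (f_equal (fun h => opJ T h t)). apply functional_extensionality. intros s.
    exact (proj2 (t_J SA) _ _ P s H2 HP). }
  rewrite E, opJ_Phi.
  replace (opJ T g) with (fun t => x * opJ T (fun s => ev (aux_G u) (tloc SA P s)) t)
    by (apply functional_extensionality; intros s; now rewrite opJ_Gamma).
  rewrite opJ_scal; [ring|exact HT|apply cper_opJ; [exact HT|apply cper_ev_G]].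
Qed.

Lemma ev_aux_map2 t : x * ev (snd (aux_map u)) (tloc SA P t) = opJ T g t + (- / w1) * mean T f.
Proof.
  assert (H1 := nr_aux_F). assert (H2 := nr_aux_G).
  assert (H3 := proj1 (t_M SA) _ _ H1). assert (H4 := proj1 (t_J SA) _ _ H2).
  assert (E : ev (snd (aux_map u)) (tloc SA P t) = opJ T (fun s => ev (aux_G u) (tloc SA P s)) t
    + (- / w1) * mean T (fun s => ev (aux_F u) (tloc SA P s))).
  { etransitivity; [exact (ev_add (tn SA) _ _ _ _ _ H4 (nr_scal (tn SA) (- / w1) _ _ H3) (Hdom t))|].
    apply (f_equal2 Rplus); [exact (proj2 (t_J SA) _ _ P t H2 HP)|].
    etransitivity; [exact (ev_scal (tn SA) (- / w1) _ _ _ H3 (Hdom t))|]. f_equal.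
    exact (proj2 (t_M SA) _ _ P t H1 HP). }
  rewrite E, opJ_Gamma.
  replace (mean T f) with (x * mean T (fun s => ev (aux_F u) (tloc SA P s))); [ring|].
  rewrite <- mean_scal; [|exact HT|apply cper_ev_F]. f_equal.
  apply functional_extensionality. intros s. apply ev_aux_F.
Qed.

Lemma fixpoint_int_eq : aux_map u = u -> int_eq T w1 g f y sol_beta sol_B.
Proof.
  intros H. split; intros t.
  - rewrite <- ev_aux_map1, H. reflexivity.
  - rewrite <- ev_aux_map2, H. reflexivity.
Qed.
End Eval.
End Generic.

End Aux.

(** * Existence of a solution of the auxiliary system *)

Lemma nrmT_le T (f : R -> R) r K r' K' n : 0 < r' <= r -> 0 <= K <= K' ->
  nr (nrmT T) f (K / r ^ n) -> nr (nrmT T) f (K' / r' ^ n).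
Proof.
  intros Hr HK H. apply (nr_le _ _ _ _ H). apply Rle_trans with (K / r' ^ n); [now apply div_pow_le|].
  apply Rmult_le_compat_r; [left; apply Rinv_0_lt_compat, pow_lt|]; lra.
Qed.

Lemma expands_mono F w A0 t0 T c r K r' K' : 0 < r' <= r -> 0 <= K <= K' ->
  expands F w A0 t0 T c r K -> expands F w A0 t0 T c r' K'.
Proof.
  intros Hr HK [H1 H2]. split.
  - intros i j. now apply (nrmT_le T _ r K).
  - intros t u v Hu Hv. apply H2; lra.
Qed.

Lemma analytic_second_order (om : R -> R) (A0 : R) : analytic_at om A0 ->
  exists w2 r K, 0 < r /\ 0 <= K /\ expands_om om A0 w2 r K.
Proof.
  intros [a [d [Hd Ha]]].
  assert (Hex : ex_series (fun k => a k * (d / 2) ^ k)).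
  { exists (om (A0 + d / 2)). apply is_pseries_R, Ha. rewrite Rabs_pos_eq; lra. }
  assert (Hb : exists K, forall k, Rabs (a k) * (d / 2) ^ k <= K).
  { apply ex_series_lim_0 in Hex. apply is_lim_seq_spec in Hex.
    destruct (Hex (mkposreal 1 Rlt_0_1)) as [N HN]. simpl in HN.
    exists (1 + sum_f_R0 (fun k => Rabs (a k) * (d / 2) ^ k) N).
    assert (Hp : forall k, 0 <= Rabs (a k) * (d / 2) ^ k).
    { intros k. apply Rmult_le_pos; [apply Rabs_pos | apply pow_le; lra]. }
    intros k. destruct (Nat.le_gt_cases k N) as [Hk|Hk].
    - assert (X : Rabs (a k) * (d / 2) ^ k <= sum_f_R0 (fun k => Rabs (a k) * (d / 2) ^ k) N); [|lra].
      clear -Hk Hp. induction N as [|N IH]; simpl.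
      + replace k with O by lia. simpl. lra.
      + destruct (Nat.eq_dec k (S N)) as [->|Hne].
        * assert (X := cond_pos_sum _ N Hp). simpl in *. lra.
        * specialize (IH ltac:(lia)). specialize (Hp (S N)). simpl in Hp. lra.
    - assert (X := HN k ltac:(lia)). rewrite Rminus_0_r, Rabs_mult, (Rabs_pos_eq ((d / 2) ^ k)) in X by (apply pow_le; lra).
      assert (Y := cond_pos_sum _ N Hp). lra. }
  destruct Hb as [K HK].
  assert (HK0 : 0 <= K).
  { eapply Rle_trans; [|apply (HK O)]. simpl. rewrite Rmult_1_r. apply Rabs_pos. }
  assert (Hps : forall h, Rabs h < d -> om (A0 + h) = PSeries a h).
  { intros h Hh. symmetry. apply is_pseries_unique, Ha, Hh. }
  assert (Hcv : Rbar_lt 0 (CV_radius a)) by (apply (CV_radius_pos a (d / 2) K); auto; lra).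
  assert (H0 : om A0 = a O).
  { rewrite <- (Rplus_0_r A0) at 1. rewrite Hps, PSeries_0; auto. rewrite Rabs_R0; auto. }
  assert (H1 : Derive om A0 = a 1%nat).
  { replace (Derive om A0) with (Derive_n (fun h => om (h + A0)) 1 0).
    - rewrite (Derive_n_ext_loc _ (PSeries a)).
      + rewrite Derive_n_coef; auto. simpl. ring.
      + exists (mkposreal d Hd). intros h Hh. rewrite Rplus_comm. apply Hps.
        replace h with (h - 0) by ring. exact Hh.
    - rewrite (Derive_n_comp_trans om 1 0 A0). simpl. f_equal; ring. }
  exists (fun k => a (2 + k)%nat), (d / 4), (K / ((d / 2) * (d / 2))).
  assert (Hdd : 0 < (d / 2) * (d / 2)) by (apply Rmult_lt_0_compat; lra).
  split; [lra|]. split; [apply Rmult_le_pos; auto; left; now apply Rinv_0_lt_compat|]. split.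
  - intros k. assert (X := bound_div (a (2 + k)%nat) (d / 2) K (2 + k) ltac:(lra) (HK (2 + k)%nat)).
    rewrite div_pow_add in X by lra.
    eapply Rle_trans; [exact X|].
    replace ((d / 2) ^ 2) with (d / 2 * (d / 2)) by ring.
    apply div_pow_le; [|lra]. apply Rmult_le_pos; auto. left; now apply Rinv_0_lt_compat.
  - intros v Hv. rewrite Hps, H0, H1 by lra.
    assert (Hv' : ex_pseries a v) by (eexists; apply Ha; lra).
    rewrite PSeries_decr_1 by auto. rewrite PSeries_decr_1.
    + unfold PS_decr_1. replace (PSeries (fun n => a (S (S n))) v) with (PSeries (fun k => a (2 + k)%nat) v) by reflexivity. ring.
    + apply ex_pseries_decr_1; auto. destruct (Req_dec v 0) as [->|Hn]; [now left|right].
      exists (/ v). apply (Rinv_l v Hn).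
Qed.

Lemma nrmT_small T (c : coeffs) r K eta : 0 < r -> (forall k j, nr (nrmT T) (c k j) (K / r ^ (k + j))) ->
  (forall t, c O O t = 0) -> 0 < eta ->
  exists d, 0 < d /\ forall eps y t, Rabs eps <= d -> Rabs y <= d -> Rabs (sum_coeffs c eps y t) <= eta.
Proof.
  intros Hr Hc H0 Heta.
  assert (HK : 0 <= K). { assert (X := nr_pos _ _ _ (Hc O O)). simpl in X. lra. }
  destruct (small_radius r K eta Hr HK Heta) as [d [Hd Hs]].
  exists d. split; auto. intros eps y t He Hy.
  destruct (Hs d (conj Hd (Rle_refl d))) as [L1 L2].
  assert (N0 : nr (nrmT T) (c O O) 0).
  { apply nrmT_cper. split.
    - apply (cper_ext T (fun _ => 0)); [intros; now rewrite H0 | apply cper_const].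
    - intros s. rewrite H0, Rabs_R0. lra. }
  assert (X := nr_of_coef2 (nrmT T) r K 0 d Hd c Hr L1 N0 Hc).
  assert (Y := ev_bound (ser_nrm (ser_nrm (nrmT T) d Hd) d Hd) c _ (eps, (y, t)) X (conj He (conj Hy I))).
  eapply Rle_trans; [exact Y|]. lra.
Qed.

(** The substitution [eps = sg * s ^ N], [beta0 = phi s] is a [comp2] in the algebra of series in
    [s] over periodic functions of time; periodicity and bounds of the coefficients [c k] are part
    of its norm. *)
Lemma fractional_substitution T (b : coeffs) r K phi sg N : 0 < r -> Rabs sg = 1 -> (1 <= N)%nat ->
  (forall k j, nr (nrmT T) (b k j) (K / r ^ (k + j))) -> analytic1 phi -> phi 0 = 0 ->
  exists (c : nat -> R -> R) (rho M : R), 0 < rho /\ (forall k, periodic T (c k)) /\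
    (forall k t, Rabs (c k t) * rho ^ k <= M) /\
    (forall s t, Rabs s < rho -> is_pseries (fun k => c k t) s (sum_coeffs b (sg * s ^ N) (phi s) t)).
Proof.
  intros Hr Hsg HN Hb Hphi Hphi0.
  destruct (analytic1_expansion phi Hphi) as [f [rf [Kf [Hrf [Hf Hpf]]]]].
  assert (HKf : 0 <= Kf). { specialize (Hf O). simpl in Hf. assert (X := Rabs_pos (f O)). lra. }
  assert (Hf0 : f O = 0).
  { rewrite <- Hphi0, Hpf by (rewrite Rabs_R0; auto). now rewrite PSeries_0. }
  destruct (small_radius rf Kf (r / 2) Hrf HKf ltac:(lra)) as [d [Hd Hs]].
  set (rho := Rmin d (Rmin 1 (r / 2))).
  assert (Hrho : 0 < rho) by (repeat apply Rmin_glb_lt; lra).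
  assert (L1 : rho <= d) by apply Rmin_l.
  assert (L2 : rho <= 1) by (eapply Rle_trans; [apply Rmin_r | apply Rmin_l]).
  assert (L3 : rho <= r / 2) by (eapply Rle_trans; [apply Rmin_r | apply Rmin_r]).
  destruct (Hs rho (conj Hrho L1)) as [L4 L5].
  set (S1 := ser_nrm (nrmT T) rho Hrho).
  set (v := (fun k _ => f k) : ser alg_fun).
  set (u := mul (cst sg) (pw (sh (cst 1)) N) : ser alg_fun).
  set (bb := fun k j => lift (b k j : alg_fun) : ser alg_fun).
  assert (HU : Rabs sg * (rho * 1) ^ N <= r / 2).
  { rewrite Hsg, Rmult_1_l, Rmult_1_r. apply Rle_trans with rho; auto.
    destruct N as [|N]; [lia|]. apply Rle_trans with (rho * 1); [|lra]. simpl.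
    apply Rmult_le_compat_l; [lra|]. rewrite <- (pow1 N). apply pow_incr. lra. }
  assert (Nu0 : nr S1 (pw (sh (cst 1)) N) ((rho * 1) ^ N)) by (apply (nr_pw S1); now apply (nr_var (nrmT T))).
  assert (Nu : nr S1 u (Rabs sg * (rho * 1) ^ N)) by now apply (nr_scal S1).
  assert (Nv : nr S1 v (0 + 2 * (rho / rf) * Kf)).
  { apply (ser_nr_of_bound (nrmT T)); auto; try lra.
    - unfold v. rewrite Hf0. apply (nr_0 (nrmT T)).
    - intros k. apply (nr_le _ _ (Rabs (f k))); [apply (nr_cst (nrmT T)) | apply Hf]. }
  assert (HV : 0 + 2 * (rho / rf) * Kf <= r / 2).
  { assert (0 <= rho / rf * Kf) by (repeat apply Rmult_le_pos; try lra; left; now apply Rinv_0_lt_compat). lra. }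
  assert (Nb : forall k j, nr S1 (bb k j) (K / r ^ (k + j))) by (intros k j; now apply (nr_lift (nrmT T))).
  set (c := comp2 bb u v).
  assert (Nc : nr S1 c (4 * K)) by exact (nr_comp2 S1 bb u v r K _ _ Hr Nb Nu HU Nv HV).
  assert (Hc : forall k, cper T (c k) /\ forall t, Rabs (c k t) <= 4 * K / rho ^ k).
  { intros k. apply nrmT_cper. now apply (ser_nr_coef (nrmT T) rho c). }
  exists c, rho, (4 * K). split; [auto|split; [|split]].
  - intros k. apply (Hc k).
  - intros k t. apply bound_mul; auto. apply (Hc k).
  - intros s t Hs'. assert (Hs0 : Rabs s <= rho) by lra.
    assert (Hdom : dom S1 (s, t)) by (split; [exact Hs0 | exact I]).
    apply is_pseries_R.
    assert (E : ev c (s, t) = sum_coeffs b (sg * s ^ N) (phi s) t).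
    { etransitivity; [exact (ev_comp2 S1 bb u v r K _ _ (s, t) Hr Nb Nu HU Nv HV Hdom)|].
      assert (Eu : ev u (s, t) = sg * s ^ N).
      { etransitivity; [exact (ev_scal S1 sg _ _ (s, t) Nu0 Hdom)|]. f_equal.
        etransitivity; [exact (ev_pw S1 _ _ N (s, t) (nr_var (nrmT T) rho Hrho) Hdom)|].
        f_equal. apply (ev_var (nrmT T) rho); auto; exact I. }
      assert (Ev : ev v (s, t) = phi s).
      { rewrite Hpf by lra. reflexivity. }
      rewrite Eu, Ev. apply PSeries_ext; intros k. apply PSeries_ext; intros j.
      apply (ev_lift (nrmT T)). exact I. }
    rewrite <- E. exact (ser_is_pseries (nrmT T) rho c _ s t Nc Hs0 I).
Qed.

Section Setting.
Variables (W : R -> Prop) (om : R -> R) (F G : R -> R -> R -> R) (A0 : R) (p q : Z).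
Hypothesis hW : open W.
Hypothesis hom : forall A, W A -> analytic_at om A.
Hypothesis hF : analytic_forcing W F.
Hypothesis hG : analytic_forcing W G.
Hypothesis hA0 : W A0.
Hypothesis hq : (1 <= q)%Z.
Hypothesis hres : om A0 = IZR p / IZR q.
Hypothesis hom' : Derive om A0 <> 0.
Let T := period q.
Let HT : 0 < T := period_pos q hq.
Let w1 := Derive om A0.

Lemma aux_data t0 : exists w2 r K Fc Gc, 0 < r /\ (forall v, Rabs v < r -> W (A0 + v)) /\
  expands_om om A0 w2 r K /\ expands F (om A0) A0 t0 T Fc r K /\ expands G (om A0) A0 t0 T Gc r K.
Proof.
  destruct (analytic_second_order om A0 (hom A0 hA0)) as [w2 [r1 [K1 [Hr1 [HK1 H1]]]]].
  destruct (forcing_expand W F A0 t0 (om A0) p q hW hF hA0 hq hres) as [Fc [r2 [K2 [Hr2 [F1 F2]]]]].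
  destruct (forcing_expand W G A0 t0 (om A0) p q hW hG hA0 hq hres) as [Gc [r3 [K3 [Hr3 [G1 G2]]]]].
  destruct (hW A0 hA0) as [r4 H4].
  assert (HK2 : 0 <= K2). { assert (X := nr_pos _ _ _ (F1 O O)). simpl in X. lra. }
  assert (HK3 : 0 <= K3). { assert (X := nr_pos _ _ _ (G1 O O)). simpl in X. lra. }
  assert (Hr4 := cond_pos r4).
  set (r := Rmin (Rmin r1 r2) (Rmin r3 r4)).
  assert (Hr : 0 < r) by (repeat apply Rmin_glb_lt; auto).
  assert (L1 : r <= r1) by (eapply Rle_trans; apply Rmin_l).
  assert (L2 : r <= r2) by (eapply Rle_trans; [apply Rmin_l | apply Rmin_r]).
  assert (L3 : r <= r3) by (eapply Rle_trans; [apply Rmin_r | apply Rmin_l]).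
  assert (L4 : r <= r4) by (eapply Rle_trans; [apply Rmin_r | apply Rmin_r]).
  exists w2, r, (K1 + K2 + K3), Fc, Gc. split; [|split; [|split; [|split]]]; auto.
  - intros v Hv. apply H4. change (Rabs (A0 + v - A0) < r4). replace (A0 + v - A0) with v by ring. lra.
  - destruct H1 as [H1 H1']. split.
    + intros k. apply Rle_trans with (K1 / r ^ k).
      * eapply Rle_trans; [apply H1 | apply div_pow_le; lra].
      * apply Rmult_le_compat_r; [left; apply Rinv_0_lt_compat, pow_lt|]; lra.
    + intros v Hv. apply H1'. lra.
  - apply (expands_mono _ _ _ _ _ _ r2 K2); [lra|lra|now split].
  - apply (expands_mono _ _ _ _ _ _ r3 K3); [lra|lra|now split].
Qed.

Definition Gam t0 (b a : coeffs) eps y : R -> R :=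
  Gamma G om A0 t0 eps (sum_coeffs b eps y) (sum_coeffs a eps y).
Definition Phf t0 (b a : coeffs) eps y : R -> R :=
  Phi F om A0 t0 eps (sum_coeffs b eps y) (sum_coeffs a eps y).

(** [g k j] is the coefficient of [eps ^ k * beta0 ^ j] in the mean of Gamma. The order-zero fields
    say that at [eps = 0] the solution is [beta = beta0], [B = 0]. *)
Record regular (t0 : R) (b a : coeffs) (g : nat -> nat -> R) (r K : R) : Prop := {
  reg_r : 0 < r;
  reg_b : forall k j, nr (nrmT T) (b k j) (K / r ^ (k + j));
  reg_a : forall k j, nr (nrmT T) (a k j) (K / r ^ (k + j));
  reg_g : forall k j, Rabs (g k j) <= K / r ^ (k + j);
  reg_b0 : forall j t, b O j t = match j with 1%nat => 1 | _ => 0 end;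
  reg_a0 : forall j t, a O j t = 0;
  reg_g0 : forall j, g O j = 0;
  reg_eq : forall eps y, Rabs eps < r -> Rabs y < r ->
    (forall t, W (A0 + sum_coeffs a eps y t)) /\
    cper T (Gam t0 b a eps y) /\ cper T (Phf t0 b a eps y) /\
    int_eq T w1 (Gam t0 b a eps y) (Phf t0 b a eps y) y (sum_coeffs b eps y) (sum_coeffs a eps y) /\
    mean T (Gam t0 b a eps y) = PSeries (fun k => PSeries (g k) y) eps }.

Arguments reg_r {t0 b a g r K}. Arguments reg_b {t0 b a g r K}. Arguments reg_a {t0 b a g r K}.
Arguments reg_g {t0 b a g r K}. Arguments reg_b0 {t0 b a g r K}. Arguments reg_a0 {t0 b a g r K}.
Arguments reg_g0 {t0 b a g r K}. Arguments reg_eq {t0 b a g r K}.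

Lemma regular_exists t0 : exists b a g r K, regular t0 b a g r K.
Proof.
  destruct (aux_data t0) as [w2 [r [K [Fc [Gc [Hr [HWr [Hw2 [HF HG]]]]]]]]].
  assert (HK := K_nonneg _ _ _ _ _ _ _ _ HF).
  set (C := Rabs w1). set (D := Rabs (- / w1)).
  assert (HC : 0 <= C) by apply Rabs_pos. assert (HD : 0 <= D) by apply Rabs_pos.
  (* Dominates both bounds of [nr_aux_map] once [aux_F] has norm at most [6 * K]: [4 * K] from the
     forcing and [2 * K] allowed for the quadratic term. *)
  set (M := 4 * T * (6 * K) + C * (4 * T * (4 * T * (4 * K))) + 4 * T * (4 * K) + D * (6 * K) + 1).
  assert (P1 : 0 <= 4 * T * (6 * K)) by (apply Rmult_le_pos; lra).
  assert (P2 : 0 <= C * (4 * T * (4 * T * (4 * K)))) by (repeat (apply Rmult_le_pos; [lra|]); lra).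
  assert (P3 : 0 <= 4 * T * (4 * K)) by (apply Rmult_le_pos; lra).
  assert (P4 : 0 <= D * (6 * K)) by (apply Rmult_le_pos; lra).
  assert (EM : M = 4 * T * (6 * K) + C * (4 * T * (4 * T * (4 * K))) + 4 * T * (4 * K) + D * (6 * K) + 1)
    by reflexivity.
  clearbody M.
  assert (HM : 1 <= M) by lra.
  (* The first bound keeps [beta] and [B] within [r / 2]; the second gives [rho * (M * M) <= 1],
     which brings the quadratic term below [2 * K]. *)
  set (rho := Rmin (r / (8 * (M + 1))) (/ (M * M))).
  assert (HMM : 0 < M * M) by nra.
  assert (Hrho : 0 < rho).
  { apply Rmin_glb_lt; [apply Rdiv_lt_0_compat; lra | now apply Rinv_0_lt_compat]. }
  assert (R1 : rho * (M + 1) <= r / 8).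
  { apply Rle_trans with (r / (8 * (M + 1)) * (M + 1)).
    - apply Rmult_le_compat_r; [lra | apply Rmin_l].
    - right. field. lra. }
  assert (R2 : rho * (M * M) <= 1).
  { apply Rle_trans with (/ (M * M) * (M * M)).
    - apply Rmult_le_compat_r; [lra | apply Rmin_r].
    - right. field. lra. }
  (* [A1] consists of series in beta0 over functions of time; the outer series runs in [eps]. [Y] is
     beta0, constant in [eps] and in time. *)
  set (A1 := talg_ser T HT (talg_fun T HT) rho Hrho).
  set (Y := lift (sh (cst 1)) : ser A1).
  set (N1 := nrm_fun (fun _ => True) open_true T).
  assert (HY : forall s, ser_nr (tn A1) s Y (rho * 1)).
  { intros s. apply (nr_lift (tn A1)). now apply (nr_var (tn (talg_fun T HT))). }
  set (Psi := aux_map om A0 q w2 Fc Gc A1 Y).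
  destruct (formal_fixpoint Psi (fun n u v => aux_map_cong om A0 q w2 Fc Gc A1 Y n u v) (tn A1) rho M Hrho ltac:(lra))
    as [u [Hu [Hu1 Hu2]]].
  { intros u Hu1 Hu2.
    assert (X := nr_aux_map om A0 q hq w2 r K Hr Hw2 F G t0 Fc Gc HF HG A1 Y rho Hrho (rho * 1) M (HY rho) ltac:(lra) u Hu1 Hu2).
    destruct X as [X1 X2].
    assert (Q : rho * (M * M * (2 * K)) <= 2 * K).
    { replace (rho * (M * M * (2 * K))) with (rho * (M * M) * (2 * K)) by ring.
      rewrite <- (Rmult_1_l (2 * K)) at 2. apply Rmult_le_compat_r; lra. }
    fold T w1 C D in X1, X2.
    split.
    - apply (nr_le (ser_nrm (tn A1) rho Hrho) _ _ _ X1).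
      assert (4 * T * (4 * K + rho * (M * M * (2 * K))) <= 4 * T * (6 * K)) by (apply Rmult_le_compat_l; lra).
      lra.
    - apply (nr_le (ser_nrm (tn A1) rho Hrho) _ _ _ X2).
      assert (D * (1 * (4 * K + rho * (M * M * (2 * K)))) <= D * (6 * K)) by (apply Rmult_le_compat_l; lra).
      lra. }
  assert (Hrho2 : 0 < rho / 2) by lra.
  assert (Hsmall : rho * 1 + rho / 2 * (2 * M) <= r / 2) by lra.
  set (b := aux_beta q A1 Y u : coeffs). set (a := aux_B q A1 u : coeffs).
  (* Gamma is [eps] times [aux_G], hence the shift by one in the first index and the zero row. *)
  set (g := fun k j => match k with O => 0 | S k' => mean T (aux_G q Gc A1 Y u k' j) end).
  assert (Nb : ser_nr (tn A1) (rho / 2) b (rho * 1 + rho / 2 * (2 * M)))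
    by exact (nr_aux_beta q hq A1 Y (rho / 2) Hrho2 (rho * 1) (2 * M) (HY _) u Hu1).
  assert (Na : ser_nr (tn A1) (rho / 2) a (rho / 2 * (2 * M)))
    by exact (nr_aux_B q hq A1 (rho / 2) Hrho2 (2 * M) u Hu2).
  assert (Ng : ser_nr (tn A1) (rho / 2) (aux_G q Gc A1 Y u) (4 * K))
    by exact (nr_aux_G om A0 q hq r K Hr G t0 Gc HG A1 Y (rho / 2) Hrho2 (rho * 1) (2 * M) (HY _) Hsmall u Hu1 Hu2).
  set (SA := talg_ser T HT A1 (rho / 2) Hrho2).
  assert (NMg : nr (tn SA) (sh (smap (tM A1) (aux_G q Gc A1 Y u))) (rho / 2 * (1 * (4 * K)))).
  { apply (nr_sh (tn A1)); [|lra]. exact (proj1 (t_M SA) _ _ Ng). }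
  set (KK := (rho * 1 + rho / 2 * (2 * M)) + rho / 2 * (1 * (4 * K))).
  assert (Hp1 : 0 <= rho / 2 * (2 * M)) by (apply Rmult_le_pos; lra).
  assert (Hp2 : 0 <= rho / 2 * (1 * (4 * K))) by (apply Rmult_le_pos; lra).
  assert (Hgm : forall k j t, sh (smap (tM A1) (aux_G q Gc A1 Y u)) k j t = g k j).
  { intros [|k] j t; [destruct j; reflexivity | reflexivity]. }
  assert (HKKle : forall X k, X <= KK -> X / (rho / 2) ^ k <= KK / (rho / 2) ^ k).
  { intros X k HX. apply Rmult_le_compat_r; auto. left. apply Rinv_0_lt_compat, pow_lt; lra. }
  exists b, a, g, (rho / 2), KK. split.
  - lra.
  - intros k j. eapply nr_le; [apply (nr_coef2 (nrmT T) rho (rho / 2) (rho / 2) Hrho b _ Nb); lra|].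
    apply HKKle. unfold KK; lra.
  - intros k j. eapply nr_le; [apply (nr_coef2 (nrmT T) rho (rho / 2) (rho / 2) Hrho a _ Na); lra|].
    apply HKKle. unfold KK; lra.
  - intros k j. rewrite <- (Hgm k j 0).
    assert (X := nr_coef2 (nrmT T) rho (rho / 2) (rho / 2) Hrho _ _ NMg ltac:(lra) ltac:(lra) k j).
    apply nrmT_cper in X. destruct X as [_ X]. eapply Rle_trans; [apply (X 0)|].
    apply HKKle. unfold KK; lra.
  - intros [|[|j]] t; unfold b, aux_beta, Y; simpl; ring.
  - intros [|j] t; reflexivity.
  - reflexivity.
  - intros eps y Heps Hy.
    assert (Heps' : Rabs eps <= rho / 2) by lra.
    assert (Hpd : tPD A1 (y, tt)) by (split; [simpl; lra | exact I]).
    assert (HYy : forall t, ev Y (tloc SA (eps, (y, tt)) t) = y).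
    { intros t. transitivity (ev (a := ser alg_fun) (sh (cst 1)) (y, t)).
      - exact (ev_lift (tn A1) _ eps _ (proj1 (t_slices A1) _ t Hpd)).
      - apply (ev_var (nrmT T) rho); [lra | lra | exact I]. }
    assert (Eb : sum_coeffs b eps y = sol_beta q hq A1 (rho / 2) Hrho2 u eps (y, tt) y).
    { apply functional_extensionality. intros t.
      exact (ev_aux_beta q hq A1 Y (rho / 2) Hrho2 (rho * 1) (2 * M) (HY _) u Hu1 eps (y, tt) Heps' Hpd y HYy t). }
    assert (Ea : sum_coeffs a eps y = sol_B q hq A1 (rho / 2) Hrho2 u eps (y, tt)).
    { apply functional_extensionality. intros t.
      exact (ev_aux_B q hq A1 (rho / 2) Hrho2 (2 * M) u Hu2 eps (y, tt) Heps' Hpd t). }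
    unfold Gam, Phf. rewrite Eb, Ea.
    split; [|split; [|split; [|split]]].
    + intros t. apply HWr.
      assert (X := sol_B_small q hq r A1 Y (rho / 2) Hrho2 (rho * 1) (2 * M) (HY _) Hsmall u Hu2 eps (y, tt) Heps' Hpd t).
      lra.
    + exact (cper_Gamma om A0 q hq r K Hr G t0 Gc HG A1 Y (rho / 2) Hrho2 (rho * 1) (2 * M) (HY _) Hsmall u Hu1 Hu2 eps (y, tt) Heps' Hpd y HYy).
    + exact (cper_Phi om A0 q hq w2 r K Hr Hw2 F t0 Fc HF A1 Y (rho / 2) Hrho2 (rho * 1) (2 * M) (HY _) Hsmall u Hu1 Hu2 eps (y, tt) Heps' Hpd y HYy).
    + exact (fixpoint_int_eq om A0 q hq w2 r K Hr Hw2 F G t0 Fc Gc HF HG A1 Y (rho / 2) Hrho2 (rho * 1) (2 * M) (HY _) Hsmall u Hu1 Hu2 eps (y, tt) Heps' Hpd y HYy Hu).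
    + assert (CG : cper T (fun t => ev (aux_G q Gc A1 Y u) (tloc SA (eps, (y, tt)) t))).
      { apply (proj2 (t_slices SA) _ (4 * K)); auto. split; auto. }
      transitivity (eps * mean T (fun t => ev (aux_G q Gc A1 Y u) (tloc SA (eps, (y, tt)) t))).
      { rewrite <- mean_scal by auto. f_equal. apply functional_extensionality. intros t. symmetry.
        exact (ev_aux_G om A0 q hq r K Hr G t0 Gc HG A1 Y (rho / 2) Hrho2 (rho * 1) (2 * M) (HY _) Hsmall u Hu1 Hu2 eps (y, tt) Heps' Hpd y HYy t). }
      assert (X := proj2 (t_M SA) (aux_G q Gc A1 Y u) (4 * K) (eps, (y, tt)) 0 Ng (conj Heps' Hpd)).
      transitivity (eps * ev (tM SA (aux_G q Gc A1 Y u)) (tloc SA (eps, (y, tt)) 0)); [f_equal; symmetry; exact X|].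
      transitivity (ev (sh (smap (tM A1) (aux_G q Gc A1 Y u))) (tloc SA (eps, (y, tt)) 0)).
      { symmetry. apply (ev_sh (tn A1) (rho / 2) _ (1 * (4 * K))); auto.
        exact (proj1 (t_M SA) _ _ Ng). }
      apply PSeries_ext; intros k. apply PSeries_ext; intros j. apply Hgm.
Qed.

(** * Time shifts and Melnikov functions *)

Lemma regular_aux_solution t0 b a g r K :
  regular t0 b a g r K -> aux_solution W F G om A0 q t0 (b, a).
Proof.
  intros [Hr Hb Ha _ Hb0 Ha0 _ Heq].
  assert (Hb' := fun k j => proj1 (nrmT_cper T _ _) (Hb k j)).
  assert (Ha' := fun k j => proj1 (nrmT_cper T _ _) (Ha k j)).
  split; [|split; [|split; [|split]]].
  - intros k j. split; [apply (Hb' k j) | apply (Ha' k j)].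
  - intros k j t. split; [apply (Hb' k j) | apply (Ha' k j)].
  - intros j nu Hnu.
    replace (b O j) with (fun _ : R => match j with 1%nat => 1 | _ => 0 end)
      by (apply functional_extensionality; intros; now rewrite Hb0).
    now apply fourier_const.
  - intros j nu.
    replace (a O j) with (fun _ : R => 0) by (apply functional_extensionality; intros; now rewrite Ha0).
    destruct (Z.eq_dec nu 0) as [->|Hn]; [|now apply fourier_const].
    rewrite fourier_0, mean_const; auto.
  - exists r, K. split; [|split]; auto.
    + intros k j t. split; apply bound_mul; auto; [apply (Hb' k j) | apply (Ha' k j)].
    + intros eps y Heps Hy. destruct (Heq eps y Heps Hy) as [H1 [H2 [H3 [H4 _]]]].
      split; auto. exact (int_eq_four_eq q w1 hq hom' _ _ H2 H3 y _ _ H4).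
Qed.

Definition psum (c : nat -> R -> R) (eps t : R) : R := PSeries (fun k => c k t) eps.

(** A solution on the slice beta0 = 0, as a series in [eps] alone. The integral equations are
    conditional on [cper] because [aux_solution] does not assert it of Gamma and Phi, and the
    passage from Fourier coefficients needs it. *)
Definition family (t0 : R) (cb ca : nat -> R -> R) : Prop :=
  exists r K d, 0 < r /\ 0 < d /\
    (forall k, nr (nrmT T) (cb k) (K / r ^ k)) /\ (forall k, nr (nrmT T) (ca k) (K / r ^ k)) /\
    (forall t, cb O t = 0) /\ (forall t, ca O t = 0) /\
    forall eps, Rabs eps < d ->
      let g := Gamma G om A0 t0 eps (psum cb eps) (psum ca eps) in
      let f := Phi F om A0 t0 eps (psum cb eps) (psum ca eps) in
      cper T g -> cper T f -> int_eq T w1 g f 0 (psum cb eps) (psum ca eps).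

(** Divided by [eps], a convergent solution is a formal fixed point of [aux_map] with [Y = 0]: the
    equations hold for every small [eps], and equal sums have equal coefficients. Formal fixed
    points are unique. *)
Lemma family_unique t0 cb ca cb' ca' : family t0 cb ca -> family t0 cb' ca' -> cb = cb' /\ ca = ca'.
Proof.
  destruct (aux_data t0)
    as [w2 [r [K [Fc [Gc [Hr [HWr [Hw2 [HF HG]]]]]]]]].
  fold T in HF, HG.
  set (A1 := talg_fun T HT). set (Y := cst 0 : ser A1).
  set (Psi := aux_map om A0 q w2 Fc Gc A1 Y).
  assert (Hshift : forall c : nat -> R -> R, (forall t, c O t = 0) -> sh (A := alg_fun) (fun k => c (S k)) = c).
  { intros c Hc. apply functional_extensionality. intros [|k]; auto.
    apply functional_extensionality. intros t. simpl. now rewrite Hc. }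
  assert (main : forall cb ca, family t0 cb ca -> Psi (fun k => cb (S k), fun k => ca (S k)) = (fun k => cb (S k), fun k => ca (S k))).
  { clear cb ca cb' ca'. intros cb ca (r1 & K1 & d & Hr1 & Hd & Hb & Ha & Hb0 & Ha0 & Heq).
    set (u := (fun k => cb (S k), fun k => ca (S k)) : ser A1 * ser A1).
    assert (HK1 : 0 <= K1). { assert (X := nr_pos _ _ _ (Hb O)). simpl in X. lra. }
    set (K2 := K1 / r1).
    assert (HK2 : 0 <= K2) by (apply Rmult_le_pos; auto; left; now apply Rinv_0_lt_compat).
    set (M := 2 * K2).
    set (rho := Rmin (Rmin (r1 / 2) (d / 2)) (r / (2 * (M + 1)))).
    assert (HM : 0 <= M) by (unfold M; lra).
    assert (Hq1 : 0 < r / (2 * (M + 1))) by (apply Rdiv_lt_0_compat; lra).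
    assert (Hrho : 0 < rho) by (repeat apply Rmin_glb_lt; lra).
    assert (L1 : rho <= r1 / 2) by (eapply Rle_trans; apply Rmin_l).
    assert (L2 : rho <= d / 2) by (eapply Rle_trans; [apply Rmin_l | apply Rmin_r]).
    assert (L3 : rho * M <= r / 2).
    { apply Rle_trans with (r / (2 * (M + 1)) * (M + 1)); [|right; field; lra].
      apply Rmult_le_compat; try lra. apply Rmin_r. }
    assert (Hn : forall c : nat -> R -> R, (forall k, nr (nrmT T) (c k) (K1 / r1 ^ k)) -> ser_nr (nrmT T) rho (fun k => c (S k)) M).
    { intros c Hc.
      assert (Hc' : forall k, nr (nrmT T) (c (S k)) (K2 / r1 ^ k)).
      { intros k. apply (nr_le _ _ _ _ (Hc (S k))). right. unfold K2. simpl. field. split; [lra|]. apply Rgt_not_eq, pow_lt; lra. }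
      apply (nr_le (ser_nrm (nrmT T) rho Hrho) _ (K2 + 2 * (rho / r1) * K2)).
      - apply (ser_nr_of_bound (nrmT T)); [lra | lra | | exact Hc'].
        apply (nr_le _ _ _ _ (Hc' O)). right. simpl. field.
      - assert (rho / r1 <= 1 / 2).
        { apply Rmult_le_reg_r with r1; auto. unfold Rdiv at 1. rewrite Rmult_assoc, Rinv_l by lra. lra. }
        unfold M. nra. }
    set (SA := talg_ser T HT A1 rho Hrho).
    assert (Hu1 : nr (tn SA) (fst u) M) by exact (Hn cb Hb).
    assert (Hu2 : nr (tn SA) (snd u) M) by exact (Hn ca Ha).
    assert (HY : nr (tn SA) Y 0) by exact (nr_0 (tn SA)).
    assert (Hsmall : 0 + rho * M <= r / 2) by lra.
    destruct (nr_aux_map om A0 q hq w2 r K Hr Hw2 F G t0 Fc Gc HF HG A1 Y rho Hrho 0 M HY Hsmall u Hu1 Hu2) as [N1 N2].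
    match type of N1 with nr _ _ ?m => set (M1 := m) in N1 end.
    match type of N2 with nr _ _ ?m => set (M2 := m) in N2 end.
    assert (HYy : forall x, Rabs x <= rho -> forall t, ev Y (tloc SA (x, tt) t) = 0).
    { intros x Hx t. apply (ev_cst (tn SA)). split; [exact Hx | exact I]. }
    assert (Hev : forall x t (c : nat -> R -> R), (forall t, c O t = 0) -> ser_nr (nrmT T) rho (fun k => c (S k)) M -> Rabs x <= rho ->
       x * ev (a := ser alg_fun) (fun k => c (S k)) (x, t) = psum c x t).
    { intros x t c Hc0 Hc Hx. rewrite <- (ev_sh (nrmT T) rho _ M x t Hc Hx I), (Hshift c Hc0). reflexivity. }
    assert (Hall : forall x t, Rabs x <= rho ->
       psum cb x t = ev (sh (fst (Psi u))) (tloc SA (x, tt) t) /\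
       psum ca x t = ev (sh (snd (Psi u))) (tloc SA (x, tt) t)).
    { intros x t Hx.
      assert (Eb : sol_beta q hq A1 rho Hrho u x tt 0 = psum cb x).
      { apply functional_extensionality. intros s. unfold sol_beta. rewrite Rplus_0_l. now apply Hev; [|apply Hn|]. }
      assert (Ea : sol_B q hq A1 rho Hrho u x tt = psum ca x).
      { apply functional_extensionality. intros s. now apply Hev; [|apply Hn|]. }
      assert (CG := cper_Gamma om A0 q hq r K Hr G t0 Gc HG A1 Y rho Hrho 0 M HY Hsmall u Hu1 Hu2 x tt Hx I 0 (HYy x Hx)).
      assert (CF := cper_Phi om A0 q hq w2 r K Hr Hw2 F t0 Fc HF A1 Y rho Hrho 0 M HY Hsmall u Hu1 Hu2 x tt Hx I 0 (HYy x Hx)).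
      assert (E1 := ev_aux_map1 om A0 q hq w2 r K Hr Hw2 F G t0 Fc Gc HF HG A1 Y rho Hrho 0 M HY Hsmall u Hu1 Hu2 x tt Hx I 0 (HYy x Hx) t).
      assert (E2 := ev_aux_map2 om A0 q hq w2 r K Hr Hw2 F G t0 Fc Gc HF HG A1 Y rho Hrho 0 M HY Hsmall u Hu1 Hu2 x tt Hx I 0 (HYy x Hx) t).
      rewrite Eb, Ea in CG, CF, E1, E2.
      destruct (Heq x ltac:(lra) CG CF) as [I1 I2].
      split.
      - rewrite I1, Rplus_0_l. symmetry. etransitivity; [|exact E1].
        apply (ev_sh (nrmT T) rho _ M1 x t N1 Hx I).
      - rewrite I2. symmetry. etransitivity; [|exact E2].
        apply (ev_sh (nrmT T) rho _ M2 x t N2 Hx I). }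
    assert (Hcoef : forall (c : nat -> R -> R) (d : ser alg_fun) MM, (forall k, nr (nrmT T) (c k) (K1 / r1 ^ k)) ->
       ser_nr (nrmT T) rho d MM ->
       (forall x t, Rabs x <= rho -> psum c x t = PSeries (fun k => sh d k t) x) -> forall k t, c (S k) t = d k t).
    { intros c e MM Hc He H k t.
      assert (Hs := nr_sh (nrmT T) rho e MM He ltac:(lra)).
      apply (PSeries_coef_unique (fun k => c k t) (fun k => sh e k t) rho K1 (rho * MM) rho); auto.
      - intros j. apply Rle_trans with (Rabs (c j t) * r1 ^ j).
        + apply Rmult_le_compat_l; [apply Rabs_pos|]. apply pow_incr; lra.
        + apply bound_mul; auto. apply (proj1 (nrmT_cper T _ _) (Hc j)).
      - intros j. apply bound_mul; auto.
        apply (proj1 (nrmT_cper T _ _) (ser_nr_coef (nrmT T) rho (sh e) (rho * MM) j Hrho Hs)).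
      - intros x Hx. apply (H x t). lra. }
    rewrite (surjective_pairing (Psi u)). unfold u at 3.
    f_equal; apply functional_extensionality; intros k; apply functional_extensionality; intros t; symmetry.
    - apply (Hcoef cb (fst (Psi u)) M1 Hb N1). intros x s Hx. apply (Hall x s Hx).
    - apply (Hcoef ca (snd (Psi u)) M2 Ha N2). intros x s Hx. apply (Hall x s Hx). }
  intros H1 H2.
  assert (E := formal_fixpoint_unique Psi (aux_map_cong om A0 q w2 Fc Gc A1 Y) _ _ (main _ _ H1) (main _ _ H2)).
  destruct H1 as (? & ? & ? & _ & _ & _ & _ & Z1 & Z2 & _).
  destruct H2 as (? & ? & ? & _ & _ & _ & _ & Z3 & Z4 & _).
  injection E. intros E1 E2.
  rewrite <- (Hshift cb Z1), <- (Hshift cb' Z3), <- (Hshift ca Z2), <- (Hshift ca' Z4).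
  split; f_equal; assumption.
Qed.

Lemma family_aux_solution t0 b a :
  aux_solution W F G om A0 q t0 (b, a) -> family t0 (fun k => b k O) (fun k => a k O).
Proof.
  intros (H1 & H2 & H3 & H4 & r & K & Hr & HB & Heq).
  assert (Cb : forall k, cper T (b k O)) by (intros k; split; [intros t; apply (H2 k O t) | apply (H1 k O)]).
  assert (Ca : forall k, cper T (a k O)) by (intros k; split; [intros t; apply (H2 k O t) | apply (H1 k O)]).
  assert (Es : forall (c : coeffs) eps, sum_coeffs c eps 0 = psum (fun k => c k O) eps).
  { intros c eps. apply functional_extensionality. intros t. apply PSeries_ext. intros k. apply PSeries_0. }
  assert (Hz : forall f, cper T f -> (forall nu, fourier q f nu = RtoC 0) -> forall t, f t = 0).
  { intros f Hf Hz. apply (fourier_unique q hq f (fun _ => 0)); auto; [apply cper_const|].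
    intros nu. rewrite Hz. destruct (Z.eq_dec nu 0) as [->|Hn].
    - rewrite fourier_0, mean_const; auto.
    - symmetry. now apply fourier_const. }
  assert (Hpc : forall (c : coeffs), (forall k, cper T (c k O)) -> (forall k j t, Rabs (c k j t) * r ^ (k + j) <= K) ->
    forall k, nr (nrmT T) (c k O) (K / r ^ k)).
  { intros c Cc Hc k. apply nrmT_cper. split; auto. intros t. apply bound_div; auto.
    specialize (Hc k O t). now rewrite Nat.add_0_r in Hc. }
  assert (Nb := Hpc b Cb (fun k j t => proj1 (HB k j t))).
  assert (Na := Hpc a Ca (fun k j t => proj2 (HB k j t))).
  exists r, K, (r / 2). split; [exact Hr|]. split; [lra|]. split; [exact Nb|]. split; [exact Na|]. split; [|split].
  (* The nonzero modes of [b 0 0] vanish by assumption; its mean is read from the equation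
     [fourier q beta 0 = beta0] at [eps = 0], [beta0 = 0]. *)
  - apply Hz; auto. intros nu. destruct (Z.eq_dec nu 0) as [->|Hn]; auto.
    destruct (Heq 0 0) as [_ [E _]]; try (rewrite Rabs_R0; auto).
    rewrite Es in E. rewrite <- E at 1. f_equal. apply functional_extensionality. intros t.
    unfold psum. now rewrite PSeries_0.
  - apply Hz; auto.
  - intros eps Heps g f Cg Cf.
    destruct (Heq eps 0) as [_ E]; try (rewrite Rabs_R0; lra); [lra|].
    rewrite !Es in E.
    assert (Cs : forall c : nat -> R -> R, (forall k, nr (nrmT T) (c k) (K / r ^ k)) -> cper T (psum c eps)).
    { intros c Hc.
      assert (Hs : ser_nr (nrmT T) (r / 2) c (K / r ^ 0 + 2 * (r / 2 / r) * K)).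
      { apply (ser_nr_of_bound (nrmT T)); auto; lra. }
      exact (proj2 (slices_ser T (nrmT T) (fun _ => True) (fun _ t => t : pt alg_fun) (r / 2) ltac:(lra) (slices_fun T))
        c _ (eps, tt) Hs (conj (Rlt_le _ _ Heps) I)). }
    exact (four_eq_int_eq q w1 hq hom' g f Cg Cf 0 _ _ (Cs _ Nb) (Cs _ Na) E).
Qed.

Lemma ser_ev_cper (c : nat -> R -> R) (r K y : R) :
  0 < r -> (forall j, nr (nrmT T) (c j) (K / r ^ j)) -> Rabs y <= r / 2 ->
  nr (nrmT T) (fun t => PSeries (fun j => c j t) y) (2 * K).
Proof.
  intros Hr Hc Hy.
  assert (HK : 0 <= K). { assert (X := nr_pos _ _ _ (Hc O)). simpl in X. lra. }
  assert (Hs : ser_nr (nrmT T) (r / 2) c (K / r ^ 0 + 2 * (r / 2 / r) * K)).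
  { apply (ser_nr_of_bound (nrmT T)); auto; lra. }
  apply nrmT_cper. split.
  - exact (proj2 (slices_ser T (nrmT T) (fun _ => True) (fun _ t => t : pt alg_fun) (r / 2) ltac:(lra) (slices_fun T))
      c _ (y, tt) Hs (conj Hy I)).
  - intros t.
    assert (X := ev_bound (ser_nrm (nrmT T) (r / 2) ltac:(lra)) c _ (y, t) Hs (conj Hy I)).
    eapply Rle_trans; [exact X|]. right. simpl. field. lra.
Qed.

Section Shift.
Variables (t0 : R) (b a : coeffs) (g : nat -> nat -> R) (r K s : R).
Hypothesis Hreg : regular t0 b a g r K.
Let y := - (om A0) * s.
Hypothesis Hy : Rabs y <= r / 2.

(** The shifted [beta] gains the constant [om A0 * s], which cancels the order-zero term [y];
    coefficient 0 is therefore 0. *)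
Let cb (k : nat) (t : R) : R := match k with O => 0 | _ => PSeries (fun j => b k j (t + s)) y end.
Let ca (k : nat) (t : R) : R := match k with O => 0 | _ => PSeries (fun j => a k j (t + s)) y end.

Lemma shift_slice_nr (c : coeffs) k : (forall k j, nr (nrmT T) (c k j) (K / r ^ (k + j))) ->
  nr (nrmT T) (fun t => PSeries (fun j => c k j t) y) (2 * K / r ^ k).
Proof.
  intros Hc. assert (Hr := reg_r Hreg).
  replace (2 * K / r ^ k) with (2 * (K / r ^ k)) by (unfold Rdiv; ring).
  apply (ser_ev_cper (c k) r (K / r ^ k) y); auto.
  intros j. rewrite <- div_pow_add; auto.
Qed.

Lemma shift_nr (c : coeffs) k : (forall k j, nr (nrmT T) (c k j) (K / r ^ (k + j))) ->
  nr (nrmT T) (fun t => match k with O => 0 | _ => PSeries (fun j => c k j (t + s)) y end) (2 * K / r ^ k).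
Proof.
  intros Hc. assert (X := shift_slice_nr c k Hc).
  assert (X0 := nr_pos _ _ _ X).
  apply nrmT_cper in X. destruct X as [X1 X2]. apply nrmT_cper. destruct k as [|k].
  - split; [apply cper_const|]. intros t. now rewrite Rabs_R0.
  - split; [now apply (cper_shift T (fun t => PSeries (fun j => c (S k) j t) y)) | intros t; apply (X2 (t + s))].
Qed.

Lemma sum_coeffs_slice (c : coeffs) eps t : (forall k j, nr (nrmT T) (c k j) (K / r ^ (k + j))) -> Rabs eps <= r / 2 ->
  sum_coeffs c eps y (t + s) = PSeries (fun j => c O j (t + s)) y +
    psum (fun k t => match k with O => 0 | _ => PSeries (fun j => c k j (t + s)) y end) eps t.
Proof.
  intros Hc Heps. assert (Hr := reg_r Hreg).
  unfold sum_coeffs, psum.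
  rewrite PSeries_decr_1.
  - f_equal. rewrite (PSeries_decr_1_aux (fun k => match k with O => 0 | _ => _ end)); auto.
  - assert (X : is_series (fun k => PSeries (fun j => c k j (t + s)) y * eps ^ k) (sum_coeffs c eps y (t + s))).
    { apply (PSeries_bound (fun k => PSeries (fun j => c k j (t + s)) y) r (2 * K) eps); auto.
      intros k. apply bound_mul; auto.
      apply (proj1 (nrmT_cper T _ _) (shift_slice_nr c k Hc)). }
    exists (sum_coeffs c eps y (t + s)). now apply is_pseries_R.
Qed.

Lemma psum_cb eps t : Rabs eps <= r / 2 -> psum cb eps t = sum_coeffs b eps y (t + s) + om A0 * s.
Proof.
  intros Heps. rewrite (sum_coeffs_slice b eps t (reg_b Hreg) Heps).
  assert (E : PSeries (fun j => b O j (t + s)) y = y).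
  { rewrite (PSeries_ext _ (fun j => match j with 1%nat => 1 | _ => 0 end)) by (intros j; apply (reg_b0 Hreg)).
    rewrite PSeries_decr_1_aux by reflexivity. rewrite PSeries_R.
    rewrite (is_series_unique _ (1 * y ^ 0)); [simpl; ring|].
    apply (is_series_first (fun n => match S n with 1%nat => 1 | _ => 0 end * y ^ n)). intros k. ring. }
  rewrite E. change (psum cb eps t = y + psum cb eps t + om A0 * s).
  assert (Ey : y = - om A0 * s) by reflexivity. lra.
Qed.

Lemma psum_ca eps t : Rabs eps <= r / 2 -> psum ca eps t = sum_coeffs a eps y (t + s).
Proof.
  intros Heps. rewrite (sum_coeffs_slice a eps t (reg_a Hreg) Heps).
  assert (E : PSeries (fun j => a O j (t + s)) y = 0).
  { rewrite (PSeries_ext _ (fun j => 0)) by (intros j; apply (reg_a0 Hreg)).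
    apply PSeries_const_0. }
  rewrite E. change (psum ca eps t = 0 + psum ca eps t). ring.
Qed.

Lemma shift_Gamma eps : Rabs eps <= r / 2 ->
  Gamma G om A0 (t0 + s) eps (psum cb eps) (psum ca eps) = (fun t => Gam t0 b a eps y (t + s)).
Proof.
  intros Heps. apply functional_extensionality. intros t. unfold Gam, Gamma.
  rewrite psum_cb, psum_ca by auto. f_equal. f_equal; ring.
Qed.

Lemma shift_Phi eps : Rabs eps <= r / 2 ->
  Phi F om A0 (t0 + s) eps (psum cb eps) (psum ca eps) = (fun t => Phf t0 b a eps y (t + s)).
Proof.
  intros Heps. apply functional_extensionality. intros t. unfold Phf, Phi.
  rewrite psum_cb, psum_ca by auto. do 3 f_equal. f_equal. f_equal; ring.
Qed.

(** A solution with phase [t0] and parameter [y], shifted in time by [s], is a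
    solution with phase [t0 + s] and parameter [y + om A0 * s = 0]. *)
Lemma shift_family : family (t0 + s) cb ca.
Proof.
  assert (Hr := reg_r Hreg).
  exists r, (2 * K), (r / 2). split; [exact Hr|]. split; [lra|]. split; [|split; [|split; [|split]]].
  - intros k. apply shift_nr, (reg_b Hreg).
  - intros k. apply shift_nr, (reg_a Hreg).
  - reflexivity.
  - reflexivity.
  - intros eps Heps g' f' Cg Cf.
    destruct (reg_eq Hreg eps y ltac:(lra) ltac:(lra)) as [_ [C1 [C2 [HI _]]]].
    destruct (int_eq_cper q w1 hq _ _ C1 C2 y _ _ HI) as [Cb CB].
    destruct (int_eq_diff_eq q w1 hq hom' _ _ C1 C2 y _ _ HI) as [D1 [D2 D3]].
    assert (Eb : psum cb eps = fun t => sum_coeffs b eps y (t + s) + om A0 * s).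
    { apply functional_extensionality. intros t. apply psum_cb. lra. }
    assert (Ea : psum ca eps = fun t => sum_coeffs a eps y (t + s)).
    { apply functional_extensionality. intros t. apply psum_ca. lra. }
    assert (Cb' := cper_shift T _ s Cb). assert (CB' := cper_shift T _ s CB).
    apply (diff_eq_int_eq q w1 hq hom' g' f' Cg Cf 0 (mean T (Gam t0 b a eps y))).
    + rewrite Eb. apply cper_plus; auto. apply cper_const.
    + rewrite Ea. exact CB'.
    + unfold g', f'. rewrite shift_Gamma, shift_Phi by lra. rewrite Eb, Ea. split; [|split].
      * intros t. evar_last.
        -- apply (is_derive_plus (V := R_NormedModule)).
           ++ apply (is_derive_shift (sum_coeffs b eps y)), D1.
           ++ apply (is_derive_const (V := R_NormedModule)).
        -- unfold plus, zero; simpl. Req. ring.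
      * intros t. apply (is_derive_shift (sum_coeffs a eps y)), D2.
      * fold T. rewrite (mean_plus T HT _ (fun _ => om A0 * s) Cb' (cper_const T _)).
        rewrite mean_const by auto. rewrite (mean_shift T (sum_coeffs b eps y)) by auto.
        fold T in D3. rewrite D3. unfold y. ring.
Qed.

Lemma shift_mean eps : Rabs eps < r / 2 ->
  mean T (Gamma G om A0 (t0 + s) eps (psum cb eps) (psum ca eps)) = PSeries (fun k => PSeries (g k) y) eps.
Proof.
  intros Heps. assert (Hr := reg_r Hreg).
  rewrite shift_Gamma by lra.
  destruct (reg_eq Hreg eps y ltac:(lra) ltac:(lra)) as [_ [C1 [_ [_ E]]]].
  rewrite (mean_shift T (Gam t0 b a eps y)); auto.
Qed.

(** The solution selected by [aux_sol] at phase [t0 + s] and the shifted solution have the same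
    slice by [family_unique], hence the same mean of Gamma for small [eps]. One regular solution at
    [t0] thus describes the Melnikov functions near [t0]. *)
Lemma Melnikov_germ k : Melnikov W F G om A0 q k (t0 + s) = PSeries (g (S k)) y.
Proof.
  assert (Hr := reg_r Hreg).
  assert (HS : aux_solution W F G om A0 q (t0 + s) (aux_sol W F G om A0 q (t0 + s))).
  { unfold aux_sol. apply epsilon_spec.
    destruct (regular_exists (t0 + s)) as (b' & a' & g' & r' & K' & H').
    exists (b', a'). now apply (regular_aux_solution (t0 + s) b' a' g' r' K'). }
  unfold Melnikov, Gammabar_coeff.
  rewrite (Derive_n_ext_loc _ (PSeries (fun k => PSeries (g k) y))).
  - rewrite Derive_n_coef.
    + field. apply INR_fact_neq_0.
    + apply (CV_radius_pos _ r (2 * K)); auto. intros i. apply bound_mul; auto.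
      replace (2 * K / r ^ i) with (2 * (K / r ^ i)) by (unfold Rdiv; ring).
      apply (PSeries_bound (g i) r (K / r ^ i) y); auto.
      intros j. apply bound_mul; auto. rewrite <- div_pow_add by auto. apply (reg_g Hreg).
  - assert (Hr2 : 0 < r / 2) by lra. exists (mkposreal _ Hr2). intros eps Heps.
    assert (Heps' : Rabs eps < r / 2). { replace eps with (eps - 0) by ring. exact Heps. }
    rewrite <- shift_mean by auto.
    unfold Gammabar_mean, Gammabar. destruct (aux_sol W F G om A0 q (t0 + s)) as [b' a'].
    destruct (family_unique (t0 + s) _ _ _ _ (family_aux_solution _ _ _ HS) shift_family) as [Eb Ea].
    rewrite <- Eb, <- Ea. unfold mean. fold T.
    assert (Es : forall c : coeffs, sum_coeffs c eps 0 = psum (fun k => c k O) eps).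
    { intros c. apply functional_extensionality. intros t. apply PSeries_ext. intros i. apply PSeries_0. }
    simpl fst; simpl snd. now rewrite !Es.
Qed.
End Shift.

(** * The subharmonic solution *)

Hypothesis hp : p <> 0%Z.

Lemma om_neq_0 : om A0 <> 0.
Proof.
  rewrite hres. assert (Hq := IZR_q_pos q hq). apply Rmult_integral_contrapositive.
  split; [now apply not_0_IZR | apply Rinv_neq_0_compat; lra].
Qed.

Section Regular.
Variables (t0 : R) (b a : coeffs) (g : nat -> nat -> R) (r K : R).
Hypothesis Hreg : regular t0 b a g r K.

Lemma reg_r_pos : 0 < r.
Proof. apply (reg_r Hreg). Qed.

Lemma reg_row_bound k j : Rabs (g k j) * r ^ j <= K / r ^ k.
Proof.
  assert (Hr := reg_r_pos). apply bound_mul; auto.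
  rewrite <- div_pow_add by auto. apply (reg_g Hreg).
Qed.

Lemma Melnikov_series k t : Rabs (om A0 * (t - t0)) <= r / 2 ->
  Melnikov W F G om A0 q k t = PSeries (g (S k)) (- om A0 * (t - t0)).
Proof.
  intros Ht. replace t with (t0 + (t - t0)) at 1 by ring.
  apply (Melnikov_germ t0 b a g r K (t - t0) Hreg).
  replace (- om A0 * (t - t0)) with (- (om A0 * (t - t0))) by ring. now rewrite Rabs_Ropp.
Qed.

(** As [om A0] is nonzero, every small [y] is [- om A0 * (t - t0)] for some [t], so the series of
    the row vanishes near 0. *)
Lemma Melnikov_zero_row k : (forall t, Melnikov W F G om A0 q k t = 0) -> forall j, g (S k) j = 0.
Proof.
  intros H. assert (Hr := reg_r_pos). assert (Ho := om_neq_0).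
  apply (PSeries_coef_unique (g (S k)) (fun _ => 0) r (K / r ^ S k) 0 (r / 2) Hr ltac:(lra)).
  - apply reg_row_bound.
  - intros j. rewrite Rabs_R0. lra.
  - intros y Hy. rewrite PSeries_const_0, <- (H (t0 - y / om A0)), Melnikov_series.
    + f_equal. field. auto.
    + replace (om A0 * (t0 - y / om A0 - t0)) with (- y) by (field; auto). rewrite Rabs_Ropp. lra.
Qed.

(** The chain rule for [Melnikov_series]: orders of vanishing in the phase and in beta0 agree
    because [om A0] is nonzero. *)
Lemma Melnikov_Derive_n k j : Derive_n (Melnikov W F G om A0 q k) j t0 = (- om A0) ^ j * (g (S k) j * INR (fact j)).
Proof.
  assert (Hr := reg_r_pos). assert (Ho := om_neq_0).
  assert (Hcv : Rbar_lt 0 (CV_radius (g (S k)))) by (apply (CV_radius_pos _ r (K / r ^ S k) Hr), reg_row_bound).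
  set (f := fun u => PSeries (g (S k)) (- om A0 * u)).
  rewrite (Derive_n_ext_loc _ (fun t => f (t + - t0))).
  - etransitivity; [exact (Derive_n_comp_trans f j t0 (- t0))|]. replace (t0 + - t0) with 0 by ring.
    unfold f. rewrite Derive_n_comp_scal.
    + rewrite Rmult_0_r, Derive_n_coef; auto.
    + rewrite Rmult_0_r. exists (mkposreal r Hr). intros x Hx i _. apply ex_derive_n_PSeries.
      apply Rbar_lt_le_trans with r.
      * replace x with (x - 0) by ring. exact Hx.
      * apply (CV_radius_ge _ r (K / r ^ S k) Hr), reg_row_bound.
  - assert (Hd : 0 < r / (2 * Rabs (om A0))).
    { apply Rdiv_lt_0_compat; auto. assert (X := Rabs_pos_lt _ Ho). lra. }
    exists (mkposreal _ Hd). intros t Ht. unfold f. rewrite Melnikov_series; [reflexivity|].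
    rewrite Rabs_mult. assert (X := Rabs_pos_lt _ Ho).
    replace (r / 2) with (Rabs (om A0) * (r / (2 * Rabs (om A0)))) by (field; lra).
    apply Rmult_le_compat_l; [lra|]. left. exact Ht.
Qed.

(** [sg] is the sign of [eps] and [x] its absolute value, so each sign gets its own cofactor [h].
    Transposing the double series puts beta0 outermost, as [expansion] requires. *)
Lemma mean_factor sg kappa : Rabs sg = 1 -> (forall k j, (k <= kappa)%nat -> g k j = 0) ->
  exists h, expansion (fun j k => sg ^ k * g (S kappa + k)%nat j) r (K / r ^ S kappa) h /\
  forall x y, Rabs x <= r / 2 -> Rabs y <= r / 2 ->
    PSeries (fun k => PSeries (g k) y) (sg * x) = (sg * x) ^ S kappa * h x y.
Proof.
  intros Hsg Hz. assert (Hr := reg_r_pos).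
  set (c := fun j k => sg ^ k * g (S kappa + k)%nat j).
  assert (Hc : forall j k, Rabs (c j k) <= K / r ^ S kappa / r ^ (j + k)).
  { intros j k. unfold c. rewrite Rabs_mult, <- RPow_abs, Hsg, pow1, Rmult_1_l, <- div_pow_add by auto.
    replace (S kappa + (j + k))%nat with (S kappa + k + j)%nat by lia.
    apply (reg_g Hreg). }
  exists (fun x y => PSeries (fun j => PSeries (c j) x) y). split; [split; auto|].
  intros x y Hx Hy.
  rewrite (pseries_factor _ r (2 * K) (S kappa)); auto.
  - f_equal. rewrite (PSeries2_swap c r (K / r ^ S kappa)); auto.
    rewrite !PSeries_R. apply Series_ext. intros k. unfold c.
    assert (E : PSeries (fun j => sg ^ k * g (S kappa + k)%nat j) y = sg ^ k * PSeries (g (S kappa + k)%nat) y)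
      by apply PSeries_scal.
    rewrite E, Rpow_mult_distr. ring.
  - intros k. replace (2 * K / r ^ k) with (2 * (K / r ^ k)) by (unfold Rdiv; ring).
    apply (PSeries_bound (g k) r (K / r ^ k) y); auto. apply reg_row_bound.
  - intros k Hk. rewrite (PSeries_ext _ (fun _ => 0)); [apply PSeries_const_0|].
    intros j. apply Hz. lia.
  - rewrite Rabs_mult, Hsg. lra.
Qed.

(** When the mean of Gamma vanishes, [diff_eq] holds with [mu = 0], and the terms subtracted in Phi
    recombine with [om A0] and [Derive om A0 * B] into the full frequency. *)
Lemma regular_solution eps y : Rabs eps < r -> Rabs y < r -> PSeries (fun k => PSeries (g k) y) eps = 0 ->
  is_solution W F G om t0 eps (fun t => om A0 * t + sum_coeffs b eps y t) (fun t => A0 + sum_coeffs a eps y t) /\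
  periodic T (sum_coeffs b eps y) /\ periodic T (sum_coeffs a eps y).
Proof.
  intros Heps Hy Hz.
  destruct (reg_eq Hreg eps y Heps Hy) as [HWa [C1 [C2 [HI Hm]]]].
  rewrite Hz in Hm.
  destruct (int_eq_cper q (Derive om A0) hq _ _ C1 C2 y _ _ HI) as [Cb CB].
  destruct (int_eq_diff_eq q (Derive om A0) hq hom' _ _ C1 C2 y _ _ HI) as [D1 [D2 _]].
  fold T in D2. rewrite Hm in D2.
  split; [|split; [apply Cb | apply CB]].
  intros t. split; [apply HWa|]. split.
  - evar_last.
    + apply (is_derive_plus (V := R_NormedModule)); [|apply D1].
      apply (is_derive_scal (fun t => t)). apply (is_derive_id (K := R_AbsRing)).
    + unfold plus, one; simpl. unfold Phf, Phi. Req. ring.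
  - evar_last.
    + apply (is_derive_plus (V := R_NormedModule)); [apply (is_derive_const (V := R_NormedModule)) | apply D2].
    + unfold plus, zero; simpl. unfold Gam, Gamma. Req. ring.
Qed.
End Regular.
End Setting.

Theorem theorem4 (W : R -> Prop) (om : R -> R) (F G : R -> R -> R -> R)
    (A0 : R) (p q : Z)
    (hW : open W)
    (hom : forall A, W A -> analytic_at om A)
    (hF : analytic_forcing W F)
    (hG : analytic_forcing W G)
    (hA0 : W A0)
    (hpq : rel_prime p q) (hq : (1 <= q)%Z) (hp : p <> 0%Z)
    (hres : om A0 = IZR p / IZR q)
    (hom' : Derive om A0 <> 0)
    (kappa : nat)
    (hvanish : forall k', (k' < kappa)%nat ->
       forall t0, Melnikov W F G om A0 q k' t0 = 0)
    (t0 : R) (ht0 : 0 <= t0 < 2 * PI)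
    (n : nat) (hn : Nat.Odd n)
    (hzero : forall j, (j < n)%nat ->
       Derive_n (Melnikov W F G om A0 q kappa) j t0 = 0)
    (hnz : Derive_n (Melnikov W F G om A0 q kappa) n t0 <> 0) :
  exists al A : R -> R -> R,
    subharmonic_solution W F G om A0 q t0 al A /\
    fractional_power_series (period q) (fact n)
      (fun eps t => al eps t - om A0 * t) /\
    fractional_power_series (period q) (fact n) (fun eps t => A eps t - A0).
Proof.
  destruct (regular_exists W om F G A0 p q hW hom hF hG hA0 hq hres t0) as (b & a & g & r & K & Hreg).
  assert (Hreg' := Hreg). destruct Hreg' as [Hr Hb Ha _ Hb0 Ha0 Hg00 _].
  assert (Ho := om_neq_0 om A0 p q hq hres hp).
  assert (HD := Melnikov_Derive_n W om F G A0 p q hW hom hF hG hA0 hq hres hom' hp t0 b a g r K Hreg kappa).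
  assert (Hg0 : forall k j, (k <= kappa)%nat -> g k j = 0).
  { intros [|k] j Hk; [apply Hg00|].
    apply (Melnikov_zero_row W om F G A0 p q hW hom hF hG hA0 hq hres hom' hp t0 b a g r K Hreg k).
    intros t. apply hvanish. lia. }
  assert (Hpn : forall j, (- om A0) ^ j <> 0) by (intros j; apply pow_nonzero; lra).
  assert (Hrow : (forall j, (j < n)%nat -> g (S kappa) j = 0) /\ g (S kappa) n <> 0).
  { split.
    - intros j Hj. specialize (hzero j Hj). rewrite HD in hzero.
      apply Rmult_integral in hzero. destruct hzero as [E|E]; [now apply Hpn in E|].
      apply Rmult_integral in E. destruct E as [E|E]; auto. now apply INR_fact_neq_0 in E.
    - intros E. apply hnz. rewrite HD, E. ring. }
  set (N := fact n). assert (HN : (1 <= N)%nat) by apply lt_O_fact.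
  assert (Hbranch : forall sg, Rabs sg = 1 -> exists phi d, analytic1 phi /\ phi 0 = 0 /\ 0 < d /\
    forall s, Rabs s < d -> Rabs (phi s) < r /\ PSeries (fun k => PSeries (g k) (phi s)) (sg * s ^ N) = 0).
  { intros sg Hsg.
    destruct (mean_factor W om F G A0 q t0 b a g r K Hreg sg kappa Hsg Hg0) as [h [Hh1 Hh2]].
    destruct (puiseux_odd n _ _ _ h Hh1 hn) as (phi & d & P1 & P2 & Hd & P3).
    { intros j Hj. simpl pow. rewrite Nat.add_0_r, (proj1 Hrow) by auto. ring. }
    { simpl pow. rewrite Nat.add_0_r, Rmult_1_l. apply Hrow. }
    destruct (analytic1_small_lt phi (r / 2) P1 P2 ltac:(lra)) as [d1 [Hd1 D1]].
    destruct (analytic1_small_lt (fun s => s ^ N) (r / 2)) as [d2 [Hd2 D2]];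
      [apply analytic1_pow, analytic1_id | apply pow_ne_zero; lia | lra |].
    exists phi, (Rmin d (Rmin d1 d2)). split; [auto|split; [auto|split]].
    { repeat apply Rmin_glb_lt; auto. }
    intros s Hs.
    assert (X1 := Rlt_le_trans _ _ _ Hs (Rmin_l _ _)).
    assert (X2 := Rlt_le_trans _ _ _ Hs (Rle_trans _ _ _ (Rmin_r _ _) (Rmin_l _ _))).
    assert (X3 := Rlt_le_trans _ _ _ Hs (Rle_trans _ _ _ (Rmin_r _ _) (Rmin_r _ _))).
    specialize (D1 s X2). specialize (D2 s X3). split; [lra|].
    rewrite Hh2 by lra. unfold N. rewrite P3 by auto. ring. }
  destruct (Hbranch 1 Rabs_R1) as (f1 & d1 & A1 & Z1 & Hd1 & B1).
  destruct (Hbranch (-1)) as (f2 & d2 & A2 & Z2 & Hd2 & B2); [rewrite Rabs_left; lra|].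
  set (root := fun eps => Rpower (Rabs eps) (/ INR N)).
  (* The two signs use different branches. The value at 0 is set by hand because [root 0] is not
     0. *)
  set (phi := fun eps => match total_order_T eps 0 with
    | inleft (left _) => f2 (root eps) | inleft (right _) => 0 | inright _ => f1 (root eps) end).
  assert (Hneg : forall eps, eps < 0 -> phi eps = f2 (root eps) /\ eps = -1 * root eps ^ N).
  { intros eps He. unfold phi. destruct (total_order_T eps 0) as [[_|E]|E]; try lra. split; auto.
    unfold root. rewrite Rpower_root_pow; auto; [rewrite Rabs_left; lra | apply Rabs_pos_lt; lra]. }
  assert (Hpos : forall eps, 0 < eps -> phi eps = f1 (root eps) /\ eps = 1 * root eps ^ N).
  { intros eps He. unfold phi. destruct (total_order_T eps 0) as [[E|E]|_]; try lra. split; auto.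
    unfold root. rewrite Rpower_root_pow; auto; [rewrite Rabs_pos_eq; lra | apply Rabs_pos_lt; lra]. }
  assert (Hphi0 : phi 0 = 0).
  { unfold phi. destruct (total_order_T 0 0) as [[E|E]|E]; auto; lra. }
  assert (Hroot : forall eps d, eps <> 0 -> 0 < d -> Rabs eps < d ^ N -> Rabs (root eps) < d).
  { intros eps d He Hd Hlt. rewrite Rabs_pos_eq by (left; apply exp_pos).
    apply Rpower_root_lt; auto. now apply Rabs_pos_lt. }
  assert (Hphi : forall eta, 0 < eta -> exists d, 0 < d /\ forall eps, Rabs eps < d -> Rabs (phi eps) < eta).
  { intros eta Heta.
    destruct (analytic1_small_lt f1 eta A1 Z1 Heta) as [e1 [He1 E1]].
    destruct (analytic1_small_lt f2 eta A2 Z2 Heta) as [e2 [He2 E2]].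
    exists (Rmin (e1 ^ N) (e2 ^ N)). split; [apply Rmin_glb_lt; now apply pow_lt|].
    intros eps He.
    assert (X1 := Rlt_le_trans _ _ _ He (Rmin_l _ _)). assert (X2 := Rlt_le_trans _ _ _ He (Rmin_r _ _)).
    destruct (Rtotal_order eps 0) as [H|[->|H]].
    - rewrite (proj1 (Hneg eps H)). apply E2, Hroot; auto. lra.
    - now rewrite Hphi0, Rabs_R0.
    - rewrite (proj1 (Hpos eps H)). apply E1, Hroot; auto. lra. }
  assert (Hsol : exists d, 0 < d /\ forall eps, Rabs eps < d -> Rabs eps < r /\ Rabs (phi eps) < r /\
    PSeries (fun k => PSeries (g k) (phi eps)) eps = 0).
  { exists (Rmin r (Rmin (d1 ^ N) (d2 ^ N))). split; [repeat apply Rmin_glb_lt; auto; now apply pow_lt|].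
    intros eps He.
    assert (X0 := Rlt_le_trans _ _ _ He (Rmin_l _ _)).
    assert (X1 := Rlt_le_trans _ _ _ He (Rle_trans _ _ _ (Rmin_r _ _) (Rmin_l _ _))).
    assert (X2 := Rlt_le_trans _ _ _ He (Rle_trans _ _ _ (Rmin_r _ _) (Rmin_r _ _))).
    split; auto. destruct (Rtotal_order eps 0) as [H|[->|H]].
    - destruct (Hneg eps H) as [E E']. rewrite E.
      destruct (B2 (root eps)) as [Y1 Y2]; [apply Hroot; auto; lra|]. rewrite <- E' in Y2. now split.
    - rewrite Hphi0, Rabs_R0, !PSeries_0. auto.
    - destruct (Hpos eps H) as [E E']. rewrite E.
      destruct (B1 (root eps)) as [Y1 Y2]; [apply Hroot; auto; lra|]. rewrite <- E' in Y2. now split. }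
  assert (Hsmall : forall c : coeffs, (forall k j, nr (nrmT (period q)) (c k j) (K / r ^ (k + j))) ->
    (forall t, c O O t = 0) -> tends_to_0 (fun eps t => sum_coeffs c eps (phi eps) t)).
  { intros c Hc Hc0 eta Heta.
    destruct (nrmT_small (period q) c r K (eta / 2) Hr Hc Hc0 ltac:(lra)) as [e [He E]].
    destruct (Hphi e He) as [e' [He' E']].
    exists (Rmin e e'). split; [now apply Rmin_glb_lt|]. intros eps t Heps.
    assert (X1 := Rlt_le_trans _ _ _ Heps (Rmin_l _ _)). assert (X2 := Rlt_le_trans _ _ _ Heps (Rmin_r _ _)).
    specialize (E eps (phi eps) t (Rlt_le _ _ X1) (Rlt_le _ _ (E' eps X2))). lra. }
  assert (Hfrac : forall c : coeffs, (forall k j, nr (nrmT (period q)) (c k j) (K / r ^ (k + j))) ->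
    fractional_power_series (period q) N (fun eps t => sum_coeffs c eps (phi eps) t)).
  { intros c Hc s [->| ->].
    - destruct (fractional_substitution (period q) c r K f1 1 N Hr Rabs_R1 HN Hc A1 Z1) as (e & rho & M & E1 & E2 & E3 & E4).
      exists e, rho, M. split; [auto|split; [auto|split; [auto|]]]. intros eps t Hpe Hlt.
      destruct (Hpos eps ltac:(lra)) as [P1 P2]. rewrite P1.
      assert (X : Rabs (root eps) < rho) by (rewrite Rabs_pos_eq by (left; apply exp_pos); exact Hlt).
      assert (Y := E4 (root eps) t X). rewrite <- P2 in Y. exact Y.
    - destruct (fractional_substitution (period q) c r K f2 (-1) N Hr ltac:(rewrite Rabs_left; lra) HN Hc A2 Z2) as (e & rho & M & E1 & E2 & E3 & E4).
      exists e, rho, M. split; [auto|split; [auto|split; [auto|]]]. intros eps t Hpe Hlt.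
      destruct (Hneg eps ltac:(lra)) as [P1 P2]. rewrite P1.
      assert (X : Rabs (root eps) < rho) by (rewrite Rabs_pos_eq by (left; apply exp_pos); exact Hlt).
      assert (Y := E4 (root eps) t X). rewrite <- P2 in Y. exact Y. }
  assert (Eb : (fun eps t => om A0 * t + sum_coeffs b eps (phi eps) t - om A0 * t) = (fun eps t => sum_coeffs b eps (phi eps) t)).
  { apply functional_extensionality; intros eps. apply functional_extensionality; intros t. ring. }
  assert (Ea : (fun eps t => A0 + sum_coeffs a eps (phi eps) t - A0) = (fun eps t => sum_coeffs a eps (phi eps) t)).
  { apply functional_extensionality; intros eps. apply functional_extensionality; intros t. ring. }
  exists (fun eps t => om A0 * t + sum_coeffs b eps (phi eps) t), (fun eps t => A0 + sum_coeffs a eps (phi eps) t).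
  split; [|split].
  - split; [|split].
    + destruct Hsol as [d [Hd Hsol]]. exists d. split; auto. intros eps He.
      destruct (Hsol eps He) as [S1 [S2 S3]].
      destruct (regular_solution W om F G A0 q hq hom' t0 b a g r K Hreg eps (phi eps) S1 S2 S3) as [R1 [R2 R3]].
      split; [exact R1|]. split.
      * intros t. replace (om A0 * (t + period q) + sum_coeffs b eps (phi eps) (t + period q) - om A0 * (t + period q))
          with (sum_coeffs b eps (phi eps) (t + period q)) by ring.
        replace (om A0 * t + sum_coeffs b eps (phi eps) t - om A0 * t) with (sum_coeffs b eps (phi eps) t) by ring.
        apply R2.
      * intros t. f_equal. f_equal. apply R3.
    + rewrite Eb. exact (Hsmall b Hb (Hb0 O)).
    + rewrite Ea. exact (Hsmall a Ha (Ha0 O)).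
  - rewrite Eb. now apply Hfrac.
  - rewrite Ea. now apply Hfrac.
Qed.
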